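(* The compositions $F(x)=(\mathcal{H}^2_+F_cf)(x)$ and $G(x)=(\mathcal{H}^2_+F_sf)(x)$ extend to bounded invertible mappings $f\mapsto F$ and $f\mapsto G$ from $L_2(\mathbb{R}_+)$ onto $L_2(\mathbb{R}_+)$, having the integral representations, for $x>0$, $$F(x)=2\sqrt{\frac{2}{\pi}}\int_0^\infty\left[\cos(xt)+\frac1\pi\sqrt{xt}\,S_{-3/2,-1/2}(xt)\right]f(t)\,dt,$$ $$G(x)=2\sqrt{\frac{2}{\pi}}\int_0^\infty\left[\sin(xt)+\frac1\pi\sqrt{xt}\,S_{-1/2,1/2}(xt)\right]f(t)\,dt,$$ where both integrals converge in the mean square sense. The inverse operators are, respectively, $$f(x)=\int_0^\infty k_c(xt)F(t)\,dt,\qquad f(x)=\int_0^\infty k_s(xt)G(t)\,dt,\quad x>0,$$ where $$k_c(x)=\frac{\sqrt x}{\pi}\sum_{k=0}^\infty\frac{(-1)^kx^{2k}}{(3/2)_{2k}}\left[\frac2\pi\psi(-1/2-2k)-\frac2\pi\log x+1\right],$$ $$k_s(x)=\frac{\sqrt x}{\pi}\sum_{k=0}^\infty\frac{(-1)^kx^{2k}}{(3/2)_{2k}}\left[1-\frac2\pi\psi(-1/2-2k)+\frac2\pi\log x\right],$$ and the integrals converge in the mean square sense. Moreover, for every $f\in L_2(\mathbb{R}_+)$, $$\|f\|\le\|F\|\le8\|f\|,\qquad\|f\|\le\|G\|\le8\|f\|.$$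
   Context: $\mathbb{R}_+=(0,\infty)$; $\|\cdot\|$ is the norm of $L_2(\mathbb{R}_+)$. The Fourier cosine, Fourier sine and half-Hartley transforms are $$(F_cf)(x)=\sqrt{\tfrac{2}{\pi}}\int_0^\infty\cos(xt)f(t)\,dt,\quad (F_sf)(x)=\sqrt{\tfrac{2}{\pi}}\int_0^\infty\sin(xt)f(t)\,dt,\quad (\mathcal{H}_+f)(x)=\sqrt{\tfrac{2}{\pi}}\int_0^\infty[\cos(xt)+\sin(xt)]f(t)\,dt,$$ understood as bounded operators on $L_2(\mathbb{R}_+)$ (extended by density, with integrals in the mean square sense), and $\mathcal{H}_+^2=\mathcal{H}_+\mathcal{H}_+$. The compositions are initially considered on the dense subspace $C_c^{(2)}(\mathbb{R}_+)$ of twice continuously differentiable functions with compact support in $\mathbb{R}_+$, and extended by continuity. An integral $\int_0^\infty k(xt)f(t)\,dt$ converges in the mean square sense if $\int_{1/N}^N k(xt)f(t)\,dt$ converges in the norm of $L_2(\mathbb{R}_+)$ (as a function of $x$) as $N\to\infty$; its value is the limit. $\psi=\Gamma'/\Gamma$ is the psi-function, and $(a)_n=a(a+1)\cdots(a+n-1)$, $(a)_0=1$, is the Pochhammer symbol. $S_{\mu,\nu}$ denotes the (second) Lommel function; for the two parameter pairs $(\mu,\nu)$ used here it is the unique solution on $(0,\infty)$ of $z^2w''+zw'+(z^2-\nu^2)w=z^{\mu+1}$ with $w(z)\sim z^{\mu-1}$ as $z\to+\infty$. *)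

(* Defs.v *)
From HB Require Import structures.
From mathcomp Require Import all_boot all_order all_algebra.
From mathcomp Require Import complex.
From mathcomp Require Import all_classical all_reals all_analysis.

Set Implicit Arguments.
Unset Strict Implicit.
Unset Printing Implicit Defensive.

Import Order.TTheory GRing.Theory Num.Theory.
Import numFieldNormedType.Exports.

Local Notation Re := complex.Re.
Local Notation Im := complex.Im.

Local Open Scope ring_scope.
Local Open Scope classical_set_scope.

Section HalfLine.
Context {R : realType}.
Local Notation C := R[i].
Local Notation mu := (@lebesgue_measure R).

Definition Rplus : set R := `]0, +oo[.

(* Elements of L_2(R_+) are represented by functions [R -> R[i]]; only their
   restriction to [Rplus] matters, and equality is [%[ae mu in Rplus]]. *)
Definition L2 (f : R -> C) : Prop :=
  ((fun x => Re (f x)) \_ Rplus \in Lfun mu 2%:E) /\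
  ((fun x => Im (f x)) \_ Rplus \in Lfun mu 2%:E).

(* Meaningful on [L2] only: [fine] sends an infinite norm to 0. *)
Definition normL2 (f : R -> C) : R :=
  fine ('N[mu]_2%:E[EFin \o ((fun x => ComplexField.Normc.normc (f x)) \_ Rplus)])%E.

Definition eqL2 (f g : R -> C) : Prop := f = g %[ae mu in Rplus].

Definition cintegral (D : set R) (f : R -> C) : C :=
  Complex (\int[mu]_(t in D) Re (f t)) (\int[mu]_(t in D) complex.Im (f t)).

Definition trunc_integral (k : R -> R) (N : R) (f : R -> C) : R -> C :=
  fun x => cintegral `[N^-1, N] (fun t => (k (x * t))%:C%C * f t).

Definition is_ms_integral (k : R -> R) (f g : R -> C) : Prop :=
  [/\ L2 g,
      \forall N \near +oo, L2 (trunc_integral k N f) &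
      normL2 (fun x => trunc_integral k N f x - g x) @[N --> +oo] --> (0 : R)].

Definition ms_convergent (k : R -> R) (f : R -> C) : Prop :=
  exists g, is_ms_integral k f g.

(* The mean square value of int_0^oo k(xt) f(t) dt, as a function of x; it is
   determined up to a.e. equality when the integral converges, and is 0 by
   convention otherwise. *)
Definition ms_integral (k : R -> R) (f : R -> C) : R -> C :=
  xget (fun=> 0) [set g | is_ms_integral k f g].

Definition scaled_ms_integral (c : R) (k : R -> R) (f : R -> C) : R -> C :=
  fun x => c%:C%C * ms_integral k f x.

Definition fourier_cos : (R -> C) -> (R -> C) :=
  scaled_ms_integral (Num.sqrt (2 / pi)) cos.

Definition fourier_sin : (R -> C) -> (R -> C) :=
  scaled_ms_integral (Num.sqrt (2 / pi)) sin.

Definition half_hartley : (R -> C) -> (R -> C) :=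
  scaled_ms_integral (Num.sqrt (2 / pi)) (fun z => cos z + sin z).

Definition bounded_operator (A : (R -> C) -> (R -> C)) : Prop :=
  [/\ forall f, L2 f -> L2 (A f),
      forall f g, L2 f -> L2 g -> eqL2 f g -> eqL2 (A f) (A g),
      forall (a : C) f g, L2 f -> L2 g ->
        eqL2 (A (fun x => a * f x + g x)) (fun x => a * A f x + A g x) &
      exists M : R, forall f, L2 f -> normL2 (A f) <= M * normL2 f].

Definition inverse_operators (A B : (R -> C) -> (R -> C)) : Prop :=
  [/\ forall f, L2 f -> eqL2 (B (A f)) f & forall g, L2 g -> eqL2 (A (B g)) g].

End HalfLine.

Section SpecialFunctions.
Context {R : realType}.
Local Notation mu := (@lebesgue_measure R).

Definition pochhammer (a : R) (n : nat) : R := \prod_(i < n) (a + i%:R).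

Definition euler_integral (x : R) : R :=
  \int[mu]_(t in Rplus) (t `^ (x - 1) * expR (- t)).

(* For x <= 0, Gamma x = Gamma (x + n) / (x)_n with the least n such that
   x + n > 0; the value at the poles is irrelevant. *)
Definition Gamma (x : R) : R :=
  if 0 < x then euler_integral x
  else let n := (Num.truncn (- x)).+1 in
       euler_integral (x + n%:R) / pochhammer x n.

Definition digamma (x : R) : R := derive1 Gamma x / Gamma x.

Definition is_lommelS (m nu : R) (w : R -> R) : Prop :=
  (forall z : R, 0 < z ->
     [/\ derivable w z 1, derivable (derive1 w) z 1 &
         z ^+ 2 * derive1n 2 w z + z * derive1 w z + (z ^+ 2 - nu ^+ 2) * w z
           = z `^ (m + 1)]) /\
  w z / z `^ (m - 1) @[z --> +oo] --> (1 : R).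

(* Only the values on (0, +oo) are meaningful. *)
Definition lommelS (m nu : R) : R -> R :=
  xget (fun=> 0) [set w | is_lommelS m nu w].

Definition kernelF (z : R) : R :=
  cos z + pi^-1 * Num.sqrt z * lommelS (- (3 / 2)) (- (1 / 2)) z.

Definition kernelG (z : R) : R :=
  sin z + pi^-1 * Num.sqrt z * lommelS (- (1 / 2)) (1 / 2) z.

Definition kernel_c (x : R) : R :=
  Num.sqrt x / pi * limn (series (fun k : nat =>
    (-1) ^+ k * x ^+ (2 * k) / pochhammer (3 / 2) (2 * k) *
    (2 / pi * digamma (- (1 / 2) - (2 * k)%:R) - 2 / pi * ln x + 1))).

Definition kernel_s (x : R) : R :=
  Num.sqrt x / pi * limn (series (fun k : nat =>
    (-1) ^+ k * x ^+ (2 * k) / pochhammer (3 / 2) (2 * k) *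
    (1 - 2 / pi * digamma (- (1 / 2) - (2 * k)%:R) + 2 / pi * ln x))).

End SpecialFunctions.

(* Main.v *)
From HB Require Import structures.
Require Import Defs.
From mathcomp Require Import all_boot all_order all_algebra.
From mathcomp Require Import complex.
From mathcomp Require Import all_classical all_reals all_analysis.
From mathcomp Require Import measurable_realfun.
From mathcomp Require Import ring lra.

Set Implicit Arguments.
Unset Strict Implicit.
Unset Printing Implicit Defensive.

Import Order.TTheory GRing.Theory Num.Theory.
Import numFieldNormedType.Exports.

Local Open Scope ring_scope.
Local Open Scope classical_set_scope.

(** Write $\kappa=\sqrt{2/\pi}$, let $L$ be the Laplace transform, $S$ the
    Stieltjes transform (kernel $1/(x+t)$), and $C_1$, $C_2$ the integral
    operators on $L_2(\mathbb{R}_+)$ with kernels $x/(x^2+t^2)$ and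
    $t/(x^2+t^2)$. All of them are bounded by the Schur test, because their
    kernels, or in the case of $L$ the rows of the kernel up to a dilation, are
    dominated by that of $S$. The proof turns every statement about the
    oscillating kernels into one about these positive kernels, by composing
    with $L$: integrating $e^{-xv}\cos(vt)$ and $e^{-xv}\sin(vt)$ in $v$ gives
    $L F_c=\kappa C_1$, $L F_s=\kappa C_2$ ([comp_LFc], [comp_LFs]) and, by
    taking adjoints, $F_c L=\kappa C_2$, $F_s L=\kappa C_1$. Since $L$ is
    injective and self-adjoint ([opL_inj]), an identity between operators may
    be checked after multiplying by $L$ on both sides ([cancel_L]). Partial
    fractions give $L^2=S$, $C_1C_2=C_2C_1=\frac\pi2S$ and
    $C_1^2+C_2^2=S^2$, hence $F_c^2=F_s^2=1$ and
    $F_cF_s+F_sF_c=\frac2\pi S$. Therefore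
    $\mathcal{H}_+^2=A:=2+\frac2\pi S$ ([Hp_sqr]).

    The integral representations are now $AF_c=2F_c+\frac2\pi\kappa LC_1$ and
    $AF_s=2F_s+\frac2\pi\kappa LC_2$ ([opF_eq], [opG_eq]). The operator $LC_1$
    has a kernel depending on $xt$ only, namely the Laplace transform of
    $u/(1+u^2)$ at $xt$, and $LC_2$ that of $1/(1+u^2)$ ([kernel_LT]). These
    two Laplace transforms $g$, $f$ satisfy $f'=-g$, $g'=f-1/z$, so that
    $g/\sqrt z$ and $f/\sqrt z$ solve the two Lommel equations with the
    required behaviour at infinity; uniqueness identifies them with the Lommel
    functions ([lommelS_f], [lommelS_g]).

    The two-sided bound of the norms holds because $F_c$ and $F_s$ are
    isometries, $\|\mathcal{H}_+\|\le2$, and $S=L^2$ is a nonnegative operator.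
    For the inverse, let $P$ have kernel $\frac2\pi\sqrt{xt}/(x^2+t^2)$. Two
    more partial fraction computations give $P^2+\frac1\pi SP^2=\frac2\pi S$,
    which says that $B=\frac12-\frac14P^2$ is the inverse of $A$ ([comp_AB]);
    the inverses of the compositions are then $F_cB$ and $F_sB$. A Laplace
    transform kernel $\varepsilon(xt)$, with $\varepsilon$ the transform of
    $\sqrt u(a+b\log u)/(1+u^2)$ for suitable $a$ and $b$, produces exactly the
    term $-\frac14P^2$ when $F_c$ or $F_s$ is applied to it ([comp_C2W],
    [comp_C1W]); so $F_cB$ has kernel $\frac\kappa2\cos+\varepsilon$, and
    similarly for the sine ([comp_FcTc], [comp_FsTs]).

    It remains to expand these kernels ([inverse_kernel_series]). With $\zeta_k$
    the terms of the announced series without the signs, $\zeta_k''=\zeta_{k-1}$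
    by the recursion of the psi function, and the remainders $d_n$ satisfy
    $d_n''=-d_{n-1}$ with zero data at $0$; integrating a bound twice at each
    step gives
    $|d_n|\le Cz^{2n+2}/(2n+2)!$. *)

(** * The Hilbert space of square-integrable functions *)

Section SquareIntegrable.
Context d (T : measurableType d) (R : realType).
Context (mu : {measure set T -> \bar R}).

Lemma Lfun2P (f : T -> R) : f \in Lfun mu 2%:E <->
  measurable_fun setT f /\ (\int[mu]_x (f x ^+ 2)%:E < +oo)%E.
Proof.
have E : measurable_fun setT f -> ('N[mu]_2%:E[EFin \o f])%E = ((\int[mu]_x (f x ^+ 2)%:E) `^ 2^-1)%E.
  move=> mf; rewrite unlock; congr (_ `^ _)%E; apply: eq_integral => x _ /=.
  by rewrite powR_mulrn// real_normK// num_real.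
split.
  rewrite inE => /andP[]; rewrite !inE/= => mf; rewrite /finite_norm E// => h.
  by split=> //; apply: (lty_poweRy _ h); rewrite invr_eq0 pnatr_eq0.
move=> [mf If]; rewrite inE; apply/andP; split; rewrite inE//=.
by rewrite /finite_norm E// poweR_lty.
Qed.

Definition L2_le : (1 <= (2%:E : \bar R))%E.
Proof. by rewrite lee_fin ler1n. Qed.

Definition L2space := LfunType mu L2_le.

Implicit Types f g h : L2space.

Definition toL2 (f : T -> R) (h : f \in Lfun mu 2%:E) : L2space := Lfun_Sub L2_le h.

Lemma L2_measurable f : measurable_fun setT f.
Proof. exact: measurable_funPT. Qed.

Lemma L2_mul_integrable f g : mu.-integrable setT (fun x => (f x * g x)%:E).
Proof. by have /Lfun1_integrable := Lfun2_mul_Lfun1 (LfunP f) (LfunP g). Qed.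

Lemma L2_lty f : (\int[mu]_x (f x ^+ 2)%:E < +oo)%E.
Proof. by have [] := (Lfun2P f).1 (LfunP f). Qed.

Definition ip f g : R := \int[mu]_x (f x * g x).

Lemma L2addE f g x : (f + g) x = f x + g x. Proof. by []. Qed.
Lemma L2scaleE (a : R) f x : (a *: f) x = a * f x. Proof. by []. Qed.
Lemma L2subE f g x : (f - g) x = f x - g x. Proof. by []. Qed.

Lemma ipC f g : ip f g = ip g f.
Proof. by apply: eq_Rintegral => x _; rewrite mulrC. Qed.

Lemma ipDl f g h : ip (f + g) h = ip f h + ip g h.
Proof.
rewrite /ip -RintegralD//; try exact: L2_mul_integrable.
by apply: eq_Rintegral => x _; rewrite L2addE mulrDl.
Qed.

Lemma ipZl a f h : ip (a *: f) h = a * ip f h.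
Proof.
rewrite /ip -RintegralZl//; last exact: L2_mul_integrable.
by apply: eq_Rintegral => x _; rewrite L2scaleE mulrA.
Qed.

Lemma ipDr f g h : ip h (f + g) = ip h f + ip h g.
Proof. by rewrite ipC ipDl !(ipC h). Qed.
Lemma ipZr a f h : ip h (a *: f) = a * ip h f.
Proof. by rewrite ipC ipZl (ipC h). Qed.
Lemma ipNl f h : ip (- f) h = - ip f h.
Proof. by rewrite -scaleN1r ipZl mulN1r. Qed.
Lemma ipNr f h : ip h (- f) = - ip h f.
Proof. by rewrite -scaleN1r ipZr mulN1r. Qed.
Lemma ipBl f g h : ip (f - g) h = ip f h - ip g h.
Proof. by rewrite ipDl ipNl. Qed.
Lemma ipBr f g h : ip h (f - g) = ip h f - ip h g.
Proof. by rewrite ipDr ipNr. Qed.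
Lemma ip_ge0 f : 0 <= ip f f.
Proof. by apply: Rintegral_ge0 => x _; rewrite -expr2 sqr_ge0. Qed.

Lemma ip_EFin f : (ip f f)%:E = (\int[mu]_x (f x ^+ 2)%:E)%E.
Proof.
rewrite /ip /Rintegral fineK; first by apply: eq_integral => x _; rewrite expr2.
exact: integrable_fin_num (L2_mul_integrable f f).
Qed.

Lemma eq_ip f f' g g' : f = f' %[ae mu] -> g = g' %[ae mu] -> ip f g = ip f' g'.
Proof.
move=> ff gg; rewrite /ip /Rintegral; congr fine; apply: ae_eq_integral => //.
- by apply/measurable_EFinP; apply: measurable_funM; exact: L2_measurable.
- by apply/measurable_EFinP; apply: measurable_funM; exact: L2_measurable.
by move: ff gg; apply: filterS2 => x /= h1 h2 _; rewrite h1// h2.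
Qed.


Lemma ip_eq0 f : ip f f = 0 -> f = (cst 0 : T -> R) %[ae mu].
Proof.
move=> f0; have := ip_EFin f; rewrite f0 => /esym I0.
have : (\int[mu]_x `| (f x ^+ 2)%:E | = 0)%E.
  by rewrite -[RHS]I0; apply: eq_integral => x _; rewrite gee0_abs// lee_fin sqr_ge0.
move/ae_eq_integral_abs => /(_ measurableT) h.
have := h (measurableT_comp (@EFin_measurable R _) (measurable_funX _ (L2_measurable f))).
apply: filterS => x /= /(_ I) [] /eqP; rewrite sqrf_eq0 => /eqP -> _; by [].
Qed.

Lemma ip_nondegenerate f g : (forall h, ip f h = ip g h) -> f = g %[ae mu].
Proof.
move=> fg; have := @ip_eq0 (f - g).
rewrite ipBl fg subrr => /(_ erefl); apply: filterS => x /= /(_ I) h _.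
by apply/eqP; rewrite -subr_eq0; apply/eqP; exact: h.
Qed.

Definition hn f : R := Num.sqrt (ip f f).

Lemma hn_ge0 f : 0 <= hn f. Proof. exact: sqrtr_ge0. Qed.

Lemma hn_sqr f : hn f ^+ 2 = ip f f. Proof. by rewrite sqr_sqrtr// ip_ge0. Qed.

Lemma hnZ a f : hn (a *: f) = `|a| * hn f.
Proof. by rewrite /hn ipZl ipZr mulrA -expr2 sqrtrM ?sqr_ge0// sqrtr_sqr. Qed.

Lemma hnN f : hn (- f) = hn f.
Proof. by rewrite /hn ipNl ipNr opprK. Qed.

Lemma hnBC f g : hn (f - g) = hn (g - f).
Proof. by rewrite -hnN opprB. Qed.

Lemma ip_sqr_le f g : ip f g ^+ 2 <= ip f f * ip g g.
Proof.
have key t : 0 <= ip f f - 2 * t * ip f g + t ^+ 2 * ip g g.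
  have := ip_ge0 (f - t *: g); rewrite !(ipBl, ipBr, ipZl, ipZr) (ipC g f); lra.
have [g0|g0] := eqVneq (ip g g) 0; last first.
  have gp : 0 < ip g g by rewrite lt_neqAle eq_sym g0 ip_ge0.
  have := key (ip f g / ip g g) => h.
  have := mulr_ge0 (ltW gp) h.
  have -> : ip g g * (ip f f - 2 * (ip f g / ip g g) * ip f g +
     (ip f g / ip g g) ^+ 2 * ip g g) = ip f f * ip g g - ip f g ^+ 2.
    by field.
  by rewrite subr_ge0.
rewrite g0 mulr0; have [->|c0] := eqVneq (ip f g) 0; first by rewrite expr0n.
have := key ((ip f f + 1) / (2 * ip f g)); rewrite g0 mulr0 addr0.
have -> : ip f f - 2 * ((ip f f + 1) / (2 * ip f g)) * ip f g = -1 by field.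
lra.
Qed.

Lemma ip_le f g : `|ip f g| <= hn f * hn g.
Proof.
rewrite -(@ler_pXn2r _ 2)// ?nnegrE ?mulr_ge0 ?hn_ge0//.
by rewrite real_normK ?num_real// exprMn !hn_sqr ip_sqr_le.
Qed.

Lemma hnD f g : hn (f + g) <= hn f + hn g.
Proof.
rewrite -(@ler_pXn2r _ 2)// ?nnegrE ?addr_ge0 ?hn_ge0//.
rewrite sqrrD !hn_sqr ipDl !ipDr (ipC g f).
have := le_trans (ler_norm _) (ip_le f g); lra.
Qed.

Lemma hnB f g : hn (f - g) <= hn f + hn g.
Proof. by rewrite -(hnN g) hnD. Qed.

Lemma hn_triangle f g h : hn (f - h) <= hn (f - g) + hn (g - h).
Proof. by apply: le_trans (hnD _ _); rewrite addrA subrK. Qed.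

Lemma eq_hn f g : f = g %[ae mu] -> hn f = hn g.
Proof. by move=> fg; rewrite /hn (eq_ip fg fg). Qed.

Lemma hn_eq0 f : hn f = 0 -> f = (cst 0 : T -> R) %[ae mu].
Proof. by move=> f0; apply: ip_eq0; rewrite -hn_sqr f0 expr0n. Qed.

Lemma hn_EFin f : ((hn f ^+ 2)%:E = \int[mu]_x (f x ^+ 2)%:E)%E.
Proof. by rewrite hn_sqr ip_EFin. Qed.

End SquareIntegrable.

Section Completeness.
Context d (T : measurableType d) (R : realType).
Context (mu : {measure set T -> \bar R}).
Local Notation H := (L2space mu).

(** A sequence whose successive distances decrease geometrically converges
    almost everywhere, since the sum of the normalised squared differences is
    integrable; Fatou's lemma then gives convergence in norm. *)
Lemma L2_fast_cvg (v : nat -> H) :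
  (forall j k, (j <= k)%N -> hn (v j - v k) ^+ 2 <= 8^-1 ^+ j) ->
  exists l : H, forall j, hn (v j - l) ^+ 2 <= 8^-1 ^+ j.
Proof.
move=> vj.
pose D k := v k.+1 - v k.
have mv k : measurable_fun setT (v k) by exact: L2_measurable.
have mD k : measurable_fun setT (D k) by exact: L2_measurable.
(* The factor $4^k$ makes the convergence of the sum at a point imply that of
   the sequence. *)
pose s x := (\sum_(0 <= k <oo) ((4 : R) ^+ k * D k x ^+ 2)%:E)%E.
have s_ge0 k x : ((0 : \bar R) <= (4 ^+ k * D k x ^+ 2)%:E)%E.
  by rewrite lee_fin mulr_ge0 ?sqr_ge0 ?exprn_ge0.
have ms k : measurable_fun setT (fun x => (4 ^+ k * D k x ^+ 2)%:E).
  by apply/measurable_EFinP; apply: measurable_funM => //; apply: measurable_funX.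
have Is : (\int[mu]_x s x < +oo)%E.
  rewrite integral_nneseries//.
  apply: (@le_lt_trans _ _ (\sum_(0 <= k <oo) ((2^-1 : R) ^+ k)%:E)%E).
    apply: lee_nneseries => [k _ _|k _].
      by apply: integral_ge0 => x _; exact: s_ge0.
    under eq_integral do rewrite EFinM.
    rewrite ge0_integralZl_EFin ?exprn_ge0//; last 2 first.
      - by move=> x _; rewrite lee_fin sqr_ge0.
      - by apply/measurable_EFinP; apply: measurable_funX.
    rewrite -hn_EFin -EFinM lee_fin /D hnBC.
    apply: (le_trans (ler_wpM2l _ (vj k k.+1 (leqnSn _)))); first exact: exprn_ge0.
    rewrite -exprMn; apply: lerXn2r; rewrite ?nnegrE//; lra.
  have := @cvg_geometric_series R 1 2^-1.
  rewrite ger0_norm ?invr_ge0// => /(_ ltac:(lra)) h.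
  have -> : (\sum_(0 <= k <oo) ((2^-1 : R) ^+ k)%:E = (1 / (1 - 2^-1))%:E)%E.
    apply/cvg_lim => //.
    rewrite (_ : (fun n => _) = EFin \o series (geometric 1 2^-1)); first by apply: cvg_EFin; [exact: nearW|].
    apply/funext => n /=; rewrite /series /= sumEFin; congr EFin.
    by apply: eq_bigr => i _; rewrite /geometric /= mul1r.
  exact: ltry.
have msx : measurable_fun setT s by apply: ge0_emeasurable_sum.
have s0 x : (0 <= s x)%E by apply: nneseries_ge0.
have aes : {ae mu, forall x, (s x < +oo)%E}.
  have : mu.-integrable setT s.
    apply/integrableP; split => //; under eq_integral do rewrite gee0_abs//.
    by [].
  move=> /(integrable_ae measurableT); apply: filterS => x /(_ I).
  by rewrite ge0_fin_numE.
pose l x := fine (limn_esup (fun k => (v k x)%:E)).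
have ml : measurable_fun setT l.
  apply: (measurableT_comp (@fine_measurable R setT measurableT)).
  by apply: measurable_fun_limn_esup => k; apply/measurable_EFinP.
have cvl : {ae mu, forall x, v k x @[k --> \oo] --> l x}.
  move: aes; apply: filterS => x sx.
  have Dx k : `|D k x| <= Num.sqrt (fine (s x)) * 2^-1 ^+ k.
    rewrite -(@ler_pXn2r _ 2)// ?nnegrE ?mulr_ge0 ?sqrtr_ge0 ?exprn_ge0 ?invr_ge0//.
    rewrite real_normK ?num_real// exprMn sqr_sqrtr ?fine_ge0//.
    rewrite -exprM mulnC exprM.
    have -> : (2^-1 : R) ^+ 2 = 4^-1 by field.
    rewrite exprVn ler_pdivlMr ?exprn_gt0// mulrC -lee_fin fineK ?ge0_fin_numE//.
    apply: le_trans (nneseries_lim_ge k.+1 (fun n _ _ => s_ge0 n x)).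
    rewrite big_nat_recr//= leeDr//; apply: sume_ge0 => i _; exact: s_ge0.
  have cv : cvgn (fun k => v k x).
    have : cvgn (series (telescope (fun k => v k x))).
      apply: (@normed_cvg _ R^o).
      apply: (@series_le_cvg _ _ (geometric (Num.sqrt (fine (s x))) 2^-1)) => [k|k|k|].
      - exact: normr_ge0.
      - by rewrite /geometric mulr_ge0 ?sqrtr_ge0// exprn_ge0.
      - exact: Dx.
      - by apply: is_cvg_geometric_series; rewrite ger0_norm ?invr_ge0//; lra.
    rewrite telescopeK => /cvgP.
    move=> /cvg_ex[a ca]; apply/cvg_ex; exists (a + v 0%N x).
    rewrite (_ : (fun k => v k x) = (fun k => (v k x - v 0%N x) + v 0%N x)); last first.
      by apply/funext => k; rewrite subrK.
    by apply: cvgD => //; exact: cvg_cst.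
  have := cv => /cvg_ex[a ca].
  have cE : (fun k => (v k x)%:E) @ \oo --> a%:E by apply: cvg_EFin; [exact: nearW|].
  by rewrite /l (cvg_limn_einf_sup cE).2.
have lj j : (\int[mu]_x ((v j x - l x) ^+ 2)%:E <= (8^-1 ^+ j)%:E)%E.
  rewrite (@ae_eq_integral _ _ _ mu setT
    (fun x => limn_einf (fun k => ((v j x - v k x) ^+ 2)%:E)))//.
  - apply: le_trans (fatou mu measurableT _ _) _.
    + move=> k; apply/measurable_EFinP; apply: measurable_funX.
      exact: measurable_funB.
    + by move=> k x _; rewrite lee_fin sqr_ge0.
    apply: (@le_trans _ _ (limn_einf (fun k => (hn (v j - v k) ^+ 2)%:E))).
      rewrite (_ : (fun k => (hn (v j - v k) ^+ 2)%:E) =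
        (fun k => \int[mu]_x ((v j x - v k x) ^+ 2)%:E)%E)//.
      by apply/funext => k; exact: hn_EFin.
    rewrite limn_einf_lim; apply: lime_le; first exact: is_cvg_einfs.
    exists j => // k /= jk.
    apply: (@le_trans _ _ ((hn (v j - v k) ^+ 2)%:E)); last by rewrite lee_fin vj.
    by apply: ereal_inf_lbound; exists k => //=.
  - apply/measurable_EFinP; apply: measurable_funX; exact: measurable_funB.
  - rewrite (_ : (fun x => _) = (fun x =>
        - limn_esup (fun k => - ((v j x - v k x) ^+ 2)%:E))%E); last first.
      by apply/funext => x; rewrite -[LHS]oppeK -limn_esupN.
    apply: measurableT_comp => //; apply: measurable_fun_limn_esup => k.
    apply: measurableT_comp => //.
    by apply/measurable_EFinP; apply: measurable_funX; exact: measurable_funB.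
  - move: cvl; apply: filterS => x cx _; apply/esym.
    apply: (cvg_limn_einf_sup _).1.
    apply: cvg_EFin; first exact: nearW.
    rewrite expr2.
    under eq_fun do rewrite expr2.
    by apply: cvgM; apply: cvgB => //; exact: cvg_cst.
have dP j : (fun x => v j x - l x) \in Lfun mu 2%:E.
  apply/Lfun2P; split; first exact: measurable_funB.
  by rewrite (le_lt_trans (lj j))// ltry.
have lP : l \in Lfun mu 2%:E.
  rewrite (_ : l = v 0%N - toL2 (dP 0%N)); first exact: LfunP.
  by apply/funext => x; rewrite L2subE /=; lra.
exists (toL2 lP) => j; rewrite -lee_fin hn_EFin.
exact: lj.
Qed.

(** Completeness, from a rapidly convergent subsequence. *)
Lemma L2_complete (u : nat -> H) :
  (forall e, 0 < e -> exists N, forall m n, (N <= m)%N -> (N <= n)%N -> hn (u m - u n) <= e) ->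
  exists l : H, hn (u n - l) @[n --> \oo] --> (0 : R).
Proof.
move=> uC.
have s8 j : 0 < Num.sqrt (8^-1 ^+ j) :> R by rewrite sqrtr_gt0 exprn_gt0// invr_gt0.
have /choice [phi phiP] : forall j, exists N, forall m n, (N <= m)%N -> (N <= n)%N ->
    hn (u m - u n) <= Num.sqrt (8^-1 ^+ j).
  by move=> j; apply: uC.
pose nn k := (\max_(i < k.+1) phi i)%N.
have phi_nn j k : (j <= k)%N -> (phi j <= nn k)%N.
  move=> jk; have jk' : (j < k.+1)%N by rewrite ltnS.
  exact: (leq_bigmax (Ordinal jk')).
have sq8 j (f : H) : hn f <= Num.sqrt (8^-1 ^+ j) -> hn f ^+ 2 <= 8^-1 ^+ j.
  move=> hf; rewrite -[leRHS]sqr_sqrtr; last by rewrite exprn_ge0// invr_ge0.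
  by apply: lerXn2r; rewrite ?nnegrE ?hn_ge0 ?sqrtr_ge0.
have [l lP] : exists l : H, forall j, hn (u (nn j) - l) ^+ 2 <= 8^-1 ^+ j.
  by apply: L2_fast_cvg => j k jk; apply: sq8; apply: phiP; apply: phi_nn.
exists l; apply/cvgrPdist_le => /= e e0.
have [j je] : exists j, 2 * Num.sqrt (8^-1 ^+ j) <= e.
  have h8 : (8^-1 : R) ^+ k @[k --> \oo] --> 0.
    by apply: cvg_expr; rewrite ger0_norm ?invr_ge0//; lra.
  have e2 : 0 < (e / 2) ^+ 2 by rewrite exprn_gt0// divr_gt0.
  move/cvgrPdist_le : h8 => /(_ _ e2)[j _ /(_ _ (leqnn j))].
  rewrite sub0r normrN ger0_norm ?exprn_ge0 ?invr_ge0// => h.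
  exists j; rewrite mulrC -ler_pdivlMr//.
  rewrite -[leRHS]ger0_norm ?divr_ge0 ?(ltW e0)// -sqrtr_sqr.
  by rewrite ler_wsqrtr.
exists (phi j) => // n /= jn; rewrite sub0r normrN ger0_norm ?hn_ge0//.
apply: le_trans je; apply: le_trans (hn_triangle _ (u (nn j)) _) _.
rewrite [leRHS]mulr_natl [leRHS]mulr2n; apply: lerD; first by apply: phiP => //; exact: phi_nn.
rewrite -(@ler_pXn2r _ 2)// ?nnegrE ?hn_ge0 ?sqrtr_ge0//.
by rewrite [leRHS]sqr_sqrtr ?exprn_ge0 ?invr_ge0.
Qed.

End Completeness.

(** * Bounded operators with an adjoint *)

Section Operators.
Context d (T : measurableType d) (R : realType).
Context (mu : {measure set T -> \bar R}).
Local Notation H := (L2space mu).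

(** Linearity is not a field: a map with an adjoint is linear up to almost
    everywhere equality ([op_lin]), which is the only sense in which it could
    be linear here. *)
Record op := Op {
  op_fun :> H -> H;
  op_adj : H -> H;
  op_bnd : R;
  op_bnd_ge0 : 0 <= op_bnd;
  op_adjP : forall f g, ip (op_fun f) g = ip f (op_adj g);
  op_bndP : forall f, hn (op_fun f) <= op_bnd * hn f }.

Implicit Types A B C : op.

Lemma op_adj_bndP A f : hn (op_adj A f) <= op_bnd A * hn f.
Proof.
have [h0|h0] := eqVneq (hn (op_adj A f)) 0.
  by rewrite h0 mulr_ge0 ?op_bnd_ge0 ?hn_ge0.
have hp : 0 < hn (op_adj A f) by rewrite lt_neqAle eq_sym h0 hn_ge0.
rewrite -(ler_pM2l hp) -expr2 hn_sqr -op_adjP.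
apply: le_trans (ler_norm _) _; apply: le_trans (ip_le _ _) _.
rewrite mulrCA mulrA; apply: ler_wpM2r; first exact: hn_ge0.
exact: op_bndP.
Qed.

Lemma op_adjP' A f g : ip (op_adj A f) g = ip f (A g).
Proof. by rewrite ipC -op_adjP ipC. Qed.

Definition opadj A : op := Op (op_bnd_ge0 A) (op_adjP' A) (op_adj_bndP A).

(** Equality of all matrix entries, which is almost everywhere equality of the
    values ([opeqP]); in this form it is visibly a congruence for all the
    operations, and is used for setoid rewriting. *)
Definition opeq A B := forall f g, ip (A f) g = ip (B f) g.

Lemma opeqP A B : opeq A B <-> forall f, A f = B f %[ae mu].
Proof.
split=> [h f|h f g]; first by apply: ip_nondegenerate => g.
by apply: eq_ip => //; exact: ae_eq_refl.
Qed.

#[global] Instance opeq_equiv : RelationClasses.Equivalence opeq.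
Proof.
split=> [A f g//|A B h f g|A B C h1 h2 f g]; first by rewrite h.
by rewrite h1 h2.
Qed.

Lemma op_ae A (f g : H) : f = g %[ae mu] -> A f = A g %[ae mu].
Proof.
move=> fg; apply: ip_nondegenerate => h; rewrite !op_adjP.
by apply: eq_ip => //; exact: ae_eq_refl.
Qed.

Lemma ip_opD A f g h : ip (A (f + g)) h = ip (A f) h + ip (A g) h.
Proof. by rewrite op_adjP ipDl -!op_adjP. Qed.

Lemma ip_opZ A a f h : ip (A (a *: f)) h = a * ip (A f) h.
Proof. by rewrite op_adjP ipZl -!op_adjP. Qed.

Lemma ip_opN A f h : ip (A (- f)) h = - ip (A f) h.
Proof. by rewrite -scaleN1r ip_opZ mulN1r. Qed.

Lemma ip_opB A f g h : ip (A (f - g)) h = ip (A f) h - ip (A g) h.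
Proof. by rewrite ip_opD ip_opN. Qed.

Lemma op_lin A a (f g : H) : A (a *: f + g) = a *: A f + A g %[ae mu].
Proof. by apply: ip_nondegenerate => h; rewrite ip_opD ip_opZ ipDl ipZl. Qed.

Lemma hn_opB A f g : hn (A f - A g) <= op_bnd A * hn (f - g).
Proof.
rewrite (@eq_hn _ _ _ _ _ (A (f - g))) ?op_bndP//.
by apply: ip_nondegenerate => h; rewrite ipBl ip_opB.
Qed.

Lemma opcomp_subproof1 A B f g : ip (A (B f)) g = ip f (op_adj B (op_adj A g)).
Proof. by rewrite !op_adjP. Qed.
Lemma opcomp_subproof2 A B f : hn (A (B f)) <= op_bnd A * op_bnd B * hn f.
Proof.
apply: le_trans (op_bndP _ _) _; rewrite -mulrA ler_wpM2l ?op_bnd_ge0//.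
exact: op_bndP.
Qed.
Definition opcomp A B : op :=
  Op (mulr_ge0 (op_bnd_ge0 A) (op_bnd_ge0 B)) (opcomp_subproof1 A B) (opcomp_subproof2 A B).

Lemma opadd_subproof1 A B f g : ip (A f + B f) g = ip f (op_adj A g + op_adj B g).
Proof. by rewrite ipDl ipDr !op_adjP. Qed.
Lemma opadd_subproof2 A B f : hn (A f + B f) <= (op_bnd A + op_bnd B) * hn f.
Proof. by apply: le_trans (hnD _ _) _; rewrite mulrDl; apply: lerD; exact: op_bndP. Qed.
Definition opadd A B : op :=
  Op (addr_ge0 (op_bnd_ge0 A) (op_bnd_ge0 B)) (opadd_subproof1 A B) (opadd_subproof2 A B).

Lemma opscale_subproof1 a A f g : ip (a *: A f) g = ip f (a *: op_adj A g).
Proof. by rewrite ipZl ipZr !op_adjP. Qed.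
Lemma opscale_subproof2 a A f : hn (a *: A f) <= (`|a| * op_bnd A) * hn f.
Proof. by rewrite hnZ -mulrA ler_wpM2l ?normr_ge0//; exact: op_bndP. Qed.
Definition opscale a A : op :=
  Op (mulr_ge0 (normr_ge0 a) (op_bnd_ge0 A)) (opscale_subproof1 a A) (opscale_subproof2 a A).

Lemma opone_subproof (f : H) : hn f <= 1 * hn f. Proof. by rewrite mul1r. Qed.
Definition opone : op := Op ler01 (fun f g => erefl (ip f g)) opone_subproof.

Local Notation "A ≡ B" := (opeq A B) (at level 70).
Local Notation "A ∘ B" := (opcomp A B) (at level 40, left associativity).
Local Notation "A ⊕ B" := (opadd A B) (at level 50, left associativity).
Local Notation "a ⊙ A" := (opscale a A) (at level 36, right associativity).

#[global] Instance opcomp_proper : Morphisms.Proper (Morphisms.respectful opeq (Morphisms.respectful opeq opeq)) opcomp.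
Proof. by move=> A B AB C D CD f g /=; rewrite AB (op_adjP B) CD -op_adjP. Qed.
#[global] Instance opadd_proper : Morphisms.Proper (Morphisms.respectful opeq (Morphisms.respectful opeq opeq)) opadd.
Proof. by move=> A B AB C D CD f g /=; rewrite !ipDl AB CD. Qed.
#[global] Instance opscale_proper : Morphisms.Proper (Morphisms.respectful eq (Morphisms.respectful opeq opeq)) opscale.
Proof. by move=> a _ <- C D CD f g /=; rewrite !ipZl CD. Qed.
#[global] Instance opadj_proper : Morphisms.Proper (Morphisms.respectful opeq opeq) opadj.
Proof. by move=> A B AB f g /=; rewrite !op_adjP' ipC -(ipC (B g)) AB. Qed.

Lemma opcompA A B C : A ∘ (B ∘ C) ≡ A ∘ B ∘ C. Proof. by []. Qed.
Lemma opcomp1o A : opone ∘ A ≡ A. Proof. by []. Qed.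
Lemma opcompo1 A : A ∘ opone ≡ A. Proof. by []. Qed.
Lemma opcompDl A B C : (A ⊕ B) ∘ C ≡ (A ∘ C) ⊕ (B ∘ C). Proof. by []. Qed.
Lemma opcompDr A B C : A ∘ (B ⊕ C) ≡ (A ∘ B) ⊕ (A ∘ C).
Proof. by move=> f g /=; rewrite ipDl ip_opD. Qed.
Lemma opcompZl a A B : (a ⊙ A) ∘ B ≡ a ⊙ (A ∘ B). Proof. by []. Qed.
Lemma opcompZr a A B : A ∘ (a ⊙ B) ≡ a ⊙ (A ∘ B).
Proof. by move=> f g /=; rewrite ipZl ip_opZ. Qed.
Lemma opscaleA a b A : a ⊙ (b ⊙ A) ≡ (a * b) ⊙ A.
Proof. by move=> f g /=; rewrite !ipZl mulrA. Qed.
Lemma opscale1 A : 1 ⊙ A ≡ A.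
Proof. by move=> f g /=; rewrite !ipZl mul1r. Qed.
Lemma opscaleDr a A B : a ⊙ (A ⊕ B) ≡ (a ⊙ A) ⊕ (a ⊙ B).
Proof. by move=> f g /=; rewrite !(ipZl, ipDl) mulrDr. Qed.

(** An operator with trivial kernel can be cancelled on the left; taking
    adjoints, one whose adjoint has trivial kernel can be cancelled on the
    right. *)
Lemma opcancel_l (L : op) A B : (forall f : H, L f = (cst 0 : T -> R) %[ae mu] -> f = (cst 0 : T -> R) %[ae mu]) ->
  L ∘ A ≡ L ∘ B -> A ≡ B.
Proof.
move=> inj /opeqP h; apply/opeqP => f.
have : A f - B f = (cst 0 : T -> R) %[ae mu].
  apply: inj; have e : L (A f - B f) = L (A f) - L (B f) %[ae mu].
    by apply: ip_nondegenerate => g; rewrite ipBl ip_opB.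
  move: e (h f); apply: filterS2 => x /(_ I) e1 /(_ I) e2 _; rewrite e1 L2subE.
  by apply/eqP; rewrite subr_eq0; apply/eqP.
apply: filterS => x /(_ I) + _; rewrite L2subE => /eqP.
by rewrite subr_eq0 => /eqP.
Qed.

Lemma opadj_comp A B : opadj (A ∘ B) ≡ opadj B ∘ opadj A. Proof. by []. Qed.
Lemma opadjK A : opadj (opadj A) ≡ A. Proof. by []. Qed.

Lemma opcancel_r (L : op) A B :
  (forall f : H, opadj L f = (cst 0 : T -> R) %[ae mu] -> f = (cst 0 : T -> R) %[ae mu]) ->
  A ∘ L ≡ B ∘ L -> A ≡ B.
Proof.
move=> inj h; rewrite -(opadjK A) -(opadjK B).
apply: opadj_proper; apply: (opcancel_l inj).
by rewrite -!opadj_comp h.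
Qed.

End Operators.

Notation "A ≡ B" := (opeq A B) (at level 70).
Notation "A ∘ B" := (opcomp A B) (at level 40, left associativity).
Notation "A ⊕ B" := (opadd A B) (at level 50, left associativity).
Notation "a ⊙ A" := (opscale a A) (at level 36, right associativity).

(** * The Schur test *)

Lemma measurable_invr (R : realType) : measurable_fun setT (@GRing.inv R).
Proof.
rewrite (_ : @GRing.inv R = fun x => x * (x ^+ 2) `^ (-1)).
  apply: measurable_funM => //.
  apply: (@measurableT_comp _ _ _ _ _ _ (fun y : R => y `^ (-1))).
    exact: measurable_powR.
  by apply: (@measurable_funX _ _ _ _ id).
apply/funext => x; rewrite powR_inv1 ?sqr_ge0//.
have [->|x0] := eqVneq x 0; first by rewrite invr0 mul0r.
by rewrite expr2 invfM mulrA mulfV// mul1r.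
Qed.

Lemma measurable_sqrtr (R : realType) : measurable_fun setT (@Num.sqrt R).
Proof. by apply: continuous_measurable_fun => x; exact: sqrt_continuous. Qed.

Section SchurTest.
Context d (T : measurableType d) (R : realType).
Context (mu : {sigma_finite_measure set T -> \bar R}).
Local Notation H := (L2space mu).
Local Open Scope ereal_scope.

(** Hoelder's inequality for the exponent 2, in a form without square roots
    that also makes sense when an integral is infinite. *)
Lemma cauchy_schwarz_ereal (a b : T -> R) :
  measurable_fun setT a -> measurable_fun setT b ->
  (\int[mu]_x (`|a x * b x|)%:E) * (\int[mu]_x (`|a x * b x|)%:E) <=
  (\int[mu]_x (a x ^+ 2)%:E) * (\int[mu]_x (b x ^+ 2)%:E).
Proof.
move=> ma mb.
have N2 (f : T -> R) : ('N[mu]_2%:E[EFin \o f] = (\int[mu]_x (f x ^+ 2)%:E) `^ 2^-1).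
  rewrite unlock; congr (_ `^ _); apply: eq_integral => x _ /=.
  by rewrite powR_mulrn// real_normK// num_real.
have half (A : \bar R) : 0 <= A -> A `^ 2^-1 * A `^ 2^-1 = A.
  case: A => [r| |//] r0.
    rewrite poweR_EFin -EFinM; congr EFin.
    by rewrite powR12_sqrt// -expr2 sqr_sqrtr.
  by rewrite poweRyr ?invr_eq0// mulyy.
have A0 (f : T -> R) : 0 <= \int[mu]_x (f x ^+ 2)%:E.
  by apply: integral_ge0 => x _; rewrite lee_fin sqr_ge0.
have := @hoelder _ _ _ mu a b 2 2 ma mb ltac:(done) ltac:(done) ltac:(by field).
rewrite Lnorm1 !N2 /= => h.
rewrite -[X in _ <= X * _]half// -[X in _ <= _ * X]half// muleACA.
by apply: lee_pmul => //; apply: integral_ge0.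
Qed.

Variable w : T -> R.
Hypothesis mw : measurable_fun setT w.
Hypothesis w_gt0 : forall x, (0 < w x)%R.

(** Hypotheses of the Schur test: $K$ and its transpose map the weight $w$
    below $Mw$. *)
Record schur (K : T -> T -> R) (M : R) : Prop := Schur {
  schur_meas : measurable_fun setT (fun p : T * T => K p.1 p.2);
  schur_gt0 : (0 < M)%R;
  schur_row : {ae mu, forall x, \int[mu]_t (`|K x t| * w t)%:E <= (M * w x)%:E};
  schur_col : {ae mu, forall t, \int[mu]_x (`|K x t| * w x)%:E <= (M * w t)%:E} }.

Lemma schur_tr K M : schur K M -> schur (fun x t => K t x) M.
Proof.
by move=> [mK M0 h1 h2]; split => //; exact: (measurableT_comp mK (measurable_fun_pair measurable_snd measurable_fst)).
Qed.

Lemma measurable_row K x : measurable_fun setT (fun p : T * T => K p.1 p.2) ->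
  measurable_fun setT (K x : T -> R).
Proof. by move=> mK; exact: (measurableT_comp mK (pair1_measurable x)). Qed.

Lemma measurable_col K t : measurable_fun setT (fun p : T * T => K p.1 p.2) ->
  measurable_fun setT (fun x => K x t : R).
Proof. by move=> mK; exact: (measurableT_comp mK (pair2_measurable t)). Qed.

Lemma measurable_kint (K : T -> T -> R) : measurable_fun setT (fun p : T * T => K p.1 p.2) ->
  measurable_fun setT (fun x => (\int[mu]_t K x t)%R).
Proof.
move=> mK; rewrite /Rintegral.
apply: (measurableT_comp (@fine_measurable R setT measurableT)).
rewrite (_ : (fun x => _) = (fun x => \int[mu]_t ((fun p : T * T => (K p.1 p.2)%:E)^\+ (x, t)) -
  \int[mu]_t ((fun p : T * T => (K p.1 p.2)%:E)^\- (x, t)))); last first.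
  apply/funext => x; rewrite integralE.
  by congr (_ - _); apply: eq_integral => t _; rewrite ?funeposE ?funenegE.
by apply: emeasurable_funB; apply: (@measurable_fun_fubini_tonelli_F _ _ _ _ _ mu) => //;
  [apply: measurable_funepos|apply: measurable_funeneg]; exact/measurable_EFinP.
Qed.

Section bound.
Variables (K : T -> T -> R) (M : R).
Hypothesis sK : schur K M.
Variable f : T -> R.
Hypothesis mf : measurable_fun setT f.
Let mK := schur_meas sK.

Let mKf : measurable_fun setT (fun p : T * T => (K p.1 p.2 * f p.2)%R).
Proof. by apply: measurable_funM => //; exact: measurableT_comp. Qed.

Definition kabs (x : T) : \bar R := \int[mu]_t (`|K x t * f t|)%:E.

Lemma measurable_kabs : measurable_fun setT kabs.
Proof.
apply: (@measurable_fun_fubini_tonelli_F _ _ _ _ _ mu (fun p => (`|K p.1 p.2 * f p.2|)%:E)) => //.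
by apply/measurable_EFinP; exact: measurableT_comp.
Qed.

Lemma kabs_ge0 x : 0 <= kabs x.
Proof. by apply: integral_ge0. Qed.

(** Splitting $|Kf|=\sqrt{|K|w}\cdot\sqrt{|K|/w}\,|f|$ in the Cauchy-Schwarz
    inequality bounds $(\int|K(x,t)f(t)|dt)^2$ by
    $Mw(x)\int|K(x,t)|w(t)^{-1}f(t)^2dt$; integrating in $x$ and exchanging the
    integrals uses the second half of the hypotheses. *)
Lemma kabs_bound : \int[mu]_x (kabs x * kabs x) <= (M ^+ 2)%:E * \int[mu]_x (f x ^+ 2)%:E.
Proof.
have M0 := schur_gt0 sK.
have mKa : measurable_fun setT (fun p : T * T => `|K p.1 p.2|%R) by exact: measurableT_comp.
have mwi : measurable_fun setT (fun x => (w x)^-1%R).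
  exact: (measurableT_comp (@measurable_invr R)).
pose F (p : T * T) := (M * w p.1 * (`|K p.1 p.2| * (f p.2 ^+ 2 / w p.2)))%R.
have mF : measurable_fun setT F.
  apply: measurable_funM.
    by apply: measurable_funM => //; exact: measurableT_comp.
  apply: measurable_funM => //; apply: measurable_funM.
    by apply: measurable_funX; exact: measurableT_comp.
  exact: (measurableT_comp mwi).
have F0 p : (0 <= F p)%R.
  rewrite /F; apply: mulr_ge0; first by rewrite mulr_ge0 ?ltW.
  by apply: mulr_ge0 => //; rewrite divr_ge0 ?sqr_ge0 ?ltW.
apply: (@le_trans _ _ (\int[mu]_x \int[mu]_t (F (x, t))%:E)).
  apply: ae_ge0_le_integral => //.
  - by move=> x _; rewrite mule_ge0 ?kabs_ge0.
  - by apply: emeasurable_funM; exact: measurable_kabs.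
  - by move=> x _; apply: integral_ge0 => t _; rewrite lee_fin.
  - apply: (@measurable_fun_fubini_tonelli_F _ _ _ _ _ mu (fun p => (F p)%:E)) => //.
    exact/measurable_EFinP.
  move: (schur_row sK); apply: filterS => x hx _.
  have mKx := measurable_row x mK.
  have mKax : measurable_fun setT (fun t => `|K x t|%R) by exact: measurableT_comp.
  have := @cauchy_schwarz_ereal (fun t => Num.sqrt (`|K x t| * w t))
    (fun t => Num.sqrt (`|K x t| / w t) * f t)%R.
  have msq : measurable_fun setT (@Num.sqrt R).
    exact: measurable_sqrtr.
  move=> /(_ (measurableT_comp msq (measurable_funM mKax mw))).
  move=> /(_ (measurable_funM (measurableT_comp msq (measurable_funM mKax mwi)) mf)) /=.
  have -> : \int[mu]_t (`|Num.sqrt (`|K x t| * w t) * (Num.sqrt (`|K x t| / w t) * f t)|)%:E = kabs x.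
    apply: eq_integral => t _; congr EFin.
    rewrite mulrA -sqrtrM ?mulr_ge0// ?ltW//.
    rewrite (_ : (`|K x t| * w t * (`|K x t| / w t))%R = (`|K x t| ^+ 2)%R); last first.
      by field; rewrite gt_eqF.
    by rewrite sqrtr_sqr normr_id !normrM normr_id.
  have -> : \int[mu]_t (Num.sqrt (`|K x t| * w t) ^+ 2)%:E = \int[mu]_t (`|K x t| * w t)%:E.
    by apply: eq_integral => t _; rewrite sqr_sqrtr// mulr_ge0// ltW.
  have -> : \int[mu]_t ((Num.sqrt (`|K x t| / w t) * f t) ^+ 2)%:E =
      \int[mu]_t (`|K x t| * (f t ^+ 2 / w t))%:E.
    apply: eq_integral => t _; rewrite exprMn sqr_sqrtr ?divr_ge0// ?ltW//.
    by congr EFin; field; rewrite gt_eqF.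
  move=> /le_trans; apply.
  apply: (@le_trans _ _ ((M * w x)%:E * \int[mu]_t (`|K x t| * (f t ^+ 2 / w t))%:E)).
    apply: lee_wpmul2r => //.
    by apply: integral_ge0 => t _; rewrite lee_fin mulr_ge0// divr_ge0 ?sqr_ge0 ?ltW.
  rewrite -ge0_integralZl_EFin//.
  - by move=> t _; rewrite lee_fin mulr_ge0// divr_ge0 ?sqr_ge0 ?ltW.
  - apply/measurable_EFinP; apply: measurable_funM => //; apply: measurable_funM => //.
    exact: measurable_funX.
  - by rewrite mulr_ge0 ?ltW.
rewrite (@fubini_tonelli _ _ _ _ _ mu mu (fun p => (F p)%:E)) => //; last first.
  exact/measurable_EFinP.
rewrite -ge0_integralZl_EFin ?sqr_ge0//; last 2 first.
- by move=> t _; rewrite lee_fin sqr_ge0.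
- by apply/measurable_EFinP; apply: measurable_funX.
apply: ae_ge0_le_integral => //.
- by move=> x _; apply: integral_ge0 => t _; rewrite lee_fin.
- apply: (@measurable_fun_fubini_tonelli_G _ _ _ _ _ mu (fun p => (F p)%:E)) => //.
  exact/measurable_EFinP.
- by move=> t _; rewrite -EFinM lee_fin mulr_ge0 ?sqr_ge0.
- by apply/measurable_EFinP; apply: measurable_funM => //; exact: measurable_funX.
move: (schur_col sK); apply: filterS => t ht _.
rewrite (_ : \int[mu]_x _ = \int[mu]_x ((M * (f t ^+ 2 / w t))%:E * (`|K x t| * w x)%:E)); last first.
  by apply: eq_integral => x _; rewrite /F /= -EFinM; congr EFin; ring.
rewrite ge0_integralZl_EFin//; last 3 first.
- by move=> x _; rewrite lee_fin mulr_ge0// ltW.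
- apply/measurable_EFinP; apply: measurable_funM => //.
  exact: (measurableT_comp _ (measurable_col t mK)).
- by rewrite mulr_ge0 ?divr_ge0 ?sqr_ge0 ?ltW.
apply: (@le_trans _ _ ((M * (f t ^+ 2 / w t))%:E * (M * w t)%:E)).
  by apply: lee_wpmul2l => //; rewrite lee_fin mulr_ge0 ?divr_ge0 ?sqr_ge0 ?ltW.
rewrite -!EFinM lee_fin le_eqVlt; apply/orP; left; apply/eqP.
by field; rewrite gt_eqF.
Qed.

End bound.
End SchurTest.

(** * Integral operators *)

Section KernelOperators.
Context d (T : measurableType d) (R : realType).
Context (mu : {sigma_finite_measure set T -> \bar R}).
Local Notation H := (L2space mu).
Variable w : T -> R.
Hypothesis mw : measurable_fun setT w.
Hypothesis w_gt0 : forall x, (0 < w x)%R.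
Local Open Scope ereal_scope.

Definition kint (K : T -> T -> R) (f : T -> R) (x : T) : R :=
  (\int[mu]_t (K x t * f t))%R.

Lemma kint_le_kabs K f x : measurable_fun setT (K x) -> measurable_fun setT f ->
  (`|kint K f x|)%:E <= kabs mu K f x.
Proof.
move=> mK mf.
apply: (@le_trans _ _ `| \int[mu]_t (K x t * f t)%:E |).
  rewrite /kint /Rintegral; case: (\int[mu]_t _) => [r| |] //=;
  by rewrite ?normr0 ?leey.
apply: le_trans (le_abse_integral _ _ _) _ => //.
by apply/measurable_EFinP; exact: measurable_funM.
Qed.

Lemma measurable_kintf K (f : T -> R) : measurable_fun setT (fun p : T * T => K p.1 p.2) ->
  measurable_fun setT f -> measurable_fun setT (kint K f).
Proof.
move=> mK mf; apply: (@measurable_kint _ _ _ mu (fun x t => K x t * f t)%R).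
by apply: measurable_funM => //; exact: measurableT_comp.
Qed.

Section one.
Variables (K : T -> T -> R) (M : R).
Hypothesis sK : schur mu w K M.
Let mK := schur_meas sK.

Lemma kabs_lty (f : H) : \int[mu]_x (kabs mu K f x * kabs mu K f x) < +oo.
Proof.
apply: le_lt_trans (kabs_bound mw w_gt0 sK (L2_measurable f)) _.
by rewrite -hn_EFin -EFinM ltry.
Qed.

Lemma kint_bound (f : H) :
  \int[mu]_x (kint K f x ^+ 2)%:E <= (M ^+ 2)%:E * \int[mu]_x (f x ^+ 2)%:E.
Proof.
apply: le_trans (kabs_bound mw w_gt0 sK (L2_measurable f)).
apply: ge0_le_integral => //.
- by move=> x _; rewrite lee_fin sqr_ge0.
- by apply/measurable_EFinP; apply: measurable_funX; apply: measurable_kintf => //; exact: L2_measurable.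
- by apply: emeasurable_funM; apply: (measurable_kabs sK); exact: L2_measurable.
move=> x _; rewrite -real_normK ?num_real// expr2 EFinM.
by apply: lee_pmul => //; apply: kint_le_kabs; [exact: measurable_row|exact: L2_measurable|exact: measurable_row|exact: L2_measurable].
Qed.

Lemma kint_L2 (f : H) : kint K f \in Lfun mu 2%:E.
Proof.
apply/Lfun2P; split; first by apply: measurable_kintf => //; exact: L2_measurable.
apply: le_lt_trans (kint_bound f) _.
by rewrite -hn_EFin -EFinM ltry.
Qed.

Lemma kabs_ae_lty (f : H) : {ae mu, forall x, kabs mu K f x < +oo}.
Proof.
have mk := measurable_kabs sK (L2_measurable f).
have : mu.-integrable setT (fun x => kabs mu K f x * kabs mu K f x).
  apply/integrableP; split; first exact: emeasurable_funM.
  under eq_integral do rewrite gee0_abs ?mule_ge0 ?kabs_ge0//.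
  exact: kabs_lty.
move=> /(integrable_ae measurableT); apply: filterS => x /(_ I).
have := kabs_ge0 mu K f x; case: (kabs mu K f x) => [r| |] //; first by rewrite ltry.
Qed.

Lemma kint_ae_integrable (f : H) :
  {ae mu, forall x, mu.-integrable setT (fun t => (K x t * f t)%:E)}.
Proof.
move: (kabs_ae_lty f); apply: filterS => x hx; apply/integrableP; split => //.
by apply/measurable_EFinP; apply: measurable_funM; [exact: measurable_row|exact: L2_measurable].
Qed.

End one.

Lemma ip_kint K M (sK : schur mu w K M) (f g : H) :
  ip (toL2 (kint_L2 sK f)) g = ip f (toL2 (kint_L2 (schur_tr sK) g)).
Proof.
have mK := schur_meas sK.
have mf := L2_measurable f; have mg := L2_measurable g.
pose h (p : T * T) := (K p.1 p.2 * f p.2 * g p.1)%R.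
have mh : measurable_fun setT h.
  apply: measurable_funM; last exact: measurableT_comp.
  by apply: measurable_funM => //; exact: measurableT_comp.
have ih : (mu \x mu).-integrable setT (EFin \o h).
  apply/integrable12ltyP; first exact/measurable_EFinP.
  rewrite (_ : \int[mu]_x _ = \int[mu]_x (`|g x|%:E * kabs mu K f x)); last first.
    apply: eq_integral => x _; rewrite /kabs -ge0_integralZl_EFin//.
      by apply: eq_integral => t _ /=; rewrite !normrM !EFinM muleC.
    apply/measurable_EFinP/measurableT_comp => //.
    by apply: measurable_funM => //; exact: measurable_row.
  apply: (@le_lt_trans _ _ (\int[mu]_x ((g x ^+ 2)%:E + kabs mu K f x * kabs mu K f x))).
    apply: ge0_le_integral => //.
    - by move=> x _; rewrite mule_ge0// kabs_ge0.
    - apply: emeasurable_funM; last exact: (measurable_kabs sK).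
      by apply/measurable_EFinP; exact: measurableT_comp.
    - apply: emeasurable_funD; first by apply/measurable_EFinP; exact: measurable_funX.
      by apply: emeasurable_funM; apply: (measurable_kabs sK).
    move=> x _; have := kabs_ge0 mu K f x; case: (kabs mu K f x) => [r r0| _|//].
      rewrite -!EFinM -EFinD lee_fin -(real_normK (num_real (g x))).
      have := sqr_ge0 (`|g x| - r)%R; have := sqr_ge0 (`|g x| + r)%R; nra.
    by rewrite mulyy addey// leey.
  rewrite ge0_integralD//.
  - by rewrite lte_add_pinfty// ?L2_lty//; exact: (kabs_lty sK).
  - by move=> x _; rewrite lee_fin sqr_ge0.
  - by apply/measurable_EFinP; exact: measurable_funX.
  - by move=> x _; rewrite mule_ge0 ?kabs_ge0.
  - by apply: emeasurable_funM; apply: (measurable_kabs sK).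
have := Fubini ih; rewrite /ip /Rintegral => FE.
transitivity (fine (\int[mu]_x \int[mu]_y (EFin \o h) (x, y))).
  congr fine; apply: ae_eq_integral => //.
  - by apply/measurable_EFinP; apply: measurable_funM => //; exact: L2_measurable.
  - exact: measurable_fubini_F ih.
  move: (kint_ae_integrable sK f); apply: filterS => x ix _ /=.
  rewrite /h /= /kint EFinM /Rintegral.
  under [RHS]eq_integral do rewrite EFinM.
  rewrite integralZr// fineK//; exact: integrable_fin_num.
rewrite FE; congr fine; apply: ae_eq_integral => //.
- exact: measurable_fubini_G ih.
- by apply/measurable_EFinP; apply: measurable_funM => //; exact: L2_measurable.
move: (kint_ae_integrable (schur_tr sK) g); apply: filterS => t it _ /=.
rewrite /h /= /kint /Rintegral (_ : \int[mu]_x _ = \int[mu]_x ((K x t * g x)%:E * (f t)%:E)).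
  rewrite integralZr// muleC [RHS]EFinM fineK//; exact: integrable_fin_num.
by apply: eq_integral => x _; rewrite -EFinM; congr EFin; ring.
Qed.

Lemma hn_kint K M (sK : schur mu w K M) (f : H) :
  (hn (toL2 (kint_L2 sK f)) <= M * hn f)%R.
Proof.
have M0 := ltW (schur_gt0 sK).
rewrite -(@ler_pXn2r _ 2)// ?nnegrE ?mulr_ge0 ?hn_ge0//.
rewrite exprMn -lee_fin [leRHS]EFinM (hn_EFin (toL2 _)) (hn_EFin f).
exact: (kint_bound sK).
Qed.

(** The adjoint is the operator of the transposed kernel, by Fubini. *)
Definition kop K M (sK : schur mu w K M) : op mu :=
  Op (ltW (schur_gt0 sK)) (ip_kint sK) (hn_kint sK).

(** An operator may have a kernel without the kernel itself passing the Schur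
    test: this is how products of integral operators enter. *)
Definition kernel_of (A : op mu) (K : T -> T -> R) := forall f : H,
  {ae mu, forall x, mu.-integrable setT (fun t => (K x t * f t)%:E) /\
     A f x = kint K f x}.

Lemma kernel_kop K M (sK : schur mu w K M) : kernel_of (kop sK) K.
Proof.
by move=> f; move: (kint_ae_integrable sK f); apply: filterS => x.
Qed.

Lemma kernel_add A B K L : kernel_of A K -> kernel_of B L ->
  kernel_of (A ⊕ B) (fun x t => K x t + L x t)%R.
Proof.
move=> hA hB f; move: (hA f) (hB f); apply: filterS2 => x [i1 e1] [i2 e2]; split.
  rewrite (_ : (fun t => _) = (fun t => (K x t * f t)%:E) \+ (fun t => (L x t * f t)%:E)).
    exact: integrableD.
  by apply/funext => t /=; rewrite mulrDl EFinD.
rewrite L2addE e1 e2 /kint -RintegralD//; apply: eq_Rintegral => t _.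
by rewrite mulrDl.
Qed.

Lemma kernel_scale a A K : kernel_of A K -> kernel_of (a ⊙ A) (fun x t => a * K x t)%R.
Proof.
move=> hA f; move: (hA f); apply: filterS => x [i1 e1]; split.
  rewrite (_ : (fun t => _) = (fun t => a%:E * (K x t * f t)%:E)).
    exact: integrableZl.
  by apply/funext => t /=; rewrite -mulrA EFinM.
rewrite L2scaleE e1 /kint -RintegralZl//; apply: eq_Rintegral => t _.
by rewrite mulrA.
Qed.

Lemma kernel_ext A K L : kernel_of A K ->
  {ae mu, forall x, {ae mu, forall t, K x t = L x t} /\ measurable_fun setT (L x)} ->
  kernel_of A L.
Proof.
move=> hA KL f; move: (hA f) KL; apply: filterS2 => x [i1 e1] [KLx mL].
have mLf : measurable_fun setT (fun t => (L x t * f t)%:E).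
  by apply/measurable_EFinP; apply: measurable_funM => //; exact: L2_measurable.
have ae : ae_eq mu setT (fun t => (K x t * f t)%:E) (fun t => (L x t * f t)%:E).
  by move: KLx; apply: filterS => t + _ => ->.
split.
  apply/integrableP; split => //.
  have /integrableP[m1 h1] := i1.
  rewrite (@ae_eq_integral _ _ _ mu setT (fun t => `|(K x t * f t)%:E|))//.
  - exact: measurableT_comp.
  - exact: measurableT_comp.
  - by move: ae; apply: filterS => t /[apply] ->.
rewrite e1 /kint /Rintegral; congr fine; apply: ae_eq_integral => //.
by have /integrableP[] := i1.
Qed.

Lemma kernel_eq A B K L : kernel_of A K -> kernel_of B L ->
  {ae mu, forall x, {ae mu, forall t, K x t = L x t}} -> A ≡ B.
Proof.
move=> hA hB KL; apply/opeqP => f.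
near=> x => _.
have [//|iA ->] := near (hA f) x; have [//|iB ->] := near (hB f) x.
rewrite /kint /Rintegral; congr fine; apply: ae_eq_integral => //.
- by have /integrableP[] := iA.
- by have /integrableP[] := iB.
have h : {ae mu, forall t, K x t = L x t} by near: x.
by move: h; apply: filterS => t + _ => ->.
Unshelve. all: by end_near. Qed.

End KernelOperators.

(** * Composition of integral operators *)

Section KernelComposition.
Context d (T : measurableType d) (R : realType).
Context (mu : {sigma_finite_measure set T -> \bar R}).
Local Notation H := (L2space mu).
Variable w : T -> R.
Hypothesis mw : measurable_fun setT w.
Hypothesis w_gt0 : forall x, (0 < w x)%R.
Local Open Scope ereal_scope.

(** Fubini's theorem applies because the absolute values of the kernels also
    pass the Schur test, so that $\int\int|K_1(x,v)K_2(v,t)f(t)|$ is finite for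
    almost every $x$. *)
Lemma kernel_comp K1 M1 K2 M2 (s1 : schur mu w K1 M1) (s2 : schur mu w K2 M2) :
  kernel_of (kop mw w_gt0 s1 ∘ kop mw w_gt0 s2)
    (fun x t => (\int[mu]_v (K1 x v * K2 v t))%R).
Proof.
move=> f; have mf := L2_measurable f.
have m1 := schur_meas s1; have m2 := schur_meas s2.
have mk2 := measurable_kabs s2 mf.
have f2P : (fun v => fine (kabs mu K2 f v)) \in Lfun mu 2%:E.
  apply/Lfun2P; split; first exact: (measurableT_comp (@fine_measurable R setT measurableT)).
  rewrite (@ae_eq_integral _ _ _ mu setT (fun v => kabs mu K2 f v * kabs mu K2 f v))//.
  - exact: (kabs_lty mw w_gt0 s2).
  - apply/measurable_EFinP; apply: measurable_funX.
    exact: (measurableT_comp (@fine_measurable R setT measurableT)).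
  - exact: emeasurable_funM.
  move: (kabs_ae_lty mw w_gt0 s2 f); apply: filterS => v hv _.
  by rewrite expr2 EFinM fineK// ge0_fin_numE// kabs_ge0.
move: (kabs_ae_lty mw w_gt0 s1 (toL2 f2P)); apply: filterS => x hx.
pose h (p : T * T) := (K1 x p.1 * K2 p.1 p.2 * f p.2)%R.
have mK1 := measurable_row x m1.
have mh : measurable_fun setT h.
  apply: measurable_funM; last exact: measurableT_comp.
  by apply: measurable_funM => //; exact: (measurableT_comp mK1).
have ih : (mu \x mu).-integrable setT (EFin \o h).
  apply/integrable12ltyP; first exact/measurable_EFinP.
  rewrite (_ : \int[mu]_v _ = kabs mu K1 (toL2 f2P) x)//.
  rewrite (_ : \int[mu]_v _ = \int[mu]_v (`|K1 x v|%:E * kabs mu K2 f v)); last first.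
    apply: eq_integral => v _; rewrite /kabs -ge0_integralZl_EFin//.
      by apply: eq_integral => t _; rewrite -EFinM -normrM /h /= -mulrA.
    apply/measurable_EFinP/measurableT_comp => //.
    by apply: measurable_funM => //; exact: measurable_row.
  apply: ae_eq_integral => //.
  - by apply: emeasurable_funM => //; apply/measurable_EFinP; exact: measurableT_comp.
  - apply/measurable_EFinP; apply: measurableT_comp => //; apply: measurable_funM => //.
  move: (kabs_ae_lty mw w_gt0 s2 f); apply: filterS => v hv _ /=.
  rewrite normrM EFinM; congr (_ * _).
  by rewrite ger0_norm ?fine_ge0 ?kabs_ge0// fineK// ge0_fin_numE// kabs_ge0.
have ae2 : {ae mu, forall t, \int[mu]_v (h (v, t))%:E =
    ((\int[mu]_v (K1 x v * K2 v t))%R * f t)%:E}.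
  move: (ae_integrable2 ih); apply: filterS => t it.
  have [ft0|ft0] := eqVneq (f t) 0%R.
    rewrite ft0 mulr0; apply: integral0_eq => v _.
    by rewrite /h /= ft0 mulr0.
  have ik : mu.-integrable setT (fun v => (K1 x v * K2 v t)%:E).
    rewrite (_ : (fun v => _) = (fun v => ((f t)^-1)%:E * (EFin \o h) (v, t))).
      exact: integrableZl.
    by apply/funext => v; rewrite /h /= -EFinM; congr EFin; field.
  rewrite [RHS]EFinM /Rintegral fineK; last exact: integrable_fin_num.
  rewrite -integralZr//; apply: eq_integral => v _.
have mG : measurable_fun setT (fun t => \int[mu]_v (EFin \o h) (v, t)).
  exact: measurable_fubini_G ih.
have mKK : measurable_fun setT (fun t => (\int[mu]_v (K1 x v * K2 v t))%R).
  apply: (@measurable_kint _ _ _ mu (fun t v => K1 x v * K2 v t)%R).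
  apply: measurable_funM; first exact: (measurableT_comp mK1 measurable_snd).
  exact: (measurableT_comp m2 (measurable_fun_pair measurable_snd measurable_fst)).
have mKKf : measurable_fun setT (fun t => ((\int[mu]_v (K1 x v * K2 v t))%R * f t)%:E).
  by apply/measurable_EFinP; exact: measurable_funM.
split.
  apply/integrableP; split => //.
  apply: (@le_lt_trans _ _ (\int[mu]_t \int[mu]_v `|(EFin \o h) (v, t)|)); last first.
    by apply: ((integrable21ltyP mu mu _).1 ih); exact/measurable_EFinP.
  apply: (@le_trans _ _ (\int[mu]_t `|\int[mu]_v (EFin \o h) (v, t)|)); last first.
    apply: ge0_le_integral => //.
    - exact: measurableT_comp.
    - apply: (@measurable_fun_fubini_tonelli_G _ _ _ _ _ mu (abse \o (EFin \o h))) => [|p].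
        by apply: measurableT_comp => //; exact/measurable_EFinP.
      exact: abse_ge0.
    move=> t _; apply: le_abse_integral => //.
    exact: (measurableT_comp (measurable_int _ ih) (pair2_measurable t)).
  rewrite (@ae_eq_integral _ _ _ mu setT (fun t => `|\int[mu]_v (EFin \o h) (v, t)|))//.
  - exact: measurableT_comp.
  - exact: measurableT_comp.
  by move: ae2; apply: filterS => t /= -> _.
have FE := Fubini ih.
rewrite /= /kint /Rintegral.
transitivity (fine (\int[mu]_v \int[mu]_t (EFin \o h) (v, t))).
  congr fine; apply: ae_eq_integral => //.
  - apply/measurable_EFinP; apply: measurable_funM => //.
    exact: (L2_measurable (toL2 (kint_L2 mw w_gt0 s2 f))).
  - exact: measurable_fubini_F ih.
  move: (kint_ae_integrable mw w_gt0 s2 f); apply: filterS => v iv _ /=.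
  rewrite /h /= /kint EFinM /Rintegral fineK; last exact: integrable_fin_num.
  rewrite -integralZl//; apply: eq_integral => t _; rewrite -EFinM; congr EFin.
  by rewrite mulrA.
rewrite FE; congr fine; apply: ae_eq_integral => //.
by move: ae2; apply: filterS => t /= -> _.
Qed.

End KernelComposition.

(** * Lebesgue measure on the half-line *)

Section HalfLineMeasure.
Context {R : realType}.
Local Notation mu := (@lebesgue_measure R).

Lemma measurable_Rplus : measurable (@Rplus R).
Proof. exact: measurable_itv. Qed.

(** Integrating over the whole line against the restricted measure keeps
    integration domains out of the statements. *)
Definition hl : set (measurableTypeR R) -> \bar R := mrestr mu measurable_Rplus.

HB.instance Definition _ := Measure.copy hl (mrestr mu measurable_Rplus).

Lemma hl_sigma_finite : sigma_finite setT hl.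
Proof.
have [F UF mF] := @sigma_finiteT _ _ _ mu.
exists F => // i; split; first exact: (mF i).1.
apply: le_lt_trans (mF i).2; apply: le_measure => //; rewrite ?inE.
- by apply: measurableI; [exact: (mF i).1|exact: measurable_Rplus].
- exact: (mF i).1.
Qed.

HB.instance Definition _ := Measure_isSigmaFinite.Build _ _ _ hl hl_sigma_finite.


Lemma ae_hl (P : R -> Prop) : {ae hl, forall x, P x} <-> {ae mu, forall x, Rplus x -> P x}.
Proof.
split=> [[A [mA A0 PA]]|[A [mA A0 PA]]].
  exists (A `&` Rplus); split => //; first by apply: measurableI => //; exact: measurable_Rplus.
  move=> x /= h; split; first by apply: PA => Px; apply: h => _.
  by apply: contrapT => nx; apply: h => /nx.
exists (A `|` ~` Rplus); split.
- by apply: measurableU => //; apply: measurableC; exact: measurable_Rplus.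
- rewrite -[LHS]/(mu (_ `&` Rplus)) setIUl setICl setU0.
  apply/eqP; rewrite -measure_le0 -A0; apply: le_measure; rewrite ?inE//.
  by apply: measurableI => //; exact: measurable_Rplus.
move=> x /= h; have [Rx|Rx] := pselect (Rplus x); last by right.
by left; apply: PA => /= /(_ Rx).
Qed.

Lemma RplusE (x : R) : Rplus x <-> 0 < x.
Proof. by rewrite /Rplus /= in_itv/= andbT. Qed.

Lemma ae_hlW (P : R -> Prop) : (forall x : R, 0 < x -> P x) -> {ae hl, forall x, P x}.
Proof. by move=> h; apply/ae_hl; apply: aeW => x /RplusE; exact: h. Qed.

Lemma integral_hl (f : R -> \bar R) : measurable_fun setT f ->
  (\int[hl]_x f x = \int[mu]_(x in Rplus) f x)%E.
Proof.
move=> mf.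
transitivity (\int[hl]_(x in Rplus) f x)%E; last first.
  by apply: eq_measure_integral => A mA AR; rewrite -[LHS]/(mu (A `&` Rplus)) setIidl.
rewrite [RHS]integral_mkcond; apply: ae_eq_integral => //.
  by apply/(measurable_restrictT f measurable_Rplus); apply: measurable_funTS.
apply: ae_hlW => x x0 _; rewrite patchE mem_set//; exact/RplusE.
Qed.

Lemma eq_integral_hl (f g : R -> \bar R) : measurable_fun setT f -> measurable_fun setT g ->
  (forall x : R, 0 < x -> f x = g x) -> (\int[hl]_x f x = \int[hl]_x g x)%E.
Proof.
move=> mf mg fg; apply: ae_eq_integral => //.
by apply: ae_hlW => x x0 _; exact: fg.
Qed.

Lemma eq_Rintegral_hl (f g : R -> R) : measurable_fun setT f -> measurable_fun setT g ->
  (forall x : R, 0 < x -> f x = g x) -> \int[hl]_x f x = \int[hl]_x g x.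
Proof.
move=> mf mg fg; rewrite /Rintegral (@eq_integral_hl _ (EFin \o g))//.
- exact/measurable_EFinP.
- exact/measurable_EFinP.
by move=> x x0 /=; rewrite fg.
Qed.

Lemma ge0_le_integral_hl (f g : R -> R) : measurable_fun setT f -> measurable_fun setT g ->
  (forall x : R, 0 < x -> 0 <= f x <= g x) -> (\int[hl]_x (f x)%:E <= \int[hl]_x (g x)%:E)%E.
Proof.
move=> mf mg fg; rewrite !integral_hl//; last 2 first.
- exact/measurable_EFinP.
- exact/measurable_EFinP.
apply: ge0_le_integral => //.
- exact: measurable_Rplus.
- by move=> x /RplusE/fg/andP[? _]; rewrite lee_fin.
- by apply/measurable_EFinP; exact: measurable_funTS.
- by apply/measurable_EFinP; exact: measurable_funTS.
- by move=> x /RplusE/fg/andP[_ ?]; rewrite lee_fin.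
Qed.

Lemma le_integrable_hl (f g : R -> R) : measurable_fun setT f ->
  (forall x : R, 0 < x -> `|f x| <= g x) -> hl.-integrable setT (EFin \o g) ->
  hl.-integrable setT (EFin \o f).
Proof.
move=> mf fg ig; have /integrableP[mg hg] := ig.
apply/integrableP; split; first exact/measurable_EFinP.
apply: le_lt_trans hg.
have /measurable_EFinP mg' := mg.
apply: (@ge0_le_integral_hl (fun x => `|f x|) (fun x => `|g x|)).
- exact: measurableT_comp.
- exact: measurableT_comp.
move=> x x0; rewrite normr_ge0/=; apply: le_trans (fg _ x0) _; exact: ler_norm.
Qed.

(** The integrand is only controlled on the open half-line, so the integral
    is the limit of those over $[1/n,\infty)$. *)
Lemma ge0_FTC (f F : R -> R) (A B : R) : measurable_fun setT f ->
  (forall x : R, 0 < x -> 0 <= f x) ->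
  (forall x : R, 0 < x -> {for x, continuous f}) ->
  (forall x : R, 0 < x -> is_derive x 1 F (f x)) ->
  F x @[x --> 0^'+] --> A -> F x @[x --> +oo] --> B ->
  (\int[hl]_x (f x)%:E = (B - A)%:E)%E.
Proof.
move=> mf f0 cf dF FA FB.
rewrite integral_hl; last exact/measurable_EFinP.
pose a (n : nat) : R := n.+1%:R^-1.
have a0 n : 0 < a n by rewrite invr_gt0.
pose D n : set R := `[a n, +oo[%classic.
have UD : \bigcup_n D n = Rplus.
  apply/seteqP; split => [x [n _]|x /RplusE x0].
    rewrite /D /= in_itv/= andbT => h; apply/RplusE; exact: lt_le_trans h.
  exists (Num.truncn x^-1) => //; rewrite /D /= in_itv/= andbT /a.
  rewrite -[leRHS]invrK lef_pV2 ?posrE ?invr_gt0//.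
  by apply/ltW; apply: truncnS_gt.
have cFx x : 0 < x -> {for x, continuous F}.
  by move=> x0; apply/differentiable_continuous/derivable1_diffP; have [] := dF x x0.
have DE n : (\int[mu]_(x in D n) (f x)%:E = (B - F (a n))%:E)%E.
  rewrite EFinB; apply: ge0_continuous_FTC2y => //.
  - by move=> x ax; apply: f0; exact: lt_le_trans ax.
  - apply/continuous_within_itvcyP; split.
      by move=> x; rewrite in_itv/= andbT => ax; apply: cf; exact: lt_trans ax.
    by apply: cvg_at_right_filter; exact: cf.
  - by move=> x ax; have [] := dF x (lt_trans (a0 n) ax).
  - by apply: cvg_at_right_filter; exact: cFx.
  - move=> x; rewrite in_itv/= andbT => ax; rewrite derive1E.
    by have [_ ->] := dF x (lt_trans (a0 n) ax).
have h1 : (\int[mu]_(x in D n) (f x)%:E @[n --> \oo] --> \int[mu]_(x in Rplus) (f x)%:E)%E.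
  rewrite -UD; apply: ge0_nondecreasing_set_cvg_integral => //.
  - apply/nondecreasing_seqP => n; apply/subsetPset => x.
    rewrite /D /= !in_itv/= !andbT; apply: le_trans.
    by rewrite lef_pV2 ?posrE// ler_nat.
  - by move=> n; exact: measurable_itv.
  - by move=> n; apply/measurable_EFinP; exact: measurable_funTS.
  - move=> n x; rewrite /D /= in_itv/= andbT => ax; rewrite lee_fin.
    by apply: f0; exact: lt_le_trans ax.
have h2 : ((B - F (a n))%:E @[n --> \oo] --> (B - A)%:E)%E.
  apply: cvg_EFin; first exact: nearW.
  apply: cvgB; first exact: cvg_cst.
  have := FA; rewrite cvg_at_rightP; apply; split => //.
  exact: cvg_harmonic.
have E : (fun n => \int[mu]_(x in D n) (f x)%:E)%E = (fun n => (B - F (a n))%:E).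
  by apply/funext => n; exact: DE.
rewrite E in h1.
exact: (cvg_unique _ h1 h2).
Qed.

Lemma ge0_FTC_integrable (f F : R -> R) (A B : R) : measurable_fun setT f ->
  (forall x : R, 0 < x -> 0 <= f x) ->
  (forall x : R, 0 < x -> {for x, continuous f}) ->
  (forall x : R, 0 < x -> is_derive x 1 F (f x)) ->
  F x @[x --> 0^'+] --> A -> F x @[x --> +oo] --> B ->
  hl.-integrable setT (EFin \o f) /\ \int[hl]_x f x = B - A.
Proof.
move=> mf f0 cf dF FA FB; have E := ge0_FTC mf f0 cf dF FA FB.
split; last by rewrite /Rintegral E.
apply/integrableP; split; first exact/measurable_EFinP.
rewrite (@eq_integral_hl _ (EFin \o f)).
- by rewrite E ltry.
- by apply: measurableT_comp => //; exact/measurable_EFinP.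
- exact/measurable_EFinP.
by move=> x x0 /=; rewrite ger0_norm// f0.
Qed.

Lemma ge0_integral_scale (c : R) (f : R -> \bar R) : 0 < c -> measurable_fun setT f ->
  (forall x : R, 0 <= f x)%E ->
  (\int[hl]_x f x = c%:E * \int[hl]_x f (c * x)%R)%E.
Proof.
move=> c0 mf f0.
have mphi : measurable_fun setT ( *%R c : measurableTypeR R -> measurableTypeR R).
  exact: measurable_funM.
have cn : 0 <= c by exact: ltW.
pose pf : {measure set (measurableTypeR R) -> \bar R} :=
  measure_function_pushforward__canonical__measure_function_Measure mu mphi.
have E : forall A, measurable A -> mu A = mscale (NngNum cn) pf A.
  apply: lebesgue_measure_unique => X /ocitvP[->|[[a b] /= ab ->]].
    by rewrite !measure0.
  rewrite /mscale /= /pushforward.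
  have -> : *%R c @^-1` `]a, b] = `]a / c, b / c]%classic.
    by apply/seteqP; split => x /=; rewrite !in_itv/= ltr_pdivrMr// ler_pdivlMr// mulrC.
  rewrite !lebesgue_measure_itv/= !lte_fin ab ltr_pM2r ?invr_gt0// ab.
  by rewrite -!EFinB -EFinM; congr EFin; field; rewrite gt_eqF.
have pre : *%R c @^-1` Rplus = Rplus.
  by apply/seteqP; split => x /=; rewrite /Rplus /= !in_itv/= !andbT pmulr_rgt0.
rewrite !integral_hl//; last first.
  by apply: (measurableT_comp mf).
rewrite (@eq_measure_integral _ _ _ _ (mscale (NngNum cn) pf)); last first.
  by move=> A mA _; exact: E.
have mR := measurable_Rplus.
rewrite ge0_integral_mscale//; last exact: measurable_funTS.
by rewrite (ge0_integral_pushforward mphi) ?pre//; exact: measurable_funTS.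
Qed.

Lemma Rintegral_scale (c : R) (f : R -> R) : 0 < c -> measurable_fun setT f ->
  \int[hl]_x f x = c * \int[hl]_x f (c * x)%R.
Proof.
move=> c0 mf; have cn : 0 <= c by exact: ltW.
rewrite /Rintegral -[X in X * _]/(fine c%:E).
have mE : measurable_fun setT (EFin \o f) by exact/measurable_EFinP.
rewrite integralE [in RHS]integralE.
rewrite (ge0_integral_scale c0 (measurable_funepos mE))//.
rewrite (ge0_integral_scale c0 (measurable_funeneg mE))//.
have -> : (\int[hl]_x ((fun x => (f (c * x)%R)%:E)^\+ x) = \int[hl]_x ((EFin \o f)^\+ (c * x)%R))%E.
  by apply: eq_integral => x _; rewrite ?funeposE.
have -> : (\int[hl]_x ((fun x => (f (c * x)%R)%:E)^\- x) = \int[hl]_x ((EFin \o f)^\- (c * x)%R))%E.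
  by apply: eq_integral => x _; rewrite ?funenegE.
set P := (\int[hl]_x _)%E; set N := (\int[hl]_x _)%E.
have : (0 <= P)%E by exact: integral_ge0.
have : (0 <= N)%E by exact: integral_ge0.
case: P => [p| |] //; case: N => [n| |] //= _ _; rewrite ?mulr0.
- by rewrite mulrBr.
- by rewrite gt0_muley ?lte_fin//=.
- by rewrite gt0_muley ?lte_fin//=.
- by rewrite gt0_muley ?lte_fin//=.
Qed.

Lemma integrable_scale (c : R) (f : R -> R) : 0 < c ->
  hl.-integrable setT (EFin \o f) -> hl.-integrable setT (fun x => (f (c * x)%R)%:E).
Proof.
move=> c0 /integrableP[mf If].
have mfc : measurable_fun setT (fun x => (f (c * x)%R)%:E).
  by apply: (measurableT_comp mf); exact: measurable_funM.
apply/integrableP; split => //.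
move: If; rewrite (@ge0_integral_scale c (fun x => `|(EFin \o f) x|)%E)//.
case: (\int[hl]_x _)%E (@integral_ge0 _ _ _ hl setT (fun x => `|(f (c * x)%R)%:E|)%E) => [r _ _|_|h _].
- by rewrite ltry.
- by rewrite gt0_muley.
- by have := h (fun x _ => abse_ge0 _).
exact: measurableT_comp.
Qed.

End HalfLineMeasure.

(** * Calculus on the half-line *)

Section DerivativeRules.
Context {R : realType}.
Implicit Types (f g : R -> R) (x a b : R).

(** The derivative as a plain predicate: the library class [is_derive] would
    be resolved eagerly, before the rules below get a chance to apply. *)
Definition has_der f x a : Prop := is_derive x 1 f a.

Lemma has_derP f x a b : has_der f x a -> a = b -> is_derive x 1 f b.
Proof. by move=> h <-. Qed.

Lemma der_cst (c x : R) : has_der (fun=> c) x 0.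
Proof. exact: is_derive_cst. Qed.
Lemma der_id x : has_der (fun y : R => y) x 1.
Proof. exact: is_derive_id. Qed.
Lemma der_add f g x a b : has_der f x a -> has_der g x b ->
  has_der (fun y => f y + g y) x (a + b).
Proof. by move=> hf hg; exact: is_deriveD. Qed.
Lemma der_opp f x a : has_der f x a -> has_der (fun y => - f y) x (- a).
Proof. by move=> hf; exact: is_deriveN. Qed.
Lemma der_mul f g x a b : has_der f x a -> has_der g x b ->
  has_der (fun y => f y * g y) x (f x * b + g x * a).
Proof. by move=> hf hg; exact: is_deriveM. Qed.
Lemma der_inv f x a : has_der f x a -> f x != 0 ->
  has_der (fun y => (f y)^-1) x (- (f x ^+ 2)^-1 * a).
Proof. by move=> hf h0; exact: is_deriveV. Qed.
Lemma der_pow n f x a : has_der f x a ->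
  has_der (fun y => f y ^+ n) x (n%:R * f x ^+ n.-1 * a).
Proof.
move=> hf; have -> : (fun y => f y ^+ n) = f ^+ n by apply/funext => y; rewrite exprfctE.
exact: is_deriveX.
Qed.
Lemma der_comp (h f : R -> R) x a b : has_der h (f x) b -> has_der f x a ->
  has_der (fun y => h (f y)) x (b * a).
Proof. by move=> hh hf; exact: is_derive1_comp. Qed.
Lemma der_exp f x a : has_der f x a ->
  has_der (fun y => expR (f y)) x (expR (f x) * a).
Proof. by move=> hf; apply: der_comp => //; exact: is_derive_expR. Qed.
Lemma der_cos f x a : has_der f x a ->
  has_der (fun y => cos (f y)) x (- sin (f x) * a).
Proof. by move=> hf; apply: der_comp => //; exact: is_derive_cos. Qed.
Lemma der_sin f x a : has_der f x a ->
  has_der (fun y => sin (f y)) x (cos (f x) * a).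
Proof. by move=> hf; apply: der_comp => //; exact: is_derive_sin. Qed.
Lemma der_atan f x a : has_der f x a ->
  has_der (fun y => atan (f y)) x ((1 + f x ^+ 2)^-1 * a).
Proof. by move=> hf; apply: der_comp => //; exact: is_derive1_atan. Qed.
Lemma der_ln f x a : has_der f x a -> 0 < f x ->
  has_der (fun y => ln (f y)) x ((f x)^-1 * a).
Proof. by move=> hf f0; apply: der_comp => //; exact: is_derive1_ln. Qed.
Lemma der_sqrt f x a : has_der f x a -> 0 < f x ->
  has_der (fun y => Num.sqrt (f y)) x ((2 * Num.sqrt (f x))^-1 * a).
Proof. by move=> hf f0; apply: der_comp => //; exact: is_derive1_sqrt. Qed.
Lemma der_continuous f x a : is_derive x 1 f a -> {for x, continuous f}.
Proof. by move=> [h _]; apply/differentiable_continuous/derivable1_diffP. Qed.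

Definition cont f x : Prop := {for x, continuous f}.

Lemma contP f x : cont f x -> {for x, continuous f}.
Proof. by []. Qed.

Lemma con_cst c x : cont (fun _ : R => c : R) x.
Proof. exact: cvg_cst. Qed.
Lemma con_id x : cont (fun y : R => y) x.
Proof. exact: cvg_id. Qed.
Lemma con_add f g x : cont f x -> cont g x ->
  cont (fun y => f y + g y) x.
Proof. by move=> hf hg; exact: cvgD. Qed.
Lemma con_opp f x : cont f x -> cont (fun y => - f y) x.
Proof. by move=> hf; exact: cvgN. Qed.
Lemma con_mul f g x : cont f x -> cont g x ->
  cont (fun y => f y * g y) x.
Proof. by move=> hf hg; exact: cvgM. Qed.
Lemma con_inv f x : cont f x -> f x != 0 ->
  cont (fun y => (f y)^-1) x.
Proof. by move=> hf h0; exact: cvgV. Qed.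
Lemma con_comp (h f : R -> R) x : cont f x -> cont h (f x) ->
  cont (fun y => h (f y)) x.
Proof. by move=> hf hh; exact: continuous_comp. Qed.
Lemma con_pow n f x : cont f x -> cont (fun y => f y ^+ n) x.
Proof.
move=> hf; apply: (@con_comp (fun y => y ^+ n)) => //; exact: exprn_continuous.
Qed.
Lemma con_exp f x : cont f x -> cont (fun y => expR (f y)) x.
Proof. by move=> hf; apply: con_comp => //; exact: continuous_expR. Qed.
Lemma con_atan f x : cont f x -> cont (fun y => atan (f y)) x.
Proof. by move=> hf; apply: con_comp => //; exact: continuous_atan. Qed.
Lemma con_cos f x : cont f x -> cont (fun y => cos (f y)) x.
Proof. by move=> hf; apply: con_comp => //; exact: continuous_cos. Qed.
Lemma con_sin f x : cont f x -> cont (fun y => sin (f y)) x.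
Proof. by move=> hf; apply: con_comp => //; exact: continuous_sin. Qed.
Lemma con_sqrt f x : cont f x -> cont (fun y => Num.sqrt (f y)) x.
Proof. by move=> hf; apply: con_comp => //; exact: sqrt_continuous. Qed.
Lemma con_ln f x : cont f x -> 0 < f x -> cont (fun y => ln (f y)) x.
Proof. by move=> hf f0; apply: con_comp => //; exact: continuous_ln. Qed.

Lemma con_at_right f x l : {for x, continuous f} -> f x = l -> f y @[y --> x^'+] --> l.
Proof. by move=> cf <-; exact: cvg_at_right_filter. Qed.

End DerivativeRules.

(* The rules are selected by the shape of the function, without unification
   up to conversion, which would unfold the arithmetic operations. *)
Ltac der_step := cbv beta; lazymatch goal with
  | |- has_der (fun _ => ?c) _ _ => exact: der_cst
  | |- has_der (fun y => y) _ _ => exact: der_id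
  | |- has_der (fun y => @?f y + @?g y) ?x _ => apply: (@der_add _ f g x)
  | |- has_der (fun y => - @?f y) ?x _ => apply: (@der_opp _ f x)
  | |- has_der (fun y => @?f y * @?g y) ?x _ => apply: (@der_mul _ f g x)
  | |- has_der (fun y => (@?f y)^-1) ?x _ => apply: (@der_inv _ f x)
  | |- has_der (fun y => @?f y ^+ ?n) ?x _ => apply: (@der_pow _ n f x)
  | |- has_der (fun y => expR (@?f y)) ?x _ => apply: (@der_exp _ f x)
  | |- has_der (fun y => cos (@?f y)) ?x _ => apply: (@der_cos _ f x)
  | |- has_der (fun y => sin (@?f y)) ?x _ => apply: (@der_sin _ f x)
  | |- has_der (fun y => atan (@?f y)) ?x _ => apply: (@der_atan _ f x)
  | |- has_der (fun y => ln (@?f y)) ?x _ => apply: (@der_ln _ f x)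
  | |- has_der (fun y => Num.sqrt (@?f y)) ?x _ => apply: (@der_sqrt _ f x)
  end.
Ltac der := repeat der_step; cbv beta.

Ltac con_step := cbv beta; lazymatch goal with
  | |- cont (fun _ => ?c) _ => exact: con_cst
  | |- cont (fun y => y) _ => exact: con_id
  | |- cont (fun y => @?f y + @?g y) ?x => apply: (@con_add _ f g x)
  | |- cont (fun y => - @?f y) ?x => apply: (@con_opp _ f x)
  | |- cont (fun y => @?f y * @?g y) ?x => apply: (@con_mul _ f g x)
  | |- cont (fun y => (@?f y)^-1) ?x => apply: (@con_inv _ f x)
  | |- cont (fun y => @?f y ^+ ?n) ?x => apply: (@con_pow _ n f x)
  | |- cont (fun y => expR (@?f y)) ?x => apply: (@con_exp _ f x)
  | |- cont (fun y => cos (@?f y)) ?x => apply: (@con_cos _ f x)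
  | |- cont (fun y => sin (@?f y)) ?x => apply: (@con_sin _ f x)
  | |- cont (fun y => atan (@?f y)) ?x => apply: (@con_atan _ f x)
  | |- cont (fun y => ln (@?f y)) ?x => apply: (@con_ln _ f x)
  | |- cont (fun y => Num.sqrt (@?f y)) ?x => apply: (@con_sqrt _ f x)
  end.
Ltac con := apply: contP; repeat con_step; cbv beta.

Section Measurability.
Context {R : realType}.

Lemma measurable_oppr d (T : measurableType d) (f : T -> R) :
  measurable_fun setT f -> measurable_fun setT (fun x => - f x).
Proof. by move=> mf; exact: measurable_funN. Qed.

Lemma measurable_normr d (T : measurableType d) (f : T -> R) :
  measurable_fun setT f -> measurable_fun setT (fun x => `|f x|).
Proof. by move=> mf; exact: measurableT_comp. Qed.

Lemma measurable_cos : measurable_fun setT (@cos R).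
Proof. by apply: continuous_measurable_fun; exact: continuous_cos. Qed.

Lemma measurable_sin : measurable_fun setT (@sin R).
Proof. by apply: continuous_measurable_fun; exact: continuous_sin. Qed.

End Measurability.

Ltac mea_step := cbv beta; first [assumption | lazymatch goal with
  | |- measurable_fun _ (fun _ => ?c) => exact: measurable_cst
  | |- measurable_fun _ (fun x => x) => exact: measurable_id
  | |- measurable_fun _ (fun x => fst x) => exact: measurable_fst
  | |- measurable_fun _ (fun x => snd x) => exact: measurable_snd
  | |- measurable_fun _ (fun x => @?f x + @?g x) => apply: (@measurable_funD _ _ _ _ f g)
  | |- measurable_fun _ (fun x => - @?f x) => apply: (@measurable_oppr _ _ _ f)
  | |- measurable_fun _ (fun x => @?f x * @?g x) => apply: (@measurable_funM _ _ _ _ f g)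
  | |- measurable_fun _ (fun x => (@?f x)^-1) =>
      apply: (@measurableT_comp _ _ _ _ _ _ _ _ f (@measurable_invr _))
  | |- measurable_fun _ (fun x => @?f x ^+ ?n) => apply: (@measurable_funX _ _ _ _ f n)
  | |- measurable_fun _ (fun x => `|@?f x|) => apply: (@measurable_normr _ _ _ f)
  | |- measurable_fun _ (fun x => Num.sqrt (@?f x)) =>
      apply: (@measurableT_comp _ _ _ _ _ _ _ _ f (@measurable_sqrtr _))
  | |- measurable_fun _ (fun x => expR (@?f x)) =>
      apply: (@measurableT_comp _ _ _ _ _ _ _ _ f (@measurable_expR _))
  | |- measurable_fun _ (fun x => ln (@?f x)) =>
      apply: (@measurableT_comp _ _ _ _ _ _ _ _ f (@measurable_ln _))
  | |- measurable_fun _ (fun x => cos (@?f x)) =>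
      apply: (@measurableT_comp _ _ _ _ _ _ _ _ f (@measurable_cos _))
  | |- measurable_fun _ (fun x => sin (@?f x)) =>
      apply: (@measurableT_comp _ _ _ _ _ _ _ _ f (@measurable_sin _))
  | |- measurable_fun _ (fun x => @?f x `^ ?p) =>
      apply: (@measurableT_comp _ _ _ _ _ _ _ _ f (@measurable_powR _ p))
  end].
Ltac mea := repeat mea_step.

Section HasIntegral.
Context {R : realType}.
Implicit Types (f g : R -> R).

(** Integrability is part of the statement, so that these facts can be added
    and scaled without side conditions. *)
Definition has_int f (I : R) := hl.-integrable setT (EFin \o f) /\ \int[hl]_x f x = I.

Lemma has_int_integrable f I : has_int f I -> hl.-integrable setT (EFin \o f).
Proof. by case. Qed.

Lemma has_intE f I : has_int f I -> \int[hl]_x f x = I. Proof. by case. Qed.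

Lemma has_int_measurable f I : has_int f I -> measurable_fun setT f.
Proof. by move=> [/integrableP[/measurable_EFinP]]. Qed.

Lemma has_int_ereal f I : has_int f I -> (\int[hl]_x (f x)%:E = I%:E)%E.
Proof.
move=> [i1 <-]; rewrite /Rintegral fineK//; exact: integrable_fin_num.
Qed.

Lemma has_int_eq f g I J : has_int f I -> measurable_fun setT g ->
  (forall x, 0 < x -> g x = f x) -> I = J -> has_int g J.
Proof.
move=> hf mg gf <-; have mf := has_int_measurable hf; case: hf => i1 e1; split.
  have /integrableP[_ h] := i1; apply/integrableP; split; first exact/measurable_EFinP.
  move: h; rewrite (@eq_integral_hl _ _ (fun x => `|(EFin \o g) x|)%E)//.
  - by apply: measurableT_comp => //; exact/measurable_EFinP.
  - by apply: measurableT_comp => //; exact/measurable_EFinP.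
  - by move=> x x0 /=; rewrite gf.
by rewrite -e1; apply: eq_Rintegral_hl.
Qed.

Lemma has_int_add f g I J : has_int f I -> has_int g J ->
  has_int (fun x => f x + g x) (I + J).
Proof.
move=> [if_ ef] [ig eg]; split; last by rewrite RintegralD// ef eg.
rewrite (_ : EFin \o _ = (EFin \o f) \+ (EFin \o g))%E; first exact: integrableD.
by apply/funext => x /=; rewrite EFinD.
Qed.

Lemma has_int_scale c f I : has_int f I -> has_int (fun x => c * f x) (c * I).
Proof.
move=> [if_ ef]; split; last by rewrite RintegralZl// ef.
rewrite (_ : EFin \o _ = (fun x => c%:E * (EFin \o f) x))%E; first exact: integrableZl.
by apply/funext => x /=; rewrite EFinM.
Qed.

Lemma has_int_dil c f I : 0 < c -> has_int f I -> has_int (fun x => f (c * x)) (c^-1 * I).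
Proof.
move=> c0 hf; have mf := has_int_measurable hf; case: hf => if_ ef.
split; first exact: integrable_scale.
by rewrite -ef (Rintegral_scale c0 mf) mulrA mulVf ?mul1r// gt_eqF.
Qed.

Lemma cvgy_inv (F G : R -> R) : {for 0, continuous G} ->
  (forall x, 0 < x -> F x = G x^-1) -> F x @[x --> +oo] --> G 0.
Proof.
move=> cG FG.
have inv0 : (fun x : R => x^-1) @ +oo --> (0 : R).
  apply/gtr0_cvgV0; first by near=> x; near: x; exact: nbhs_pinfty_gt.
  exact: cvg_id.
have h : (fun x : R => G x^-1) @ +oo --> G 0 by apply: continuous_cvg.
apply: cvg_trans h; apply: near_eq_cvg; near=> x; apply/esym/FG.
near: x; exact: nbhs_pinfty_gt.
Unshelve. all: by end_near. Qed.

(** The limit at infinity of an antiderivative is the value at $0$ of $G$,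
    the same antiderivative in the variable $1/x$. *)
Lemma has_int_FTC (f F G : R -> R) : measurable_fun setT f ->
  (forall x : R, 0 < x -> 0 <= f x) ->
  (forall x : R, 0 < x -> {for x, continuous f}) ->
  (forall x : R, 0 < x -> is_derive x 1 F (f x)) ->
  {for 0, continuous F} -> {for 0, continuous G} ->
  (forall x, 0 < x -> F x = G x^-1) -> has_int f (G 0 - F 0).
Proof.
move=> mf f0 cf dF F0 G0 FG; apply: (ge0_FTC_integrable mf f0 cf dF).
  exact: cvg_at_right_filter.
exact: cvgy_inv.
Qed.

End HasIntegral.

(** * Elementary integrals *)

Section ElementaryIntegrals.
Context {R : realType}.
Implicit Types (a x t v : R).

Lemma cvgy_sqrt : Num.sqrt x @[x --> (+oo : set_system R)] --> (+oo : set_system R).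
Proof.
apply/cvgryPge => A; near=> x.
rewrite (le_trans (ler_norm A))// -sqrtr_sqr; apply: ler_wsqrtr.
near: x; by apply: nbhs_pinfty_ge; exact: num_real.
Unshelve. all: by end_near. Qed.

Lemma int_exp1 : has_int (fun v : R => expR (- v)) 1.
Proof.
have := @ge0_FTC_integrable R (fun v => expR (- v)) (fun v => - expR (- v)) (-1) 0.
rewrite opprK add0r; apply.
- by mea.
- by move=> x _; exact: expR_ge0.
- by move=> x _; con.
- by move=> x _; apply: has_derP; [der|ring].
- by apply: con_at_right; [con|rewrite oppr0 expR0].
- by rewrite -oppr0; apply: cvgN; exact: cvgr_expR.
Qed.

Lemma int_exp a : 0 < a -> has_int (fun v => expR (- (a * v))) a^-1.
Proof. by move=> a0; rewrite -[a^-1]mulr1; exact: has_int_dil int_exp1. Qed.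

Lemma int_atan1 : has_int (fun v : R => (1 + v ^+ 2)^-1) (pi / 2).
Proof.
have := @ge0_FTC_integrable R (fun v => (1 + v ^+ 2)^-1) atan 0 (pi / 2).
rewrite subr0; apply.
- by mea.
- by move=> x _; rewrite invr_ge0 addr_ge0 ?sqr_ge0.
- by move=> x _; con; rewrite gt_eqF// ltr_pwDl ?sqr_ge0.
- by apply: con_at_right; [exact: continuous_atan|exact: atan0].
- exact: cvgy_atan.
Qed.

Lemma int_atan a : 0 < a -> has_int (fun v => (a ^+ 2 + v ^+ 2)^-1) (pi / 2 / a).
Proof.
move=> a0; have ai : 0 < a^-1 by rewrite invr_gt0.
apply: has_int_eq (has_int_scale (a ^+ 2)^-1 (has_int_dil ai int_atan1)) _ _ _.
- by mea.
- move=> x x0; field; rewrite ?gt_eqF//= ?addr_gt0 ?exprn_gt0//.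
- by rewrite invrK; field; rewrite gt_eqF.
Qed.

Lemma int_sqrtV1 : has_int (fun v : R => (Num.sqrt v)^-1 / (1 + v)) pi.
Proof.
have := @ge0_FTC_integrable R (fun v => (Num.sqrt v)^-1 / (1 + v))
  (fun v => 2 * atan (Num.sqrt v)) 0 pi.
rewrite subr0; apply.
- by mea.
- by move=> x x0; rewrite divr_ge0 ?invr_ge0 ?sqrtr_ge0// addr_ge0// ltW.
- by move=> x x0; con; rewrite gt_eqF ?addr_gt0 ?sqrtr_gt0.
- move=> x x0; apply: has_derP; first by der.
  have s0 : 0 < Num.sqrt x by rewrite sqrtr_gt0.
  rewrite sqr_sqrtr ?ltW//; field.
  by rewrite !gt_eqF ?addr_gt0.
- by apply: con_at_right; [con|rewrite sqrtr0 atan0 mulr0].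
- rewrite [X in _ --> X](_ : _ = 2 * (pi / 2)); last by field.
  apply: cvgM; first exact: cvg_cst.
  apply: (@cvg_comp _ _ _ (@Num.sqrt R) atan); [exact: cvgy_sqrt|exact: cvgy_atan].
Qed.

Lemma int_sqrtV a : 0 < a -> has_int (fun v => (Num.sqrt v)^-1 / (a + v)) (pi / Num.sqrt a).
Proof.
move=> a0; have ai : 0 < a^-1 by rewrite invr_gt0.
have sa : 0 < Num.sqrt a by rewrite sqrtr_gt0.
apply: has_int_eq (has_int_scale (a * Num.sqrt a)^-1 (has_int_dil ai int_sqrtV1)) _ _ _.
- by mea.
- move=> x x0; have sx : 0 < Num.sqrt x by rewrite sqrtr_gt0.
  rewrite sqrtrM ?invr_ge0 ?ltW// sqrtrV ?ltW//; field.
  by rewrite !gt_eqF ?addr_gt0.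
- by rewrite invrK; field; rewrite !gt_eqF.
Qed.

Let s (v : R) := Num.sqrt (2 * v).
Let Fl (v : R) : R := 2^-1 * (ln (s v ^+ 2 - 2 * s v + 2) - ln (s v ^+ 2 + 2 * s v + 2)).
Let Fa (v : R) : R := atan (s v + 1) + atan (s v - 1).

Let qm_gt0 (y : R) : 0 < y ^+ 2 - 2 * y + 2.
Proof. by have := sqr_ge0 (y - 1); lra. Qed.
Let qp_gt0 (y : R) : 0 < y ^+ 2 + 2 * y + 2.
Proof. by have := sqr_ge0 (y + 1); lra. Qed.

Let der_s x : 0 < x -> is_derive x 1 s (s x)^-1.
Proof.
move=> x0; have s0 : 0 < Num.sqrt (2 * x) by rewrite sqrtr_gt0 mulr_gt0.
apply: has_derP; first by rewrite /s; der; rewrite mulr_gt0.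
by rewrite /s; field; rewrite gt_eqF.
Qed.

Let der_Fa x : 0 < x -> is_derive x 1 Fa ((2 * s x ^+ 2 + 4) / (s x * (s x ^+ 4 + 4))).
Proof.
move=> x0; have s0 : 0 < s x by rewrite sqrtr_gt0 mulr_gt0.
have ds := der_s x0.
apply: has_derP; first by rewrite /Fa; apply: der_add; apply: der_atan; apply: der_add; first [exact: ds|exact: der_cst].
have := qm_gt0 (s x); have := qp_gt0 (s x); set y := s x in s0 * => h1 h2.
have e1 : 1 + (y + 1) ^+ 2 = y ^+ 2 + 2 * y + 2 by ring.
have e2 : 1 + (y - 1) ^+ 2 = y ^+ 2 - 2 * y + 2 by ring.
have e3 : y ^+ 4 + 4 = (y ^+ 2 + 2 * y + 2) * (y ^+ 2 - 2 * y + 2) by ring.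
rewrite e1 e2 e3; field.
by rewrite !gt_eqF.
Qed.

Let der_Fl x : 0 < x -> is_derive x 1 Fl ((2 * s x ^+ 2 - 4) / (s x * (s x ^+ 4 + 4))).
Proof.
move=> x0; have s0 : 0 < s x by rewrite sqrtr_gt0 mulr_gt0.
have ds := der_s x0.
apply: has_derP.
  rewrite /Fl; apply: der_mul; first exact: der_cst.
  apply: der_add; last apply: der_opp; (apply: der_ln; [repeat first [exact: ds | der_step]|]).
    exact: qm_gt0.
  exact: qp_gt0.
have := qm_gt0 (s x); have := qp_gt0 (s x); set y := s x in s0 * => h1 h2.
have e3 : y ^+ 4 + 4 = (y ^+ 2 + 2 * y + 2) * (y ^+ 2 - 2 * y + 2) by ring.
rewrite e3 /=; field.
by rewrite !gt_eqF.
Qed.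

Let Fa0 : Fa x @[x --> 0^'+] --> (0 : R).
Proof.
apply: con_at_right; first by rewrite /Fa /s; con.
by rewrite /Fa /s mulr0 sqrtr0 add0r sub0r atanN subrr.
Qed.

Let Fl0 : Fl x @[x --> 0^'+] --> (0 : R).
Proof.
apply: con_at_right.
  by rewrite /Fl /s; con; [exact: qm_gt0|exact: qp_gt0].
by rewrite /Fl /s !mulr0 sqrtr0 mulr0 expr0n/= subr0 addr0 subrr mulr0.
Qed.

Let Fay : Fa x @[x --> +oo] --> (pi : R).
Proof.
have sy : s x @[x --> +oo] --> (+oo : set_system R).
  rewrite /s; apply/cvgryPge => A; near=> x.
  rewrite (le_trans (ler_norm A))// -sqrtr_sqr; apply: ler_wsqrtr.
  rewrite mulrC -ler_pdivrMr//; near: x; by apply: nbhs_pinfty_ge; exact: num_real.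
have h (c : R) : atan (s x + c) @[x --> +oo] --> pi / 2.
  apply: (@cvg_comp _ _ _ (fun x => s x + c) atan _ (+oo : set_system R)); last exact: cvgy_atan.
  apply/cvgryPge => A; near=> x; rewrite -lerBlDr.
  by near: x; move/cvgryPge : sy; exact.
rewrite [X in _ --> X](_ : _ = pi / 2 + pi / 2); last by field.
by rewrite /Fa; apply: cvgD; exact: h.
Unshelve. all: by end_near. Qed.

Let Fly : Fl x @[x --> +oo] --> (0 : R).
Proof.
pose G (y : R) : R := 2^-1 * (ln (1 - s y + y) - ln (1 + s y + y)).
have -> : (0 : R) = G 0 by rewrite /G /s mulr0 sqrtr0 !(addr0, subr0) ln1 subr0 mulr0.
have q1 : 0 < 1 - s 0 + 0 by rewrite /s mulr0 sqrtr0 subr0 addr0.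
have q2 : 0 < 1 + s 0 + 0 by rewrite /s mulr0 sqrtr0 !addr0.
apply: cvgy_inv; first by rewrite /G /s; con.
move=> x x0; rewrite /Fl /G; congr (_ * _).
have s0 : 0 < s x by rewrite sqrtr_gt0 mulr_gt0.
have sx2 : s x ^+ 2 = 2 * x by rewrite sqr_sqrtr// mulr_ge0// ltW.
have sV : s x^-1 = 2 / s x.
  have sV0 : 0 < s x^-1 by rewrite sqrtr_gt0 mulr_gt0// invr_gt0.
  apply/eqP; rewrite -(@eqrXn2 _ 2)// ?ltW ?divr_gt0//; apply/eqP.
  rewrite expr_div_n sx2 sqr_sqrtr ?mulr_ge0 ?invr_ge0 ?ltW//; field.
  by rewrite gt_eqF.
have xE : x = s x ^+ 2 / 2 by rewrite sx2; field.
have xVE : x^-1 = 2 / s x ^+ 2 by rewrite sx2; field; rewrite gt_eqF.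
rewrite sV xVE.
have -> : 1 - 2 / s x + 2 / s x ^+ 2 = (s x ^+ 2 - 2 * s x + 2) / s x ^+ 2.
  by field; rewrite gt_eqF.
have -> : 1 + 2 / s x + 2 / s x ^+ 2 = (s x ^+ 2 + 2 * s x + 2) / s x ^+ 2.
  by field; rewrite gt_eqF.
rewrite !ln_div ?posrE ?exprn_gt0//.
by ring.
Qed.

Let int_half (e : R) : (e = 1 \/ e = -1) ->
  has_int (fun v => 2^-1 * ((2 * s v ^+ 2 + 4) / (s v * (s v ^+ 4 + 4)) +
    e * ((2 * s v ^+ 2 - 4) / (s v * (s v ^+ 4 + 4))))) (pi / 2).
Proof.
move=> e1.
have := @ge0_FTC_integrable R (fun v => 2^-1 * ((2 * s v ^+ 2 + 4) / (s v * (s v ^+ 4 + 4)) +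
    e * ((2 * s v ^+ 2 - 4) / (s v * (s v ^+ 4 + 4))))) (fun v => 2^-1 * (Fa v + e * Fl v)) 0 (pi / 2).
rewrite subr0; apply.
- by rewrite /s; mea.
- move=> x x0; have s0 : 0 < s x by rewrite sqrtr_gt0 mulr_gt0.
  apply: mulr_ge0; first by rewrite invr_ge0.
  rewrite (mulrA e) -mulrDl; apply: divr_ge0.
    by have := sqr_ge0 (s x); case: e1 => ->; nra.
  by rewrite mulr_ge0 ?ltW// addr_gt0 ?exprn_gt0.
- move=> x x0; have s0 : 0 < s x by rewrite sqrtr_gt0 mulr_gt0.
  have : s x * (s x ^+ 4 + 4) != 0 by rewrite gt_eqF// mulr_gt0// addr_gt0// exprn_gt0.
  by rewrite /s => h; con.
- move=> x x0; apply: has_derP.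
    apply: der_mul; first exact: der_cst.
    apply: der_add; first exact: der_Fa.
    apply: der_mul; first exact: der_cst.
    exact: der_Fl.
  by rewrite !mulr0 !addr0.
- rewrite [X in _ --> X](_ : _ = 2^-1 * (0 + e * 0)); last by rewrite mulr0 addr0 mulr0.
  apply: cvgM; first exact: cvg_cst.
  apply: cvgD; first exact: Fa0.
  by apply: cvgM; [exact: cvg_cst|exact: Fl0].
- rewrite [X in _ --> X](_ : _ = 2^-1 * (pi + e * 0)); last by rewrite mulr0 addr0 mulrC.
  apply: cvgM; first exact: cvg_cst.
  apply: cvgD; first exact: Fay.
  by apply: cvgM; [exact: cvg_cst|exact: Fly].
Qed.

Let sE v : s v = Num.sqrt 2 * Num.sqrt v.
Proof. by rewrite /s sqrtrM. Qed.

Let r2 : Num.sqrt 2 ^+ 2 = 2 :> R.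
Proof. by rewrite sqr_sqrtr. Qed.

Let r2_gt0 : 0 < Num.sqrt 2 :> R.
Proof. by rewrite sqrtr_gt0. Qed.

Let s4E x : 0 < x -> s x ^+ 4 + 4 = 4 * (1 + x ^+ 2).
Proof.
move=> x0; have s2 : Num.sqrt x ^+ 2 = x by rewrite sqr_sqrtr// ltW.
by rewrite sE exprMn (exprM _ 2 2) r2 (exprM _ 2 2) s2; ring.
Qed.

Let piE : Num.sqrt 2 * (pi / 2) = pi / Num.sqrt 2 :> R.
Proof. by rewrite -[X in pi / X]r2; field; rewrite gt_eqF. Qed.

(** The rational antiderivatives in the variable $\sqrt{2v}$ have an
    arctangent part and a logarithmic part; the two integrals with
    $v^{1/2}$ and $v^{-1/2}$ in the numerator are their sum and difference. *)
Lemma int_sqrt1 : has_int (fun v : R => Num.sqrt v / (1 + v ^+ 2)) (pi / Num.sqrt 2).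
Proof.
apply: has_int_eq (has_int_scale (Num.sqrt 2) (int_half (or_introl erefl))) _ _ _.
- by mea.
- move=> x x0; have s0 : 0 < Num.sqrt x by rewrite sqrtr_gt0.
  have s2 : Num.sqrt x ^+ 2 = x by rewrite sqr_sqrtr// ltW.
  have x21 : 0 < 1 + x ^+ 2 by rewrite addr_gt0// exprn_gt0.
  rewrite s4E// sE exprMn r2 s2.
  transitivity (x / (Num.sqrt x * (1 + x ^+ 2))).
    by rewrite -[X in X / (_ * _)]s2; field; rewrite !gt_eqF.
  by field; rewrite !gt_eqF.
- exact: piE.
Qed.

Lemma int_sqrtV21 : has_int (fun v : R => (Num.sqrt v)^-1 / (1 + v ^+ 2)) (pi / Num.sqrt 2).
Proof.
apply: has_int_eq (has_int_scale (Num.sqrt 2) (int_half (or_intror erefl))) _ _ _.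
- by mea.
- move=> x x0; have s0 : 0 < Num.sqrt x by rewrite sqrtr_gt0.
  have s2 : Num.sqrt x ^+ 2 = x by rewrite sqr_sqrtr// ltW.
  have x21 : 0 < 1 + x ^+ 2 by rewrite addr_gt0// exprn_gt0.
  rewrite s4E// sE exprMn r2 s2.
  by field; rewrite !gt_eqF.
- exact: piE.
Qed.

Lemma int_sqrt a : 0 < a ->
  has_int (fun v => Num.sqrt v / (a ^+ 2 + v ^+ 2)) (pi / (Num.sqrt 2 * Num.sqrt a)).
Proof.
move=> a0; have ai : 0 < a^-1 by rewrite invr_gt0.
have sa : 0 < Num.sqrt a by rewrite sqrtr_gt0.
have sa2 : Num.sqrt a ^+ 2 = a by rewrite sqr_sqrtr// ltW.
apply: has_int_eq (has_int_scale (Num.sqrt a / a ^+ 2) (has_int_dil ai int_sqrt1)) _ _ _.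
- by mea.
- move=> x x0; have sx : 0 < Num.sqrt x by rewrite sqrtr_gt0.
  rewrite sqrtrM ?invr_ge0 ?ltW// sqrtrV ?ltW//; field.
  by rewrite !gt_eqF ?addr_gt0 ?exprn_gt0.
- rewrite invrK -[X in X ^+ 2]sa2 -[X in X * (pi / _)]sa2; field.
  by rewrite !gt_eqF.
Qed.

Lemma int_sqrtV2 a : 0 < a ->
  has_int (fun v => (Num.sqrt v)^-1 / (a ^+ 2 + v ^+ 2)) (pi / (Num.sqrt 2 * a * Num.sqrt a)).
Proof.
move=> a0; have ai : 0 < a^-1 by rewrite invr_gt0.
have sa : 0 < Num.sqrt a by rewrite sqrtr_gt0.
apply: has_int_eq (has_int_scale (a ^+ 2 * Num.sqrt a)^-1 (has_int_dil ai int_sqrtV21)) _ _ _.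
- by mea.
- move=> x x0; have sx : 0 < Num.sqrt x by rewrite sqrtr_gt0.
  rewrite sqrtrM ?invr_ge0 ?ltW// sqrtrV ?ltW//; field.
  by rewrite !gt_eqF ?addr_gt0 ?exprn_gt0.
- by rewrite invrK; field; rewrite !gt_eqF.
Qed.

Lemma int_ln x t : 0 < x -> 0 < t -> x != t ->
  has_int (fun v => ((x + v) * (v + t))^-1) ((ln x - ln t) / (x - t)).
Proof.
move=> x0 t0 xt; have xt' : x - t != 0 by rewrite subr_eq0.
pose F v := (ln (v + t) - ln (v + x)) / (x - t).
pose G y := (ln (1 + t * y) - ln (1 + x * y)) / (x - t).
have := @has_int_FTC R (fun v => ((x + v) * (v + t))^-1) F G.
have -> : G 0 - F 0 = (ln x - ln t) / (x - t).
  by rewrite /G /F !(mulr0, addr0, add0r) ln1; field.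
apply.
- by mea.
- by move=> v v0; rewrite invr_ge0 mulr_ge0// ltW// addr_gt0.
- by move=> v v0; con; rewrite gt_eqF// mulr_gt0// addr_gt0.
- move=> v v0; apply: has_derP; first by rewrite /F; der; rewrite addr_gt0.
  by rewrite /=; field; rewrite xt' !gt_eqF ?addr_gt0.
- by rewrite /F; con; rewrite add0r.
- by rewrite /G; con; rewrite mulr0 addr0.
- move=> v v0; rewrite /F /G; congr (_ / _).
  have E c : 0 < c -> ln (v + c) = ln v + ln (1 + c * v^-1).
    move=> c0; rewrite -lnM ?posrE ?addr_gt0 ?mulr_gt0 ?invr_gt0//; congr ln.
    by field; rewrite gt_eqF.
  by rewrite !E//; ring.
Qed.

Lemma int_ln2 x t : 0 < x -> 0 < t -> x != t ->
  has_int (fun v => v / ((x ^+ 2 + v ^+ 2) * (v ^+ 2 + t ^+ 2)))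
    ((ln x - ln t) / (x ^+ 2 - t ^+ 2)).
Proof.
move=> x0 t0 xt; have xt' : x ^+ 2 - t ^+ 2 != 0.
  by rewrite subr_eq0 eqrXn2 ?ltW.
pose F v := (ln (v ^+ 2 + t ^+ 2) - ln (v ^+ 2 + x ^+ 2)) / (2 * (x ^+ 2 - t ^+ 2)).
pose G y := (ln (1 + t ^+ 2 * y ^+ 2) - ln (1 + x ^+ 2 * y ^+ 2)) / (2 * (x ^+ 2 - t ^+ 2)).
have := @has_int_FTC R (fun v => v / ((x ^+ 2 + v ^+ 2) * (v ^+ 2 + t ^+ 2))) F G.
have -> : G 0 - F 0 = (ln x - ln t) / (x ^+ 2 - t ^+ 2).
  rewrite /G /F expr0n/= !(mulr0, addr0, add0r) ln1 !lnXn//; field.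
  by [].
apply.
- by mea.
- by move=> v v0; rewrite divr_ge0 ?mulr_ge0 ?addr_ge0 ?sqr_ge0// ltW.
- by move=> v v0; con; rewrite gt_eqF// mulr_gt0// addr_gt0// exprn_gt0.
- move=> v v0; apply: has_derP; first by rewrite /F; der; rewrite addr_gt0// exprn_gt0.
  by rewrite /=; field; rewrite xt' !gt_eqF ?addr_gt0 ?exprn_gt0.
- by rewrite /F; con; rewrite expr0n/= add0r exprn_gt0.
- by rewrite /G; con; rewrite expr0n/= mulr0 addr0.
- move=> v v0; rewrite /F /G; congr (_ / _).
  have E c : 0 < c -> ln (v ^+ 2 + c) = ln (v ^+ 2) + ln (1 + c * v^-1 ^+ 2).
    move=> c0; rewrite -lnM ?posrE ?addr_gt0 ?mulr_gt0 ?exprn_gt0 ?invr_gt0//; congr ln.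
    by field; rewrite gt_eqF.
  by rewrite !E ?exprn_gt0//; ring.
Qed.

Lemma int_pi4 : has_int (fun v : R => ((1 + v) * (1 + v ^+ 2))^-1) (pi / 4).
Proof.
pose F v : R := 2^-1 * ln (1 + v) - 4^-1 * ln (1 + v ^+ 2) + 2^-1 * atan v.
pose G y : R := 2^-1 * ln (1 + y) - 4^-1 * ln (1 + y ^+ 2).
have := @ge0_FTC_integrable R (fun v => ((1 + v) * (1 + v ^+ 2))^-1) F 0 (pi / 4).
rewrite subr0; apply.
- by mea.
- by move=> v v0; rewrite invr_ge0 mulr_ge0 ?addr_ge0 ?sqr_ge0// ltW.
- by move=> v v0; con; rewrite gt_eqF// mulr_gt0// addr_gt0// exprn_gt0.
- move=> v v0; apply: has_derP; first by rewrite /F; der; rewrite addr_gt0// exprn_gt0.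
  by rewrite /=; field; rewrite !gt_eqF ?addr_gt0 ?exprn_gt0.
- apply: con_at_right; first by rewrite /F; con; rewrite ?expr0n ?addr0.
  by rewrite /F expr0n/= !addr0 ln1 atan0; ring.
- rewrite [X in _ --> X](_ : _ = G 0 + 2^-1 * (pi / 2)); last first.
    by rewrite /G expr0n/= !addr0 ln1; field.
  apply: cvgD; last by apply: cvgM; [exact: cvg_cst|exact: cvgy_atan].
  apply: cvgy_inv; first by rewrite /G; con; rewrite ?expr0n ?addr0.
  move=> v v0; rewrite /G.
  have -> : 1 + v = v * (1 + v^-1) by field; rewrite gt_eqF.
  have -> : 1 + v ^+ 2 = v * (v * (1 + v^-1 ^+ 2)) by field; rewrite gt_eqF.
  rewrite !lnM ?posrE ?mulr_gt0 ?addr_gt0 ?exprn_gt0 ?invr_gt0//.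
  by field.
Qed.

Lemma int_pi4' : has_int (fun v : R => v / ((1 + v) * (1 + v ^+ 2))) (pi / 4).
Proof.
apply: has_int_eq (has_int_add int_atan1 (has_int_scale (-1) int_pi4)) _ _ _.
- by mea.
- by move=> v v0; field; rewrite !gt_eqF ?addr_gt0 ?exprn_gt0.
- by field.
Qed.

(** Fourth root, and an integrable majorant on the half-line: it behaves like
    $v^{-3/4}$ at 0 and like $v^{-5/4}$ at infinity, so that it dominates
    square-root kernels even after multiplication by a logarithm. *)
Definition root4 (v : R) := Num.sqrt (Num.sqrt v).

Lemma root4_gt0 v : 0 < v -> 0 < root4 v.
Proof. by move=> v0; rewrite !sqrtr_gt0. Qed.

Lemma root4_sqr v : 0 < v -> root4 v ^+ 2 = Num.sqrt v.
Proof. by move=> v0; rewrite sqr_sqrtr// sqrtr_ge0. Qed.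

Lemma root4_4 v : 0 < v -> root4 v ^+ 4 = v.
Proof. by move=> v0; rewrite (exprM _ 2 2) root4_sqr// sqr_sqrtr// ltW. Qed.

Definition majorant (v : R) := (root4 v ^+ 3 * (1 + root4 v) ^+ 2)^-1.

(** Its antiderivative is rational in the fourth root. *)
Lemma integrable_majorant : hl.-integrable setT (EFin \o majorant).
Proof.
pose F v : R := - (1 + root4 v)^-1.
pose G y : R := - (root4 y / (1 + root4 y)).
have r40 : root4 0 = 0 :> R by rewrite /root4 !sqrtr0.
have h : has_int (fun v => 4^-1 * majorant v) (G 0 - F 0).
  apply: has_int_FTC.
  - by rewrite /majorant /root4; mea.
  - move=> v v0; have := root4_gt0 v0 => r0.
    by rewrite mulr_ge0// invr_ge0 mulr_ge0 ?sqr_ge0// exprn_ge0// ltW.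
  - move=> v v0; have := root4_gt0 v0; rewrite /root4 => r0.
    by rewrite /majorant /root4; con; rewrite gt_eqF// mulr_gt0// exprn_gt0// addr_gt0.
  - move=> v v0; have r0 := root4_gt0 v0.
    have sv : 0 < Num.sqrt v by rewrite sqrtr_gt0.
    apply: has_derP; first by rewrite /F /root4; der; rewrite ?gt_eqF ?addr_gt0 ?sqrtr_gt0.
    rewrite /majorant -/(root4 v) -(root4_sqr v0); field.
    by rewrite !gt_eqF// addr_gt0.
  - by rewrite /F /root4; con; rewrite !sqrtr0 addr0 oner_neq0.
  - by rewrite /G /root4; con; rewrite !sqrtr0 addr0 oner_neq0.
  - move=> v v0; have r0 := root4_gt0 v0.
    have rV : root4 v^-1 = (root4 v)^-1.
      by rewrite /root4 sqrtrV ?ltW// sqrtrV// sqrtr_ge0.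
    rewrite /F /G rV; field.
    by rewrite !gt_eqF// addr_gt0.
have [i1 _] := has_int_scale 4 h.
apply: eq_integrable i1 => // x _ /=; congr EFin; by field.
Qed.

Lemma ln_root4 v : 0 < v -> `|ln v| <= 4 * (root4 v + (root4 v)^-1).
Proof.
move=> v0; have r0 := root4_gt0 v0.
have h1 := ln_sublinear r0.
have ri : 0 < (root4 v)^-1 by rewrite invr_gt0.
have h2 := ln_sublinear ri; rewrite lnV ?posrE// in h2.
have -> : ln v = 4 * ln (root4 v).
  by rewrite -[in LHS](root4_4 v0) lnXn// mulr_natl.
by rewrite ler_norml; apply/andP; split; lra.
Qed.

End ElementaryIntegrals.

(** * Logarithmic integrals *)

Section LogIntegrals.
Context {R : realType}.
Implicit Types (a p q x t v : R).

Lemma sqrt_mulV x : 0 < x -> Num.sqrt x = x * (Num.sqrt x)^-1.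
Proof.
move=> x0; have s0 : 0 < Num.sqrt x by rewrite sqrtr_gt0.
by rewrite -[X in X * _](sqr_sqrtr (ltW x0)); field; rewrite gt_eqF.
Qed.

Lemma ae_hl_neq a (P : R -> Prop) : (forall x, 0 < x -> x != a -> P x) -> {ae hl, forall x, P x}.
Proof.
move=> h; apply/ae_hl; exists [set a]; split => //; first exact: lebesgue_measure_set1.
move=> x /= nP; apply: contrapT => xa; apply: nP => /RplusE x0; apply: h => //.
exact/eqP.
Qed.

Lemma majorant_ln_bound x : 0 < x ->
  (1 + x) * (Num.sqrt x)^-1 / (1 + x ^+ 2) * `|ln x| <= 32 * majorant x.
Proof.
move=> x0; have r0 := root4_gt0 x0.
apply: le_trans (ler_wpM2l _ (ln_root4 x0)) _.
  rewrite divr_ge0 ?mulr_ge0 ?addr_ge0 ?sqr_ge0 ?invr_ge0 ?sqrtr_ge0// ltW//.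
rewrite /majorant; move: r0 (root4_4 x0) (root4_sqr x0); set r := root4 x.
move: r => r r0 xE sE; rewrite -sE -xE.
have -> : (1 + r ^+ 4) * (r ^+ 2)^-1 / (1 + (r ^+ 4) ^+ 2) * (4 * (r + r^-1)) =
  4 * ((1 + r ^+ 4) * (r ^+ 2 + 1)) / (r ^+ 3 * (1 + (r ^+ 4) ^+ 2)).
  by field; rewrite !gt_eqF ?addr_gt0 ?exprn_gt0.
rewrite ler_pdivrMr ?mulr_gt0 ?addr_gt0 ?exprn_gt0//.
have -> : 32 * (r ^+ 3 * (1 + r) ^+ 2)^-1 * (r ^+ 3 * (1 + (r ^+ 4) ^+ 2)) =
  32 * (1 + (r ^+ 4) ^+ 2) / (1 + r) ^+ 2.
  by field; rewrite !gt_eqF ?addr_gt0 ?exprn_gt0.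
rewrite ler_pdivlMr ?exprn_gt0 ?addr_gt0//.
have h1 : (1 + r) ^+ 2 <= 2 * (1 + r ^+ 2) by have := sqr_ge0 (1 - r); lra.
have h2 : (1 + r ^+ 2) ^+ 2 <= 2 * (1 + r ^+ 4).
  by have := sqr_ge0 (1 - r ^+ 2); rewrite sqrrB sqrrD -!exprM /=; lra.
have h3 : (1 + r ^+ 4) ^+ 2 <= 2 * (1 + (r ^+ 4) ^+ 2).
  by have := sqr_ge0 (1 - r ^+ 4); rewrite sqrrB sqrrD -!exprM /=; lra.
have p2 : 0 <= r ^+ 2 by rewrite sqr_ge0.
have p4 : 0 <= r ^+ 4 by rewrite exprn_ge0// ltW.
apply: (@le_trans _ _ (4 * ((1 + r ^+ 4) * (r ^+ 2 + 1)) * (2 * (1 + r ^+ 2)))).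
  by apply: ler_wpM2l h1; rewrite !mulr_ge0// addr_ge0.
apply: (@le_trans _ _ (8 * (1 + r ^+ 4) * (2 * (1 + r ^+ 4)))).
  have -> : 4 * ((1 + r ^+ 4) * (r ^+ 2 + 1)) * (2 * (1 + r ^+ 2)) =
    8 * (1 + r ^+ 4) * (1 + r ^+ 2) ^+ 2 by ring.
  by apply: ler_wpM2l h2; rewrite mulr_ge0// addr_ge0.
by move: h3; rewrite expr2; lra.
Qed.

Lemma ln_div_ge0 x : 0 < x -> x != 1 -> 0 <= ln x / (x - 1).
Proof.
move=> x0 x1; have [h|h] := ltP 1 x.
  by rewrite divr_ge0 ?ln_ge0 ?subr_ge0// ltW.
by rewrite -mulrNN -invrN mulr_ge0 ?oppr_ge0 ?ln_le0// invr_ge0 oppr_ge0 subr_le0.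
Qed.

(** The logarithm is removed by writing $\ln x = \int_0^\infty
    (x-1)/((v+1)(v+x))\,dv$ and exchanging the two integrations; the inner
    integral is then algebraic. *)
Lemma int_log p q :
  has_int (fun x => (p + q * x) * (Num.sqrt x)^-1 / (1 + x ^+ 2) * ln x)
    ((q - p) * (pi ^+ 2 * Num.sqrt 2 / 4)).
Proof.
pose phi x := (p + q * x) * (Num.sqrt x)^-1 / (1 + x ^+ 2).
have mphi : measurable_fun setT phi by rewrite /phi; mea.
have iphi : hl.-integrable setT (EFin \o (fun x => phi x * ln x)).
  apply: (@le_integrable_hl R _ (fun x => (`|p| + `|q|) * 32 * majorant x)).
  - by mea.
  - move=> x x0; rewrite normrM /phi normrM normrM.
    have sx : 0 < Num.sqrt x by rewrite sqrtr_gt0.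
    have si : 0 <= (Num.sqrt x)^-1 by rewrite invr_ge0 sqrtr_ge0.
    have xi : 0 <= (1 + x ^+ 2)^-1 by rewrite invr_ge0 addr_ge0 ?sqr_ge0.
    rewrite (ger0_norm si) (ger0_norm xi).
    apply: (@le_trans _ _ ((`|p| + `|q|) * ((1 + x) * (Num.sqrt x)^-1 / (1 + x ^+ 2) * `|ln x|))).
      rewrite !mulrA; do 3 (apply: ler_wpM2r; first by []).
      apply: le_trans (ler_normD _ _) _; rewrite normrM (ger0_norm (ltW x0)).
      have := normr_ge0 p; have := normr_ge0 q; nra.
    by rewrite -[leRHS]mulrA; apply: ler_wpM2l; [rewrite addr_ge0|exact: majorant_ln_bound].
  have := integrableZl measurableT ((`|p| + `|q|) * 32) (@integrable_majorant R).
  by apply: eq_integrable => // x _ /=; rewrite EFinM.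
pose h (z : R * R) := phi z.1 * (z.1 - 1) / ((z.1 + z.2) * (z.2 + 1)).
have mh : measurable_fun setT h.
  rewrite /h; apply: measurable_funM; first apply: measurable_funM; mea.
  exact: (measurableT_comp mphi).
have hx x : 0 < x -> x != 1 -> has_int (fun v => h (x, v)) (phi x * ln x).
  move=> x0 x1; apply: has_int_eq (has_int_scale (phi x * (x - 1)) (int_ln x0 ltr01 x1)) _ _ _.
  - by rewrite /h/=; mea.
  - by move=> v v0.
  - by rewrite ln1 subr0 /=; field; rewrite subr_eq0.
have hx' x : 0 < x -> x != 1 -> has_int (fun v => `|h (x, v)|) `|phi x * ln x|.
  move=> x0 x1; apply: has_int_eq (has_int_scale `|phi x * (x - 1)| (int_ln x0 ltr01 x1)) _ _ _.
  - by rewrite /h/=; mea.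
  - move=> v v0; rewrite /h /= normrM; congr (_ * _); rewrite ger0_norm//.
    by rewrite invr_ge0 mulr_ge0// ltW// addr_gt0.
  - have x1' : x - 1 != 0 by rewrite subr_eq0.
    rewrite ln1 subr0 -[X in _ * X](ger0_norm (ln_div_ge0 x0 x1)) -normrM /=.
    by congr `|_|; field.
have ih : (hl \x hl)%E.-integrable setT (EFin \o h).
  apply/integrable12ltyP; first exact/measurable_EFinP.
  have /integrableP[_] := iphi; apply: le_lt_trans.
  rewrite (@ae_eq_integral _ _ _ hl setT (fun x => `|(phi x * ln x)%:E|)%E)//.
  - apply: (@measurable_fun_fubini_tonelli_F _ _ _ _ _ hl (fun z => `|(EFin \o h) z|)%E) => //.
    by apply: measurableT_comp => //; exact/measurable_EFinP.
  - have m1 : measurable_fun setT (fun x => phi x * ln x) by mea.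
    by apply/measurable_EFinP; exact: measurable_normr.
  apply: (@ae_hl_neq 1) => x x0 x1 _ /=.
  exact: has_int_ereal (hx' x x0 x1).
split => //.
have FE := Fubini ih.
rewrite /Rintegral -[RHS]/(fine (((q - p) * (pi ^+ 2 * Num.sqrt 2 / 4))%:E)); congr fine.
transitivity (\int[hl]_x \int[hl]_v (EFin \o h) (x, v))%E.
  apply: ae_eq_integral => //.
  - by apply/measurable_EFinP; mea.
  - exact: measurable_fubini_F ih.
  by apply: (@ae_hl_neq 1) => x x0 x1 _ /=; apply/esym; exact: has_int_ereal (hx x x0 x1).
rewrite FE.
have r2 : Num.sqrt 2 ^+ 2 = 2 :> R by rewrite sqr_sqrtr.
have r0 : 0 < Num.sqrt 2 :> R by rewrite sqrtr_gt0.
pose J v := (p * (- pi) * ((Num.sqrt v)^-1 / (1 + v ^+ 2)) + q * pi * (Num.sqrt v / (1 + v ^+ 2)))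
  + (p * (Num.sqrt 2 * pi) * ((1 + v) * (1 + v ^+ 2))^-1 +
     q * (- (Num.sqrt 2 * pi)) * (v / ((1 + v) * (1 + v ^+ 2)))).
have hJ : has_int J ((q - p) * (pi ^+ 2 * Num.sqrt 2 / 4)).
  apply: has_int_eq
    (has_int_add (has_int_add (has_int_scale (p * (- pi)) int_sqrtV21)
       (has_int_scale (q * pi) int_sqrt1))
     (has_int_add (has_int_scale (p * (Num.sqrt 2 * pi)) int_pi4)
       (has_int_scale (q * (- (Num.sqrt 2 * pi))) int_pi4'))) _ _ _ => //.
  - by rewrite /J; mea.
  - have -> : pi / Num.sqrt 2 = pi * Num.sqrt 2 / 2 :> R.
      by rewrite -[X in _ = _ / X]r2; field; rewrite gt_eqF.
    by field.
rewrite -(has_int_ereal hJ); apply: ae_eq_integral => //.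
- exact: measurable_fubini_G ih.
- by apply/measurable_EFinP; exact: has_int_measurable hJ.
apply: ae_hlW => v v0 _.
suff hv : has_int (fun x => h (x, v)) (J v) by rewrite -(has_int_ereal hv).
pose c := ((1 + v) * (1 + v ^+ 2))^-1.
have sv : 0 < Num.sqrt v by rewrite sqrtr_gt0.
have sv2 : Num.sqrt v ^+ 2 = v by rewrite sqr_sqrtr// ltW.
apply: has_int_eq (has_int_add (has_int_scale (c * (- p * (1 + v) + q * v * (v + 1))) (int_sqrtV v0))
  (has_int_add (has_int_scale (c * (p * (1 + v) + q * (1 - v))) int_sqrt1)
    (has_int_scale (c * (p * (1 - v) - q * (1 + v))) int_sqrtV21))) _ _ _.
- exact: (measurableT_comp mh (pair2_measurable v)).
- move=> x x0; rewrite /h /= /phi /c.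
  have sx : 0 < Num.sqrt x by rewrite sqrtr_gt0.
  have -> : Num.sqrt x / (1 + x ^+ 2) = x * (Num.sqrt x)^-1 / (1 + x ^+ 2).
    by rewrite [X in X / _](sqrt_mulV x0).
  by field; rewrite !gt_eqF ?addr_gt0 ?exprn_gt0.
- rewrite /J /c.
  have -> : pi / Num.sqrt 2 = pi * Num.sqrt 2 / 2 :> R.
    by rewrite -[X in _ = _ / X]r2; field; rewrite gt_eqF.
  have -> : Num.sqrt v / (1 + v ^+ 2) = v * (Num.sqrt v)^-1 / (1 + v ^+ 2).
    by rewrite [X in X / _](sqrt_mulV v0).
  by field; rewrite !gt_eqF ?addr_gt0 ?exprn_gt0.
Qed.

Lemma int_lnV a : 0 < a -> has_int (fun v => (Num.sqrt v)^-1 / (a ^+ 2 + v ^+ 2) * ln v)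
  ((ln a * (pi / Num.sqrt 2) - pi ^+ 2 * Num.sqrt 2 / 4) / (a * Num.sqrt a)).
Proof.
move=> a0; have ai : 0 < a^-1 by rewrite invr_gt0.
have sa : 0 < Num.sqrt a by rewrite sqrtr_gt0.
have r0 : 0 < Num.sqrt 2 :> R by rewrite sqrtr_gt0.
apply: has_int_eq (has_int_add (has_int_scale (a ^+ 2 * Num.sqrt a)^-1
   (has_int_dil ai (int_log 1 0))) (has_int_scale (ln a) (int_sqrtV2 a0))) _ _ _.
- by mea.
- move=> x x0; have sx : 0 < Num.sqrt x by rewrite sqrtr_gt0.
  rewrite sqrtrM ?invr_ge0 ?ltW// sqrtrV ?ltW// lnM ?posrE// lnV ?posrE//; field.
  by rewrite !gt_eqF ?addr_gt0 ?exprn_gt0.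
- by rewrite invrK; field; rewrite !gt_eqF.
Qed.

Lemma int_lns a : 0 < a -> has_int (fun v => Num.sqrt v / (a ^+ 2 + v ^+ 2) * ln v)
  ((ln a * (pi / Num.sqrt 2) + pi ^+ 2 * Num.sqrt 2 / 4) / Num.sqrt a).
Proof.
move=> a0; have ai : 0 < a^-1 by rewrite invr_gt0.
have sa : 0 < Num.sqrt a by rewrite sqrtr_gt0.
have r0 : 0 < Num.sqrt 2 :> R by rewrite sqrtr_gt0.
apply: has_int_eq (has_int_add (has_int_scale (a * Num.sqrt a)^-1
   (has_int_dil ai (int_log 0 1))) (has_int_scale (ln a) (int_sqrt a0))) _ _ _.
- by mea.
- move=> x x0; have sx : 0 < Num.sqrt x by rewrite sqrtr_gt0.
  rewrite sqrtrM ?invr_ge0 ?ltW// sqrtrV ?ltW// lnM ?posrE// lnV ?posrE//.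
  have -> : Num.sqrt x / (a ^+ 2 + x ^+ 2) = x * (Num.sqrt x)^-1 / (a ^+ 2 + x ^+ 2).
    by rewrite [X in X / _](sqrt_mulV x0).
  by field; rewrite !gt_eqF ?addr_gt0 ?exprn_gt0.
- by rewrite invrK; field; rewrite !gt_eqF.
Qed.

End LogIntegrals.

(** * Homogeneous kernels *)

Section HalfLineKernels.
Context {R : realType}.
Implicit Types (a b x t v z : R).
Local Notation H := (L2space (@hl R)).

(** The Schur weight $t^{-1/2}$, written so as to be positive everywhere. *)
Definition wt (t : R) : R := expR (- ln t / 2).

Lemma measurable_wt : measurable_fun setT wt.
Proof. by rewrite /wt; mea. Qed.

Lemma wt_gt0 t : 0 < wt t. Proof. exact: expR_gt0. Qed.

Lemma wtE t : 0 < t -> wt t = (Num.sqrt t)^-1.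
Proof.
move=> t0; rewrite /wt mulNr expRN; congr (_^-1).
by rewrite -powR12_sqrt ?ltW// /powR gt_eqF// mulrC.
Qed.

Lemma hl_row (K : R -> R -> R) (D M : R) (g : R -> R) x :
  measurable_fun setT (K x) ->
  (forall t, 0 < t -> `|K x t| * wt t <= g t) -> has_int g D -> D <= M ->
  (\int[hl]_t (`|K x t| * wt t)%:E <= M%:E)%E.
Proof.
move=> mK Kg hg DM; apply: (@le_trans _ _ D%:E); last by rewrite lee_fin.
have mw := measurable_wt.
rewrite -(has_int_ereal hg); apply: ge0_le_integral_hl.
- by mea.
- exact: has_int_measurable hg.
by move=> t t0; rewrite Kg// andbT mulr_ge0// ltW// wt_gt0.
Qed.

(** Every kernel dominated by Hilbert's is bounded, because
    $\int_0^\infty t^{-1/2}/(x+t)\,dt=\pi x^{-1/2}$. *)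
Lemma schur_hilbert (K : R -> R -> R) (C : R) : 0 < C ->
  measurable_fun setT (fun p : measurableTypeR R * measurableTypeR R => K p.1 p.2) ->
  (forall x t, 0 < x -> 0 < t -> `|K x t| <= C / (x + t)) ->
  schur hl wt K (C * pi).
Proof.
move=> C0 mK KC; split => //; first by rewrite mulr_gt0 ?pi_gt0.
- apply: ae_hlW => x x0; apply: (@hl_row _ _ _ (fun t => C * ((Num.sqrt t)^-1 / (x + t)))
    x _ _ (has_int_scale C (int_sqrtV x0))).
  + exact: measurable_row.
  + move=> t t0; rewrite wtE// [leRHS](_ : _ = C / (x + t) * (Num.sqrt t)^-1); last by ring.
    by apply: ler_wpM2r; [rewrite invr_ge0 sqrtr_ge0|exact: KC].
  + by rewrite wtE// mulrA.
- apply: ae_hlW => t t0; apply: (@hl_row (fun t x => K x t) _ _ (fun x => C * ((Num.sqrt x)^-1 / (t + x)))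
    t _ _ (has_int_scale C (int_sqrtV t0))).
  + exact: measurable_col.
  + move=> x x0; rewrite wtE// [leRHS](_ : _ = C / (t + x) * (Num.sqrt x)^-1); last by ring.
    by rewrite addrC; apply: ler_wpM2r; [rewrite invr_ge0 sqrtr_ge0|exact: KC].
  + by rewrite wtE// mulrA.
Qed.

Definition kS (x t : R) : R := (x + t)^-1.
Definition kL (x t : R) : R := expR (- (x * t)).
Definition kC1 (x t : R) : R := x / (x ^+ 2 + t ^+ 2).
Definition kC2 (x t : R) : R := t / (x ^+ 2 + t ^+ 2).
Definition kP (x t : R) : R := 2 / pi * (Num.sqrt x * Num.sqrt t / (x ^+ 2 + t ^+ 2)).
Definition kM (x t : R) : R := Num.sqrt 2 / pi * ((x + t) / (x ^+ 2 + t ^+ 2)).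
Definition omega (a b u : R) : R := Num.sqrt u * (a + b * ln u) / (1 + u ^+ 2).
Definition kW (a b x t : R) : R := omega a b (x / t) / t.

Lemma schur_S : schur hl wt kS (1 * pi).
Proof.
apply: schur_hilbert => //; first by rewrite /kS; mea.
by move=> x t x0 t0; rewrite /kS mul1r ger0_norm// invr_ge0 ltW// addr_gt0.
Qed.

Let sq_gt0 x t : 0 < x -> 0 < t -> 0 < x ^+ 2 + t ^+ 2.
Proof. by move=> x0 t0; rewrite addr_gt0 ?exprn_gt0. Qed.

Lemma schur_C1 : schur hl wt kC1 (2 * pi).
Proof.
apply: schur_hilbert => //; first by rewrite /kC1; mea.
move=> x t x0 t0; have h := sq_gt0 x0 t0.
rewrite /kC1 ger0_norm ?divr_ge0 ?(ltW x0) ?(ltW h)//.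
by rewrite ler_pdivrMr// mulrAC ler_pdivlMr ?addr_gt0//; have := sqr_ge0 (x - t); nra.
Qed.

Lemma schur_C2 : schur hl wt kC2 (2 * pi).
Proof.
apply: schur_hilbert => //; first by rewrite /kC2; mea.
move=> x t x0 t0; have h := sq_gt0 x0 t0.
rewrite /kC2 ger0_norm ?divr_ge0 ?(ltW t0) ?(ltW h)//.
by rewrite ler_pdivrMr// mulrAC ler_pdivlMr ?addr_gt0//; have := sqr_ge0 (x - t); nra.
Qed.

Lemma schur_P : schur hl wt kP ((2 / pi) * pi).
Proof.
have p0 : 0 < 2 / pi :> R by rewrite divr_gt0 ?pi_gt0.
apply: schur_hilbert => //; first by rewrite /kP; mea.
move=> x t x0 t0; have h := sq_gt0 x0 t0.
have sx : 0 < Num.sqrt x by rewrite sqrtr_gt0.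
have st : 0 < Num.sqrt t by rewrite sqrtr_gt0.
rewrite /kP ger0_norm; last by rewrite mulr_ge0 ?divr_ge0 ?mulr_ge0 ?pi_ge0// ltW.
apply: ler_wpM2l; first exact: ltW.
rewrite ler_pdivrMr// [leRHS]mulrC ler_pdivlMr ?addr_gt0//.
have := sqr_ge0 (x - t); have := sqr_ge0 (Num.sqrt x - Num.sqrt t).
have := sqr_sqrtr (ltW x0); have := sqr_sqrtr (ltW t0).
move: (Num.sqrt x) (Num.sqrt t) sx st => p q p0' q0' <- <-.
have := mulr_ge0 (sqr_ge0 (p - q)) (addr_ge0 (sqr_ge0 p) (sqr_ge0 q)); nra.
Qed.

Lemma schur_M : schur hl wt kM ((Num.sqrt 2 / pi * 2) * pi).
Proof.
have p0 : 0 < Num.sqrt 2 / pi :> R by rewrite divr_gt0 ?pi_gt0 ?sqrtr_gt0.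
apply: schur_hilbert => //; [by rewrite mulr_gt0|by rewrite /kM; mea|].
move=> x t x0 t0; have h := sq_gt0 x0 t0.
rewrite /kM ger0_norm; last first.
  by rewrite mulr_ge0 ?(ltW p0)// divr_ge0 ?(ltW h)// addr_ge0// ltW.
rewrite -!mulrA ler_wpM2l ?sqrtr_ge0// ler_wpM2l ?invr_ge0 ?pi_ge0//.
by rewrite ler_pdivrMr// mulrAC ler_pdivlMr ?addr_gt0//; have := sqr_ge0 (x - t); nra.
Qed.

Lemma ln_le_sqrt (u : R) : 0 < u -> `|ln u| <= 2 * (Num.sqrt u + (Num.sqrt u)^-1).
Proof.
move=> u0; have s0 : 0 < Num.sqrt u by rewrite sqrtr_gt0.
have si : 0 < (Num.sqrt u)^-1 by rewrite invr_gt0.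
have h1 := ln_sublinear s0; have h2 := ln_sublinear si; rewrite lnV ?posrE// in h2.
have -> : ln u = 2 * ln (Num.sqrt u).
  by rewrite -[in LHS](sqr_sqrtr (ltW u0)) lnXn// mulr_natl.
by rewrite ler_norml; apply/andP; split; lra.
Qed.

Lemma omega_bound a b (u : R) : 0 < u ->
  `|omega a b u| <= (`|a| + 2 * `|b|) * (1 + u) / (1 + u ^+ 2).
Proof.
move=> u0; have s0 : 0 < Num.sqrt u by rewrite sqrtr_gt0.
have d0 : 0 <= (1 + u ^+ 2)^-1 by rewrite invr_ge0 addr_ge0 ?sqr_ge0.
rewrite /omega normrM (ger0_norm d0); apply: ler_wpM2r => //.
rewrite normrM (ger0_norm (ltW s0)).
apply: (@le_trans _ _ (Num.sqrt u * (`|a| + `|b| * (2 * (Num.sqrt u + (Num.sqrt u)^-1))))).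
  apply: ler_wpM2l; first exact: ltW.
  apply: le_trans (ler_normD _ _) _; rewrite lerD2l normrM ler_wpM2l//.
  exact: ln_le_sqrt.
have -> : Num.sqrt u * (`|a| + `|b| * (2 * (Num.sqrt u + (Num.sqrt u)^-1))) =
   Num.sqrt u * `|a| + 2 * `|b| * (1 + Num.sqrt u ^+ 2) by field; rewrite gt_eqF.
rewrite (sqr_sqrtr (ltW u0)) [leRHS]mulrDl lerD2r mulrC ler_wpM2l//.
by have := sqr_ge0 (Num.sqrt u - 1); rewrite sqrrB (sqr_sqrtr (ltW u0)); lra.
Qed.

Lemma measurable_omega a b : measurable_fun setT (omega a b).
Proof. by rewrite /omega; mea. Qed.

Lemma schur_W a b : schur hl wt (kW a b) (2 * (`|a| + 2 * `|b| + 1) * pi).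
Proof.
have C0 : 0 < `|a| + 2 * `|b| + 1 by rewrite ltr_wpDl// addr_ge0// mulr_ge0.
apply: schur_hilbert; first by rewrite mulr_gt0.
  by rewrite /kW /omega; mea.
move=> x t x0 t0; have u0 : 0 < x / t by rewrite divr_gt0.
rewrite /kW normrM (ger0_norm (x := t^-1)) ?invr_ge0 ?(ltW t0)//.
apply: le_trans (ler_wpM2r _ (omega_bound a b u0)) _; first by rewrite invr_ge0 ltW.
apply: (@le_trans _ _ ((`|a| + 2 * `|b| + 1) * (1 + x / t) / (1 + (x / t) ^+ 2) / t)).
  do 2 (apply: ler_wpM2r; first by rewrite invr_ge0 ?addr_ge0 ?sqr_ge0// ltW).
  by apply: ler_wpM2r; [rewrite addr_ge0// ltW|rewrite lerDl].
have -> : (`|a| + 2 * `|b| + 1) * (1 + x / t) / (1 + (x / t) ^+ 2) / t =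
  (`|a| + 2 * `|b| + 1) * ((x + t) / (x ^+ 2 + t ^+ 2)).
  by field; rewrite !gt_eqF ?addr_gt0 ?exprn_gt0.
rewrite [leRHS](_ : _ = (`|a| + 2 * `|b| + 1) * (2 / (x + t))); last by ring.
apply: ler_wpM2l; first exact: ltW.
have h := sq_gt0 x0 t0.
rewrite ler_pdivrMr// mulrAC ler_pdivlMr ?addr_gt0//.
by have := sqr_ge0 (x - t); nra.
Qed.

(** On each row $e^{-xt}\le1/(1+xt)$, which is a dilate of Hilbert's kernel. *)
Lemma schur_L : schur hl wt kL pi.
Proof.
have mL : measurable_fun setT (fun p : measurableTypeR R * measurableTypeR R => kL p.1 p.2).
  by rewrite /kL; mea.
have LE x t : kL x t = kL t x by rewrite /kL mulrC.
have row x : 0 < x -> (\int[hl]_t (`|kL x t| * wt t)%:E <= (pi * wt x)%:E)%E.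
  move=> x0; have xi : 0 < x^-1 by rewrite invr_gt0.
  apply: (@hl_row _ _ _ (fun t => x^-1 * ((Num.sqrt t)^-1 / (x^-1 + t)))
    x _ _ (has_int_scale x^-1 (int_sqrtV xi))).
  - exact: measurable_row.
  - move=> t t0; rewrite wtE// /kL ger0_norm ?expR_ge0//.
    rewrite mulrA mulrAC ler_wpM2r ?invr_ge0 ?sqrtr_ge0//.
    rewrite -invfM mulrDr mulfV ?gt_eqF// expRN lef_pV2 ?posrE ?expR_gt0 ?addr_gt0 ?mulr_gt0//.
    exact: expR_ge1Dx.
  - have sx : 0 < Num.sqrt x by rewrite sqrtr_gt0.
    rewrite wtE// sqrtrV ?(ltW x0)// invrK [X in pi * X](sqrt_mulV x0).
    by rewrite le_eqVlt; apply/orP; left; apply/eqP; field; rewrite !gt_eqF.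
split => //; first exact: pi_gt0.
- exact: ae_hlW.
- apply: ae_hlW => t t0; under eq_integral do rewrite LE.
  exact: row.
Qed.

End HalfLineKernels.

(** * Identities between homogeneous kernels *)

(* Replaces a positive variable by the square of its root. *)
Ltac sqroot v v0 :=
  let s := fresh "r" in let s0 := fresh "r_gt0" in let e := fresh "e" in
  have s0 : 0 < Num.sqrt v; [by rewrite sqrtr_gt0 |
  move: s0 (sqr_sqrtr (ltW v0)); generalize (Num.sqrt v) => s s0 e; rewrite -?e {e}].

(* Turns a nonzero constant into a variable, so that [field] does not reduce it. *)
Ltac genpi h p p0 := lazymatch type of h with
  | is_true (?q != _) => move: (h); generalize q => p p0 end.

Section HalfLineOperators.
Context {R : realType}.
Implicit Types (a b x t v z : R).
Local Notation H := (L2space (@hl R)).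

Definition opK (K : R -> R -> R) M (s : schur hl wt K M) : op hl :=
  @kop _ (measurableTypeR R) R hl wt measurable_wt (@wt_gt0 R) K M s.

Definition opS := opK (@schur_S R).
Definition opL := opK (@schur_L R).
Definition opC1 := opK (@schur_C1 R).
Definition opC2 := opK (@schur_C2 R).
Definition opP := opK (@schur_P R).
Definition opM := opK (@schur_M R).
Definition opW a b := opK (@schur_W R a b).

Lemma kernel_opK K M (s : schur hl wt K M) : kernel_of (opK s) K.
Proof. exact: kernel_kop. Qed.

Lemma kernel_opcomp K1 M1 K2 M2 (s1 : schur hl wt K1 M1) (s2 : schur hl wt K2 M2)
    (K3 : R -> R -> R) :
  (forall x, measurable_fun setT (K3 x)) ->
  (forall x t, 0 < x -> 0 < t -> t != x -> has_int (fun v => K1 x v * K2 v t) (K3 x t)) ->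
  kernel_of (opK s1 ∘ opK s2) K3.
Proof.
move=> mK3 h; have hc := @kernel_comp _ (measurableTypeR R) R hl wt measurable_wt (@wt_gt0 R) _ _ _ _ s1 s2.
apply: (@kernel_ext _ (measurableTypeR R) R hl _ _ _ hc).
apply: ae_hlW => x x0; split; last exact: mK3.
by apply: (@ae_hl_neq _ x) => t t0 tx; exact: has_intE (h _ _ x0 t0 tx).
Qed.

Lemma opK_eq (A B : op hl) (K L : R -> R -> R) : kernel_of A K -> kernel_of B L ->
  (forall x t, 0 < x -> 0 < t -> K x t = L x t) -> A ≡ B.
Proof.
move=> hA hB KL; apply: (kernel_eq hA hB).
by apply: ae_hlW => x x0; apply: ae_hlW => t t0; exact: KL.
Qed.

Lemma opadj_K K M (s : schur hl wt K M) : kernel_of (opadj (opK s)) (fun x t => K t x).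
Proof. exact: (kernel_opK (schur_tr s)). Qed.

Lemma opadj_L : opadj opL ≡ opL.
Proof.
by apply: (opK_eq (opadj_K _) (kernel_opK _)) => x t x0 t0; rewrite /kL mulrC.
Qed.

Lemma opadj_S : opadj opS ≡ opS.
Proof.
by apply: (opK_eq (opadj_K _) (kernel_opK _)) => x t x0 t0; rewrite /kS addrC.
Qed.

Lemma opadj_P : opadj opP ≡ opP.
Proof.
apply: (opK_eq (opadj_K _) (kernel_opK _)) => x t x0 t0; rewrite /kP addrC.
by rewrite (mulrC (Num.sqrt t)).
Qed.

Lemma opadj_C1 : opadj opC1 ≡ opC2.
Proof.
by apply: (opK_eq (opadj_K _) (kernel_opK _)) => x t x0 t0; rewrite /kC1 /kC2 addrC.
Qed.

Lemma opadj_C2 : opadj opC2 ≡ opC1.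
Proof. by rewrite -opadj_C1. Qed.

(** $\int_0^\infty e^{-(x+t)v}dv=1/(x+t)$. *)
Lemma comp_LL : opL ∘ opL ≡ opS.
Proof.
apply: (opK_eq (@kernel_opcomp _ _ _ _ _ _ kS _ _) (kernel_opK _)) => //.
  by move=> x; rewrite /kS; mea.
move=> x t x0 t0 _; have xt : 0 < x + t by rewrite addr_gt0.
apply: has_int_eq (int_exp xt) _ _ _ => //.
  by rewrite /kL; mea.
by move=> v v0; rewrite /kL -expRD; congr expR; ring.
Qed.

Let dsq_neq0 x t : 0 < x -> 0 < t -> t != x -> t ^+ 2 - x ^+ 2 != 0.
Proof. by move=> x0 t0 tx; rewrite subr_eq0 eqrXn2// ltW. Qed.

Let pf2 x t v : 0 < x -> 0 < t -> 0 < v -> t != x ->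
  ((x ^+ 2 + v ^+ 2) * (v ^+ 2 + t ^+ 2))^-1 =
  ((x ^+ 2 + v ^+ 2)^-1 - (t ^+ 2 + v ^+ 2)^-1) / (t ^+ 2 - x ^+ 2).
Proof.
move=> x0 t0 v0 tx; have d := dsq_neq0 x0 t0 tx.
by field; rewrite d !gt_eqF ?addr_gt0 ?exprn_gt0.
Qed.

(** Partial fractions in $v^2$; they require $t\ne x$, which excludes a null
    set only. The same holds for the other compositions below. *)
Lemma comp_C1C2 : opC1 ∘ opC2 ≡ (pi / 2) ⊙ opS.
Proof.
apply: (opK_eq (@kernel_opcomp _ _ _ _ _ _ (fun x t => pi / 2 * kS x t) _ _)
  (kernel_scale _ (kernel_opK _))) => //.
  by move=> x; rewrite /kS; mea.
move=> x t x0 t0 tx; have d := dsq_neq0 x0 t0 tx.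
apply: has_int_eq (has_int_add
  (has_int_scale (x * t / (t ^+ 2 - x ^+ 2)) (int_atan x0))
  (has_int_scale (- (x * t / (t ^+ 2 - x ^+ 2))) (int_atan t0))) _ _ _.
- by rewrite /kC1 /kC2; mea.
- move=> v v0; rewrite /kC1 /kC2.
  have -> : x / (x ^+ 2 + v ^+ 2) * (t / (v ^+ 2 + t ^+ 2)) =
     x * t * ((x ^+ 2 + v ^+ 2) * (v ^+ 2 + t ^+ 2))^-1 by rewrite invfM; ring.
  by rewrite pf2//; ring.
- by rewrite /kS; field; rewrite d !gt_eqF ?addr_gt0.
Qed.

Lemma comp_C2C1 : opC2 ∘ opC1 ≡ (pi / 2) ⊙ opS.
Proof.
apply: (opK_eq (@kernel_opcomp _ _ _ _ _ _ (fun x t => pi / 2 * kS x t) _ _)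
  (kernel_scale _ (kernel_opK _))) => //.
  by move=> x; rewrite /kS; mea.
move=> x t x0 t0 tx; have d := dsq_neq0 x0 t0 tx.
apply: has_int_eq (has_int_add
  (has_int_scale (- (x ^+ 2 / (t ^+ 2 - x ^+ 2))) (int_atan x0))
  (has_int_scale (t ^+ 2 / (t ^+ 2 - x ^+ 2)) (int_atan t0))) _ _ _.
- by rewrite /kC1 /kC2; mea.
- move=> v v0; rewrite /kC1 /kC2.
  by field; rewrite d !gt_eqF ?addr_gt0 ?exprn_gt0.
- by rewrite /kS; field; rewrite d !gt_eqF ?addr_gt0.
Qed.

(** All three kernels are multiples of $\ln x-\ln t$, by $x/(x^2-t^2)$,
    $t/(x^2-t^2)$ and $1/(x-t)$. *)
Lemma comp_SS : (opC1 ∘ opC1) ⊕ (opC2 ∘ opC2) ≡ opS ∘ opS.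
Proof.
have mln (c : R -> R) x : measurable_fun setT c ->
    measurable_fun setT (fun t => c t * ((ln x - ln t) / (x ^+ 2 - t ^+ 2))).
  by move=> mc; mea.
have h1 : kernel_of (opC1 ∘ opC1) (fun x t => x * ((ln x - ln t) / (x ^+ 2 - t ^+ 2))).
  apply: kernel_opcomp => [x|x t x0 t0 tx]; first exact: mln.
  have xt : x != t by rewrite eq_sym.
  apply: has_int_eq (has_int_scale x (int_ln2 x0 t0 xt)) _ _ _ => //.
    by rewrite /kC1; mea.
  by move=> v v0; rewrite /kC1 invfM; ring.
have h2 : kernel_of (opC2 ∘ opC2) (fun x t => t * ((ln x - ln t) / (x ^+ 2 - t ^+ 2))).
  apply: kernel_opcomp => [x|x t x0 t0 tx]; first by apply: mln; mea.
  have xt : x != t by rewrite eq_sym.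
  apply: has_int_eq (has_int_scale t (int_ln2 x0 t0 xt)) _ _ _ => //.
    by rewrite /kC2; mea.
  by move=> v v0; rewrite /kC2 invfM; ring.
have h3 : kernel_of (opS ∘ opS) (fun x t => (ln x - ln t) / (x - t)).
  apply: kernel_opcomp => [x|x t x0 t0 tx]; first by mea.
  have xt : x != t by rewrite eq_sym.
  apply: has_int_eq (int_ln x0 t0 xt) _ _ _ => //.
    by rewrite /kS; mea.
  by move=> v v0; rewrite /kS invfM.
apply: (kernel_eq (kernel_add h1 h2) h3).
apply: ae_hlW => x x0; apply: (@ae_hl_neq _ x) => t t0 tx.
have d := dsq_neq0 t0 x0 (_ : x != t); rewrite -mulrDl.
have xt : x != t by rewrite eq_sym.
have dx : x - t != 0 by rewrite subr_eq0.
have -> : x ^+ 2 - t ^+ 2 = (x - t) * (x + t) by ring.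
by field; rewrite dx gt_eqF ?addr_gt0.
Qed.

Let r2 : Num.sqrt 2 ^+ 2 = 2 :> R.
Proof. by rewrite sqr_sqrtr. Qed.
Let r0 : 0 < Num.sqrt 2 :> R.
Proof. by rewrite sqrtr_gt0. Qed.
Let piV2 : pi / Num.sqrt 2 = pi * Num.sqrt 2 / 2 :> R.
Proof. by rewrite -[X in _ = _ / X]r2; field; rewrite gt_eqF. Qed.
Let piV2' c : pi / (Num.sqrt 2 * c) = pi * Num.sqrt 2 / 2 / c :> R.
Proof. by rewrite invfM mulrA piV2. Qed.

(** The operator $M$ with kernel $\frac{\sqrt2}\pi(x+t)/(x^2+t^2)$ is what
    appears when the square-root integrals of $SP$ are computed; together with
    [comp_MP] this expresses $S$ through $P$. *)
Lemma comp_SP : (pi^-1 ⊙ (opS ∘ opP)) ⊕ opP ≡ opM.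
Proof.
have pi0 : pi != 0 :> R by rewrite gt_eqF// pi_gt0.
pose K x t : R := (- (2 * (Num.sqrt x * Num.sqrt t)) + Num.sqrt 2 * (x + t)) / (x ^+ 2 + t ^+ 2).
have h1 : kernel_of (opS ∘ opP) K.
  apply: kernel_opcomp => [x|x t x0 t0 _]; first by rewrite /K; mea.
  have sx : 0 < Num.sqrt x by rewrite sqrtr_gt0.
  have st : 0 < Num.sqrt t by rewrite sqrtr_gt0.
  pose c := 2 / pi * Num.sqrt t / (x ^+ 2 + t ^+ 2).
  apply: has_int_eq (has_int_add (has_int_scale (- (c * x)) (int_sqrtV x0))
    (has_int_add (has_int_scale (c * x) (int_sqrt t0))
      (has_int_scale (c * t ^+ 2) (int_sqrtV2 t0)))) _ _ _.
  - by rewrite /kS /kP; mea.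
  - move=> v v0; rewrite /kS /kP /c.
    sqroot v v0.
    by genpi pi0 p p0; field; rewrite ?p0 !gt_eqF ?addr_gt0 ?exprn_gt0.
  - rewrite -mulrA !piV2' /c /K.
    sqroot x x0; sqroot t t0.
    by genpi pi0 p p0; field; rewrite ?p0 !gt_eqF ?addr_gt0 ?exprn_gt0.
apply: (opK_eq (kernel_add (kernel_scale _ h1) (kernel_opK _)) (kernel_opK _)) => x t x0 t0.
by rewrite /K /kP /kM; genpi pi0 p p0; field; rewrite ?p0 !gt_eqF ?addr_gt0 ?exprn_gt0.
Qed.

Lemma comp_MP : opM ∘ opP ≡ (2 / pi) ⊙ opS.
Proof.
have pi0 : pi != 0 :> R by rewrite gt_eqF// pi_gt0.
apply: (opK_eq (@kernel_opcomp _ _ _ _ _ _ (fun x t => 2 / pi * kS x t) _ _)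
  (kernel_scale _ (kernel_opK _))) => //.
  by move=> x; rewrite /kS; mea.
move=> x t x0 t0 tx; have d := dsq_neq0 x0 t0 tx.
have sx : 0 < Num.sqrt x by rewrite sqrtr_gt0.
have st : 0 < Num.sqrt t by rewrite sqrtr_gt0.
pose c := Num.sqrt 2 / pi * (2 / pi * Num.sqrt t) / (t ^+ 2 - x ^+ 2).
apply: has_int_eq (has_int_add
  (has_int_add (has_int_scale (c * x) (int_sqrt x0)) (has_int_scale (- (c * x ^+ 2)) (int_sqrtV2 x0)))
  (has_int_add (has_int_scale (- (c * x)) (int_sqrt t0)) (has_int_scale (c * t ^+ 2) (int_sqrtV2 t0)))) _ _ _.
- by rewrite /kM /kP; mea.
- move=> v v0; rewrite /kM /kP /c.
  sqroot v v0.
  by genpi pi0 p p0; field; rewrite ?p0 d !gt_eqF ?addr_gt0 ?exprn_gt0.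
- rewrite -!(mulrA (Num.sqrt 2)) !piV2' /c /kS.
  transitivity (Num.sqrt 2 ^+ 2 / (pi * (x + t))); last first.
    by rewrite r2; genpi pi0 p p0; field; rewrite ?p0 gt_eqF ?addr_gt0.
  move: d; sqroot x x0; sqroot t t0 => d.
  by genpi pi0 p p0; field; rewrite ?p0 ?d !gt_eqF ?addr_gt0 ?exprn_gt0.
Qed.

Let kPP x t : R := 4 / pi ^+ 2 * (Num.sqrt x * Num.sqrt t) * ((ln x - ln t) / (x ^+ 2 - t ^+ 2)).

Lemma kernel_PP : kernel_of (opP ∘ opP) kPP.
Proof.
have pi0 : pi != 0 :> R by rewrite gt_eqF// pi_gt0.
apply: kernel_opcomp => [x|x t x0 t0 tx]; first by rewrite /kPP; mea.
have xt : x != t by rewrite eq_sym.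
have d := dsq_neq0 x0 t0 tx.
apply: has_int_eq (has_int_scale (4 / pi ^+ 2 * (Num.sqrt x * Num.sqrt t)) (int_ln2 x0 t0 xt)) _ _ _ => //.
  by rewrite /kP; mea.
move=> v v0; rewrite /kP; sqroot v v0.
by genpi pi0 p p0; field; rewrite ?p0 !gt_eqF ?addr_gt0 ?exprn_gt0.
Qed.

(** The kernel of the left-hand side contains both $\ln x$ and $\ln t$ and two
    terms without logarithm; the relation between the coefficients of $W$ is
    the one that cancels the latter, and leaves a multiple of the kernel of
    $P^2$. *)
Lemma comp_C2W b : opC2 ∘ opW (b * pi / 2) b ≡ (b * pi ^+ 3 * Num.sqrt 2 / 8) ⊙ (opP ∘ opP).
Proof.
have pi0 : pi != 0 :> R by rewrite gt_eqF// pi_gt0.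
pose K x t : R := b * pi * Num.sqrt 2 / 2 * (Num.sqrt x * Num.sqrt t) * ((ln x - ln t) / (x ^+ 2 - t ^+ 2)).
have h1 : kernel_of (opC2 ∘ opW (b * pi / 2) b) K.
  apply: kernel_opcomp => [x|x t x0 t0 tx]; first by rewrite /K; mea.
  have xt : x != t by rewrite eq_sym.
  have d := dsq_neq0 t0 x0 xt.
  have sx : 0 < Num.sqrt x by rewrite sqrtr_gt0.
  have st : 0 < Num.sqrt t by rewrite sqrtr_gt0.
  pose c := Num.sqrt t / (x ^+ 2 - t ^+ 2).
  pose e := b * pi / 2 - b * ln t.
  apply: has_int_eq (has_int_add
    (has_int_add (has_int_scale (c * x ^+ 2 * e) (int_sqrtV2 x0)) (has_int_scale (c * x ^+ 2 * b) (int_lnV x0)))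
    (has_int_add (has_int_scale (- (c * t ^+ 2 * e)) (int_sqrtV2 t0))
      (has_int_scale (- (c * t ^+ 2 * b)) (int_lnV t0)))) _ _ _.
  - by rewrite /kC2 /kW /omega; mea.
  - move=> v v0; rewrite /kC2 /kW /omega /c /e.
    have sv : 0 < Num.sqrt v by rewrite sqrtr_gt0.
    have ti : 0 < t^-1 by rewrite invr_gt0.
    rewrite sqrtrM ?(ltW v0)// sqrtrV ?(ltW t0)// lnM ?posrE// lnV ?posrE//.
    move: d; sqroot v v0; sqroot x x0; sqroot t t0 => d.
    by field; rewrite ?d !gt_eqF ?addr_gt0 ?exprn_gt0.
  - rewrite -!(mulrA (Num.sqrt 2)) !piV2' piV2 /c /e /K.
    move: d; sqroot x x0; sqroot t t0 => d.
    by field; rewrite ?d ?gt_eqF.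
apply: (kernel_eq h1 (kernel_scale _ kernel_PP)).
apply: ae_hlW => x x0; apply: (@ae_hl_neq _ x) => t t0 tx.
have xt : x != t by rewrite eq_sym.
have d := dsq_neq0 t0 x0 xt.
by rewrite /K /kPP; genpi pi0 p p0; field; rewrite ?p0 ?d.
Qed.

(** As for [comp_C2W], with the integrals of $v^{1/2}$ in place of those of
    $v^{-1/2}$, hence the opposite sign. *)
Lemma comp_C1W b : opC1 ∘ opW (- (b * pi / 2)) b ≡ (- (b * pi ^+ 3 * Num.sqrt 2 / 8)) ⊙ (opP ∘ opP).
Proof.
have pi0 : pi != 0 :> R by rewrite gt_eqF// pi_gt0.
pose K x t : R := - (b * pi * Num.sqrt 2 / 2) * (Num.sqrt x * Num.sqrt t) * ((ln x - ln t) / (x ^+ 2 - t ^+ 2)).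
have h1 : kernel_of (opC1 ∘ opW (- (b * pi / 2)) b) K.
  apply: kernel_opcomp => [x|x t x0 t0 tx]; first by rewrite /K; mea.
  have xt : x != t by rewrite eq_sym.
  have d := dsq_neq0 t0 x0 xt.
  have sx : 0 < Num.sqrt x by rewrite sqrtr_gt0.
  have st : 0 < Num.sqrt t by rewrite sqrtr_gt0.
  pose c := x * Num.sqrt t / (x ^+ 2 - t ^+ 2).
  pose e := - (b * pi / 2) - b * ln t.
  apply: has_int_eq (has_int_add
    (has_int_add (has_int_scale (- (c * e)) (int_sqrt x0)) (has_int_scale (- (c * b)) (int_lns x0)))
    (has_int_add (has_int_scale (c * e) (int_sqrt t0))
      (has_int_scale (c * b) (int_lns t0)))) _ _ _.
  - by rewrite /kC1 /kW /omega; mea.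
  - move=> v v0; rewrite /kC1 /kW /omega /c /e.
    have sv : 0 < Num.sqrt v by rewrite sqrtr_gt0.
    have ti : 0 < t^-1 by rewrite invr_gt0.
    rewrite sqrtrM ?(ltW v0)// sqrtrV ?(ltW t0)// lnM ?posrE// lnV ?posrE//.
    move: d; sqroot v v0; sqroot x x0; sqroot t t0 => d.
    by field; rewrite ?d !gt_eqF ?addr_gt0 ?exprn_gt0.
  - rewrite !piV2' piV2 /c /e /K.
    move: d; sqroot x x0; sqroot t t0 => d.
    by field; rewrite ?d ?gt_eqF.
apply: (kernel_eq h1 (kernel_scale _ kernel_PP)).
apply: ae_hlW => x x0; apply: (@ae_hl_neq _ x) => t t0 tx.
have xt : x != t by rewrite eq_sym.
have d := dsq_neq0 t0 x0 xt.
by rewrite /K /kPP; genpi pi0 p p0; field; rewrite ?p0 ?d.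
Qed.

Definition LT (phi : R -> R) z : R := \int[hl]_u (expR (- (z * u)) * phi u).

Lemma measurable_LT phi : measurable_fun setT phi -> measurable_fun setT (LT phi).
Proof.
move=> mphi; apply: (@measurable_kint _ (measurableTypeR R) R hl
  (fun z u => expR (- (z * u)) * phi u)).
have m2 : measurable_fun setT (fun p : measurableTypeR R * measurableTypeR R => phi p.2).
  by apply: measurableT_comp => //; exact: measurable_snd.
by mea.
Qed.

(** If $K$ is homogeneous of degree $-1$, then substituting $v=tu$ shows that
    the kernel of $LK$ depends on $xt$ only. *)
Lemma kernel_LT K M (s : schur hl wt K M) (phi : R -> R) : measurable_fun setT phi ->
  (forall z, 0 < z -> hl.-integrable setT (EFin \o (fun u => expR (- (z * u)) * phi u))) ->
  (forall v t, 0 < v -> 0 < t -> K v t = phi (v / t) / t) ->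
  kernel_of (opL ∘ opK s) (fun x t => LT phi (x * t)).
Proof.
move=> mphi iphi Kphi.
have hc := @kernel_comp _ (measurableTypeR R) R hl wt measurable_wt (@wt_gt0 R) _ _ _ _ (@schur_L R) s.
apply: (@kernel_ext _ (measurableTypeR R) R hl _ _ _ hc).
apply: ae_hlW => x x0; split; last first.
  by apply: (@measurableT_comp _ _ _ _ _ _ _ _ _ (measurable_LT mphi)); mea.
apply: ae_hlW => t t0.
have mK : measurable_fun setT (fun v => K v t) by exact: measurable_col (schur_meas s).
have tn : t != 0 by rewrite gt_eqF.
rewrite (Rintegral_scale t0); last by rewrite /kL; mea.
rewrite /LT -RintegralZl//; last first.
  have : has_int (fun u => t^-1 * (expR (- (x * t * u)) * phi u))
      (t^-1 * LT phi (x * t)).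
    by apply: has_int_scale; split => //; apply: iphi; rewrite mulr_gt0.
  move=> /has_int_eq h; apply: has_int_integrable (h _ _ _ _ erefl).
    by rewrite /kL; apply: measurable_funM; [mea|apply: (@measurableT_comp _ _ _ _ _ _ _ _ _ mK); mea].
  move=> u u0; rewrite Kphi ?mulr_gt0// /kL (mulrC t u) mulfK//.
  have -> : x * (u * t) = x * t * u by ring.
  by ring.
apply: eq_Rintegral_hl.
- by apply: measurable_funM; [mea|rewrite /kL; apply: measurable_funM; [mea|apply: (@measurableT_comp _ _ _ _ _ _ _ _ _ mK); mea]].
- by have /integrableP[/measurable_EFinP] := iphi (x * t) (mulr_gt0 x0 t0).
move=> u u0; rewrite Kphi ?mulr_gt0// /kL (mulrC t u) mulfK//.
have -> : x * (u * t) = x * t * u by ring.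
by field.
Qed.

End HalfLineOperators.

(** * Limit theorems and damped trigonometric integrals *)

Section LimitTheorems.
Context {R : realType}.

Lemma cvg0_bound T (F : set_system T) (FF : Filter F) (f h : T -> R) :
  (\forall x \near F, `|f x| <= h x) -> h x @[x --> F] --> (0 : R) -> f x @[x --> F] --> (0 : R).
Proof.
move=> fh h0; apply/norm_cvg0P.
apply: (@squeeze_cvgr _ _ _ _ (fun=> 0) h) h0 => //; last exact: cvg_cst.
by apply: filterS fh => x -> /=; rewrite andbT.
Qed.

Lemma cvgy_exp (e : R) : 0 < e -> expR (- (e * v)) @[v --> +oo] --> (0 : R).
Proof.
move=> e0; have h : (fun v : R => e * v) @ +oo --> +oo by apply: gt0_cvgMry => //; exact: cvg_id.
exact: (cvg_comp _ _ h (@cvgr_expR R)).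
Qed.

Lemma hl_dct_ae (u : nat -> R -> R) (v g : R -> R) :
  (forall n, measurable_fun setT (u n)) -> measurable_fun setT v ->
  {ae hl, forall x : R, u n x @[n --> \oo] --> v x} ->
  (forall n (x : R), 0 < x -> `|u n x| <= g x) ->
  hl.-integrable setT (EFin \o g) ->
  hl.-integrable setT (EFin \o v) /\ \int[hl]_x u n x @[n --> \oo] --> \int[hl]_x v x.
Proof.
move=> mu_ mv uv ug ig.
have [|||||iv _ c] := @dominated_convergence _ (measurableTypeR R) R hl setT measurableT
  (fun n x => (u n x)%:E) (EFin \o v) (EFin \o g).
- by move=> n; apply/measurable_EFinP; exact: mu_.
- by apply/measurable_EFinP; exact: mv.
- apply: (@filterS _ (almost_everywhere (@hl R)) (ae_filter_ringOfSetsType _) _ _ _ uv).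
  by move=> x uvx _; apply: cvg_EFin => //; exact: nearW.
- by [].
- by apply: ae_hlW => x x0 n _ /=; rewrite lee_fin ug.
split=> //; apply: fine_cvg => /=.
by rewrite fineK//; exact: integrable_fin_num.
Qed.

Lemma hl_dct (u : nat -> R -> R) (v g : R -> R) :
  (forall n, measurable_fun setT (u n)) -> measurable_fun setT v ->
  (forall x : R, 0 < x -> u n x @[n --> \oo] --> v x) ->
  (forall n (x : R), 0 < x -> `|u n x| <= g x) ->
  hl.-integrable setT (EFin \o g) ->
  hl.-integrable setT (EFin \o v) /\ \int[hl]_x u n x @[n --> \oo] --> \int[hl]_x v x.
Proof. by move=> mu_ mv uv; apply: hl_dct_ae => //; exact: ae_hlW. Qed.

Lemma hl_fubini (F : R -> R -> R) (C : R) :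
  measurable_fun setT (fun p : measurableTypeR R * measurableTypeR R => F p.1 p.2) ->
  (\int[hl]_v \int[hl]_t `|F v t|%:E <= C%:E)%E ->
  (forall v, 0 < v -> hl.-integrable setT (EFin \o F v)) ->
  (forall t, 0 < t -> hl.-integrable setT (EFin \o F^~ t)) ->
  \int[hl]_v (\int[hl]_t F v t) = \int[hl]_t (\int[hl]_v F v t).
Proof.
move=> mF FC i1 i2.
have ih : (hl \x hl)%E.-integrable setT (EFin \o (fun p => F p.1 p.2)).
  apply/integrable12ltyP; first exact/measurable_EFinP.
  by apply: le_lt_trans FC _; rewrite ltry.
have FE := Fubini ih; rewrite /Rintegral.
transitivity (fine (\int[hl]_v \int[hl]_t (F v t)%:E)%E).
  congr fine; apply: ae_eq_integral => //.
  - by apply/measurable_EFinP; apply: (@measurable_kint _ (measurableTypeR R)).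
  - exact: measurable_fubini_F ih.
  by apply: ae_hlW => v v0 _; rewrite fineK//; apply: integrable_fin_num => //; exact: i1.
rewrite [X in fine X](FE); congr fine; apply: ae_eq_integral => //.
- exact: measurable_fubini_G ih.
- apply/measurable_EFinP; apply: (@measurable_kint _ (measurableTypeR R) _ _ (fun t v => F v t)).
  exact: (measurableT_comp mF (measurable_fun_pair measurable_snd measurable_fst)).
by apply: ae_hlW => t t0 _; rewrite fineK//; apply: integrable_fin_num => //; exact: i2.
Qed.

Lemma hl_fatou (u : nat -> R -> R) (v : R -> R) (C : R) :
  (forall n, measurable_fun setT (u n)) -> measurable_fun setT v ->
  (forall x : R, 0 < x -> u n x @[n --> \oo] --> v x) ->
  (forall n, (\int[hl]_x (u n x ^+ 2)%:E <= C%:E)%E) ->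
  (\int[hl]_x (v x ^+ 2)%:E <= C%:E)%E.
Proof.
move=> mu_ mv uv uC.
have m2 n : measurable_fun setT (fun x => (u n x ^+ 2)%:E).
  by apply/measurable_EFinP; have := mu_ n => ?; mea.
have F := @fatou _ (measurableTypeR R) R hl setT measurableT (fun n x => (u n x ^+ 2)%:E) m2.
have {F}F := F _; apply: (@le_trans _ _ (\int[hl]_x limn_einf (fun n => (u n x ^+ 2)%:E))%E).
  rewrite le_eqVlt; apply/orP; left; apply/eqP.
  apply: ae_eq_integral => //.
  - by apply/measurable_EFinP; mea.
  - have -> : (fun x : R => limn_einf (fun n => (u n x ^+ 2)%:E)) =
        (fun x => - limn_esup (fun n => - (u n x ^+ 2)%:E))%E.
      by apply/funext => x; rewrite (limn_esupN (fun n => (u n x ^+ 2)%:E)) oppeK.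
    apply: measurableT_comp => //; apply: measurable_fun_limn_esup => n.
    by apply: measurableT_comp => //; exact: m2.
  - apply: ae_hlW => x x0 _.
    have c : (u n x ^+ 2)%:E @[n --> \oo] --> (v x ^+ 2)%:E.
      apply: cvg_EFin; first exact: nearW.
      rewrite /comp /=; have := uv x x0 => h; rewrite expr2.
      by under eq_fun do rewrite expr2; exact: cvgM.
    rewrite is_cvg_limn_einfE; last by apply/cvg_ex; eexists; exact: c.
    by apply/esym/cvg_lim.
apply: le_trans (F _) _; first by move=> n x _; rewrite lee_fin sqr_ge0.
rewrite limn_einf_lim; apply: lime_le; first exact: is_cvg_einfs.
apply: nearW => n; apply: le_trans (uC n).
by apply: ereal_inf_lbound; exists n => /=.
Qed.

End LimitTheorems.

Section DampedIntegrals.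
Context {R : realType}.
Implicit Types (a e s t x : R).

(** A constant is added to the oscillating factor so that the fundamental
    theorem for nonnegative integrands applies. *)
Lemma int_exp_trig p q e a : 0 < e ->
  has_int (fun v => expR (- (e * v)) * (p * cos (a * v) + q * sin (a * v)))
    ((p * e + q * a) / (e ^+ 2 + a ^+ 2)).
Proof.
move=> e0; have d0 : 0 < e ^+ 2 + a ^+ 2 by rewrite ltr_pwDl ?sqr_ge0 ?exprn_gt0.
pose C := `|p| + `|q|.
pose G v := (p * (a * sin (a * v) - e * cos (a * v)) -
  q * (a * cos (a * v) + e * sin (a * v))) / (e ^+ 2 + a ^+ 2) - C / e.
pose F v := expR (- (e * v)) * G v.
have h : has_int (fun v => expR (- (e * v)) * (C + (p * cos (a * v) + q * sin (a * v))))
    (0 - (- ((p * e + q * a) / (e ^+ 2 + a ^+ 2) + C / e))).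
  apply: (@ge0_FTC_integrable _ _ F).
  - by mea.
  - move=> x _; apply: mulr_ge0; first exact: expR_ge0.
    have : `|p * cos (a * x) + q * sin (a * x)| <= C.
      apply: le_trans (ler_normD _ _) _; rewrite !normrM.
      by apply: lerD; rewrite ler_piMr// ?sin_max ?cos_max.
    by rewrite ler_norml => /andP[+ _]; lra.
  - by move=> x _; con.
  - move=> x _; rewrite /F /G; apply: has_derP; first by der.
    by rewrite /=; field; rewrite !gt_eqF.
  - apply: con_at_right; first by rewrite /F /G; con.
    by rewrite /F /G !mulr0 oppr0 expR0 sin0 cos0; field; rewrite !gt_eqF.
  - pose M := (`|p| * (`|a| + e) + `|q| * (`|a| + e)) / (e ^+ 2 + a ^+ 2) + C / e.
    apply: (@cvg0_bound _ _ _ _ _ (fun v => M * expR (- (e * v)))).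
      apply: nearW => v; rewrite /F /G normrM (ger0_norm (expR_ge0 _)) mulrC.
      apply: ler_wpM2r; first exact: expR_ge0.
      have ei : 0 <= C / e by rewrite divr_ge0 ?(ltW e0)// addr_ge0.
      have di : 0 <= (e ^+ 2 + a ^+ 2)^-1 by rewrite invr_ge0 ltW.
      apply: le_trans (ler_normB _ _) _; rewrite (ger0_norm ei) lerD2r.
      rewrite normrM (ger0_norm di); apply: ler_wpM2r => //.
      apply: le_trans (ler_normB _ _) _; rewrite !normrM.
      have b1 x : `|a * sin x| <= `|a| by rewrite normrM ler_piMr// sin_max.
      have b2 x : `|a * cos x| <= `|a| by rewrite normrM ler_piMr// cos_max.
      have b3 x : `|e * sin x| <= e by rewrite normrM (ger0_norm (ltW e0)) ler_piMr ?sin_max ?ltW.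
      have b4 x : `|e * cos x| <= e by rewrite normrM (ger0_norm (ltW e0)) ler_piMr ?cos_max ?ltW.
      apply: lerD; apply: ler_wpM2l => //.
        by apply: le_trans (ler_normB _ _) _; exact: lerD.
      by apply: le_trans (ler_normD _ _) _; exact: lerD.
    by rewrite -(mulr0 M); apply: cvgM; [exact: cvg_cst|exact: cvgy_exp].
apply: has_int_eq (has_int_add h (has_int_scale (- C) (int_exp e0))) _ _ _.
- by mea.
- by move=> v _; ring.
- by ring.
Qed.

Lemma int_exp_cos e a : 0 < e ->
  has_int (fun v => expR (- (e * v)) * cos (a * v)) (e / (e ^+ 2 + a ^+ 2)).
Proof.
move=> e0; apply: has_int_eq (int_exp_trig 1 0 a e0) _ _ _; first by mea.
  by move=> v _; rewrite mul1r mul0r addr0.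
by rewrite mul1r mul0r addr0.
Qed.

Lemma int_exp_sin e a : 0 < e ->
  has_int (fun v => expR (- (e * v)) * sin (a * v)) (a / (e ^+ 2 + a ^+ 2)).
Proof.
move=> e0; apply: has_int_eq (int_exp_trig 0 1 a e0) _ _ _; first by mea.
  by move=> v _; rewrite mul1r mul0r add0r.
by rewrite mul1r mul0r add0r.
Qed.

(** Half the Poisson kernel, up to its normalisation by $\pi$. *)
Definition poisson e u : R := e / (e ^+ 2 + u ^+ 2) / 2.

Lemma poisson_ge0 e u : 0 < e -> 0 <= poisson e u.
Proof. by move=> e0; rewrite !divr_ge0// ?addr_ge0 ?sqr_ge0// ltW. Qed.

Lemma int_poisson e s : 0 < e ->
  has_int (fun t => poisson e (s - t) + poisson e (s + t)) (pi / 2).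
Proof.
move=> e0; have d0 u : 0 < e ^+ 2 + u ^+ 2 by rewrite ltr_pwDl ?sqr_ge0 ?exprn_gt0.
have d1 (u : R) : 0 < 1 + u ^+ 2 by rewrite ltr_pwDl ?sqr_ge0.
have h := @ge0_FTC_integrable R (fun t => poisson e (s - t) + poisson e (s + t))
  (fun t => (atan (e^-1 * t - s / e) + atan (e^-1 * t + s / e)) / 2) 0 (pi / 2).
rewrite subr0 in h; apply: h.
- by rewrite /poisson; mea.
- by move=> t _; apply: addr_ge0; exact: poisson_ge0.
- by move=> t _; rewrite /poisson; con; rewrite gt_eqF.
- move=> t _; apply: has_derP; first by der.
  by rewrite /poisson; field; rewrite !gt_eqF// ?exprn_gt0.
- apply: con_at_right; first by con.
  by rewrite mulr0 !add0r atanN addNr mul0r.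
- have ei : 0 < e^-1 by rewrite invr_gt0.
  have lin c : (fun t : R => e^-1 * t + c) @ +oo --> +oo.
    have l : (fun t : R => e^-1 * t) @ +oo --> +oo by apply: gt0_cvgMry => //; exact: cvg_id.
    apply/cvgryPge => A; move/cvgryPge : l => /(_ (A - c)).
    by apply: filterS => t; rewrite lerBlDr.
  have c2 : (fun t : R => (atan (e^-1 * t - s / e) + atan (e^-1 * t + s / e)) / 2) @ +oo --> ((pi / 2 + pi / 2) / 2 : R).
    apply: cvgM; last exact: cvg_cst.
    have A c : (fun t : R => atan (e^-1 * t + c)) @ +oo --> (pi / 2 : R).
      have := cvg_comp _ _ (lin c) (@cvgy_atan R); by [].
    by apply: cvgD; exact: A.
  by move: c2; rewrite [(pi / 2 + _) / 2](_ : _ = pi / 2)//; field.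
Qed.

End DampedIntegrals.

(** * Transforms with an oscillating kernel *)

Section Windows.
Context {R : realType}.
Local Notation H := (L2space (@hl R)).
Implicit Types (f g : H) (N : R).

Definition win N : set R := `[N^-1, N].

Lemma measurable_win N : measurable (win N : set (measurableTypeR R)).
Proof. exact: measurable_itv. Qed.

Lemma ind_L2 N : (\1_(win N) : R -> R) \in Lfun hl 2%:E.
Proof.
have mw := measurable_win N.
have mi : measurable_fun (setT : set (measurableTypeR R)) (\1_(win N) : R -> R) by exact: measurable_indic.
apply/Lfun2P; split=> //.
rewrite [ltLHS](_ : _ = \int[hl]_x (\1_(win N) x)%:E)%E; last first.
  by apply: eq_integral => x _; rewrite indicE; case: (_ \in _); rewrite ?expr1n ?expr0n.
rewrite integral_indic// setIT.
apply: (@le_lt_trans _ _ (@lebesgue_measure R (win N))).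
  rewrite -[leLHS]/(@lebesgue_measure R (win N `&` Rplus)); apply: le_measure.
  - by rewrite inE; apply: measurableI => //; exact: measurable_Rplus.
  - by rewrite inE.
  - exact: subIsetl.
by rewrite /win lebesgue_measure_itv/=; case: ifP => _; rewrite ?ltry//.
Qed.

Lemma cut_L2 N f : (fun t => \1_(win N) t * f t) \in Lfun hl 2%:E.
Proof.
have mw := measurable_win N.
have mi : measurable_fun (setT : set (measurableTypeR R)) (\1_(win N) : R -> R) by exact: measurable_indic.
have mf := L2_measurable f.
have mif : measurable_fun (setT : set (measurableTypeR R)) (fun t => \1_(win N) t * f t).
  exact: measurable_funM.
apply/Lfun2P; split=> //; apply: le_lt_trans (L2_lty f).
apply: ge0_le_integral => //.
- by move=> x _; rewrite lee_fin sqr_ge0.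
- by apply/measurable_EFinP; exact: measurable_funX.
- by apply/measurable_EFinP; exact: measurable_funX.
move=> x _; rewrite lee_fin indicE; case: (_ \in _); rewrite ?mul1r// mul0r expr0n.
exact: sqr_ge0.
Qed.

Definition cut N f : H := toL2 (cut_L2 N f).

Lemma cutE N f x : cut N f x = \1_(win N) x * f x. Proof. by []. Qed.

Lemma cut_integrable N f : hl.-integrable setT (EFin \o cut N f).
Proof. exact: (L2_mul_integrable (toL2 (ind_L2 N)) f). Qed.

Lemma cut_cvg f : hn (f - cut N f) @[N --> +oo] --> (0 : R).
Proof.
apply/cvg_pinftyP => u uy.
pose w n x := (f x - \1_(win (u n)) x * f x) ^+ 2.
have mw n : measurable_fun (setT : set (measurableTypeR R)) (w n).
  have mi : measurable_fun (setT : set (measurableTypeR R)) (\1_(win (u n)) : R -> R).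
    exact: measurable_indic (measurable_win _).
  by apply: measurable_funX; apply: measurable_funB; [exact: L2_measurable|
     apply: measurable_funM => //; exact: L2_measurable].
have [|||||_ c] := @hl_dct R w (fun=> 0) (fun x => f x * f x).
- exact: mw.
- exact: measurable_cst.
- move=> x x0; apply: cvg_near_cst; move/cvgryPge : uy => uy.
  near=> n; rewrite /w indicE mem_set ?mul1r ?subrr ?expr0n//=.
  rewrite /win /= in_itv/=; apply/andP; split; last by near: n; exact: uy.
  have h : x^-1 <= u n by near: n; exact: uy.
  rewrite -[x]invrK lef_pV2 ?posrE ?invr_gt0//.
  by apply: lt_le_trans h; rewrite invr_gt0.
- move=> n x x0; rewrite /w -expr2 ger0_norm ?sqr_ge0// indicE.
  case: (_ \in _); rewrite ?mul1r ?subrr ?mul0r ?subr0 ?expr0n ?sqr_ge0//.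
- exact: L2_mul_integrable.
rewrite Rintegral_cst// mul0r in c.
have := continuous_cvg _ (@sqrt_continuous R 0) c.
by rewrite sqrtr0 => h; exact: h.
Unshelve. all: by end_near. Qed.

End Windows.

Section ConstantWeight.
Context {R : realType}.

Lemma schur_sym (K : R -> R -> R) (M : R) (g : R -> R -> R) (D : R -> R) :
  0 < M ->
  measurable_fun setT (fun p : measurableTypeR R * measurableTypeR R => K p.1 p.2) ->
  (forall x t, K x t = K t x) ->
  (forall x t, 0 < x -> 0 < t -> `|K x t| <= g x t) ->
  (forall x, 0 < x -> has_int (g x) (D x)) -> (forall x, 0 < x -> D x <= M) ->
  schur hl (fun=> 1) K M.
Proof.
move=> M0 mK sK Kg hg DM.
have row x : 0 < x -> (\int[hl]_t (`|K x t| * 1)%:E <= (M * 1)%:E)%E.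
  move=> x0; rewrite mulr1; apply: (@le_trans _ _ (D x)%:E); last by rewrite lee_fin DM.
  have mKx := measurable_row x mK.
  rewrite -(has_int_ereal (hg _ x0)); apply: ge0_le_integral_hl.
  - by mea.
  - exact: has_int_measurable (hg _ x0).
  by move=> t t0; rewrite mulr1 normr_ge0 Kg.
split => //; first exact: ae_hlW.
apply: ae_hlW => t t0; under eq_integral do rewrite sK.
exact: row.
Qed.

Definition kop1 (K : R -> R -> R) M (s : schur hl (fun=> 1) K M) : op hl :=
  @kop _ (measurableTypeR R) R hl (fun=> 1) (@measurable_cst _ _ _ _ _ _) (fun=> ltr01) K M s.

Lemma kernel_kop1 K M (s : schur hl (fun=> 1) K M) : kernel_of (kop1 s) K.
Proof. exact: kernel_kop. Qed.

End ConstantWeight.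

Section FourierKernel.
Context {R : realType}.
Local Notation H := (L2space (@hl R)).
Variables (k : R -> R) (sg : R).
Hypothesis mk : measurable_fun setT k.
Hypothesis k1 : forall x, `|k x| <= 1.
Hypothesis sg1 : `|sg| <= 1.
(* The Gram matrix of the damped kernel, for sg = 1 (cosine) or -1 (sine). *)
Hypothesis kk : forall e s t, 0 < e ->
  has_int (fun v => expR (- (e * v)) * (k (s * v) * k (v * t)))
    (poisson e (s - t) + sg * poisson e (s + t)).
Implicit Types (f g : H) (e : R).

Let mk2 : measurable_fun setT (fun p : measurableTypeR R * measurableTypeR R => k (p.1 * p.2)).
Proof. by apply: measurableT_comp => //; mea. Qed.

Let D e x t := expR (- (e * x)) * k (x * t) * expR (- (e * t)).
Let J e s t := expR (- (e * s)) * (poisson (2 * e) (s - t) + sg * poisson (2 * e) (s + t)) *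
   expR (- (e * t)).

Let DC e x t : D e x t = D e t x.
Proof. by rewrite /D (mulrC x t); ring. Qed.

Let pC e s t : poisson e (s - t) = poisson e (t - s).
Proof. by rewrite /poisson -(sqrrN (s - t)) opprB. Qed.

Let JC e x t : J e x t = J e t x.
Proof. by rewrite /J pC (addrC x t); ring. Qed.

Let exp1 e x : 0 < e -> 0 < x -> expR (- (e * x)) <= 1.
Proof. by move=> e0 x0; rewrite -expR0 ler_expR oppr_le0 mulr_ge0// ltW. Qed.

Let sD e : 0 < e -> schur hl (fun=> 1) (D e) e^-1.
Proof.
move=> e0; apply: (@schur_sym _ _ _ (fun x t => expR (- (e * t))) (fun=> e^-1)) => //.
- by rewrite invr_gt0.
- by rewrite /D; mea.
- move=> x t x0 t0; rewrite /D !normrM !(ger0_norm (expR_ge0 _)).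
  by rewrite ler_piMl ?expR_ge0// mulr_ile1 ?expR_ge0// exp1.
- by move=> x x0; exact: int_exp.
Qed.

Let sJ e : 0 < e -> schur hl (fun=> 1) (J e) (pi / 2).
Proof.
move=> e0; have e2 : 0 < 2 * e by rewrite mulr_gt0.
apply: (@schur_sym _ _ _ (fun s t => poisson (2 * e) (s - t) + poisson (2 * e) (s + t))
  (fun=> pi / 2)) => //.
- by rewrite divr_gt0 ?pi_gt0.
- by rewrite /J /poisson; mea.
- move=> x t x0 t0; rewrite /J !normrM !(ger0_norm (expR_ge0 _)).
  have p1 := @poisson_ge0 _ (2 * e) (x - t) e2; have p2 := @poisson_ge0 _ (2 * e) (x + t) e2.
  apply: (@le_trans _ _ `|poisson (2 * e) (x - t) + sg * poisson (2 * e) (x + t)|).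
    by rewrite mulrAC ler_piMl// mulr_ile1 ?expR_ge0// exp1.
  apply: le_trans (ler_normD _ _) _; rewrite (ger0_norm p1) lerD2l normrM (ger0_norm p2).
  by rewrite ler_piMl.
- by move=> x x0; exact: int_poisson.
Qed.

Let opD e (e0 : 0 < e) : op hl := kop1 (sD e0).

Let opD_adj e (e0 : 0 < e) : opadj (opD e0) ≡ opD e0.
Proof.
apply: (opK_eq (kernel_kop1 (schur_tr (sD e0))) (kernel_kop1 _)) => x t _ _.
by rewrite DC.
Qed.

(** The damped kernel $e^{-ex}k(xt)e^{-et}$ passes the Schur test with weight
    1, but with a bad constant; its square is a Poisson kernel, whose constant
    does not depend on $e$. *)
Let opD_sq e (e0 : 0 < e) : opD e0 ∘ opD e0 ≡ kop1 (sJ e0).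
Proof.
apply: (kernel_eq (@kernel_comp _ (measurableTypeR R) R hl (fun=> 1)
  (@measurable_cst _ _ _ _ _ _) (fun=> ltr01) _ _ _ _ (sD e0) (sD e0)) (kernel_kop1 _)).
apply: ae_hlW => x x0; apply: ae_hlW => t t0.
have e2 : 0 < 2 * e by rewrite mulr_gt0.
have h := has_int_scale (expR (- (e * x)) * expR (- (e * t))) (kk x t e2).
transitivity (expR (- (e * x)) * expR (- (e * t)) *
  (poisson (2 * e) (x - t) + sg * poisson (2 * e) (x + t))); last by rewrite /J; ring.
rewrite -(has_intE h); apply: eq_Rintegral => v _.
rewrite /D (_ : - (2 * e * v) = - (e * v) + - (e * v)); last by ring.
by rewrite expRD; ring.
Qed.

Let opD_contr e (e0 : 0 < e) f : hn (opD e0 f) ^+ 2 <= pi / 2 * hn f ^+ 2.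
Proof.
rewrite hn_sqr op_adjP ipC.
have -> : ip (op_adj (opD e0) (opD e0 f)) f = ip (kop1 (sJ e0) f) f.
  transitivity (ip (opD e0 (opD e0 f)) f); [exact: opD_adj|exact: opD_sq].
apply: le_trans (ler_norm _) _; apply: le_trans (ip_le _ _) _.
by rewrite expr2 mulrA ler_wpM2r ?hn_ge0// op_bndP.
Qed.

Let K x t := k (x * t).
Let en n : R := n.+1%:R^-1.
Let en0 n : 0 < en n. Proof. by rewrite invr_gt0. Qed.
Let en_cvg : en n @[n --> \oo] --> (0 : R). Proof. exact: cvg_harmonic. Qed.

Let damp_cvg (x : R) : expR (- (en n * x)) @[n --> \oo] --> (1 : R).
Proof.
have := continuous_cvg _ (@continuous_expR R (- (0 * x))) (cvgN (cvgM en_cvg (cvg_cst x))).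
by rewrite mul0r oppr0 expR0 => h; exact: h.
Qed.

Let mKr (f : R -> R) x : measurable_fun setT f -> measurable_fun setT (fun t => K x t * f t).
Proof.
by move=> mf; apply: measurable_funM => //; apply: measurableT_comp => //; mea.
Qed.

Let kD_cvg f x : hl.-integrable setT (EFin \o f) -> 0 < x ->
  kint hl (D (en n)) f x @[n --> \oo] --> kint hl K f x.
Proof.
move=> if_ x0; have mf := L2_measurable f.
have [|||||_ c] := @hl_dct R (fun n t => D (en n) x t * f t) (fun t => K x t * f t) (fun t => `|f t|).
- move=> n; apply: measurable_funM => //; rewrite /D; apply: measurable_funM; last by mea.
  by apply: measurable_funM; [mea|apply: measurableT_comp => //; mea].
- exact: mKr.
- move=> t t0; rewrite -[K x t]mul1r -[1 * K x t]mulr1.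
  apply: cvgM; last exact: cvg_cst.
  by rewrite /D; apply: cvgM; [apply: cvgM; [exact: damp_cvg|exact: cvg_cst]|exact: damp_cvg].
- move=> n t t0; rewrite !normrM !(ger0_norm (expR_ge0 _)) ler_piMl//.
  by rewrite mulr_ile1 ?mulr_ge0 ?expR_ge0 ?exp1// mulr_ile1 ?expR_ge0 ?exp1.
- by have := integrable_abse if_.
exact: c.
Qed.

Let kint_L1_le f x : hl.-integrable setT (EFin \o f) -> forall L : R -> R -> R,
  measurable_fun setT (L x) -> (forall t, 0 < t -> `|L x t| <= 1) ->
  `|kint hl L f x| <= \int[hl]_t `|f t|.
Proof.
move=> if_ L mL L1; have mf := L2_measurable f; have := integrable_abse if_ => iaf.
have hi : has_int (fun t => `|f t|) (\int[hl]_t `|f t|) by [].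
have il : hl.-integrable setT (EFin \o (fun t => L x t * f t)).
  apply: (@le_integrable_hl _ _ (fun t => `|f t|)) => //; first exact: measurable_funM.
  by move=> t t0; rewrite normrM ler_piMl// L1.
apply: le_trans (le_normr_Rintegral _ il) _ => //.
rewrite -lee_fin -(has_int_ereal (_ : has_int (fun t => `|L x t * f t|) _)); last first.
  by split; first exact: integrable_abse il.
rewrite -(has_int_ereal hi); apply: ge0_le_integral_hl.
- by apply: measurable_normr; exact: measurable_funM.
- exact: measurable_normr.
by move=> t t0; rewrite normr_ge0 normrM ler_piMl// L1.
Qed.

Let mkintK f : measurable_fun setT (kint hl K f).
Proof. by apply: (@measurable_kintf _ (measurableTypeR R)) => //; exact: L2_measurable. Qed.

Let hn_opD n f : (\int[hl]_x (kint hl (D (en n)) f x ^+ 2)%:E <= (pi / 2 * hn f ^+ 2)%:E)%E.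
Proof.
apply: (@le_trans _ _ (hn (opD (en0 n) f) ^+ 2)%:E); last by rewrite lee_fin; exact: opD_contr.
by rewrite hn_EFin.
Qed.

Let mkintD n f : measurable_fun setT (kint hl (D (en n)) f).
Proof. exact: L2_measurable (opD (en0 n) f). Qed.

(** The damped operators converge pointwise on integrable functions, so Fatou's
    lemma transfers their uniform bound. *)
Let contraction f : hl.-integrable setT (EFin \o f) ->
  (\int[hl]_x (kint hl K f x ^+ 2)%:E <= (pi / 2 * hn f ^+ 2)%:E)%E.
Proof.
move=> if_; apply: (@hl_fatou _ (fun n => kint hl (D (en n)) f)).
- by move=> n; exact: mkintD.
- exact: mkintK.
- by move=> x x0; exact: kD_cvg.
- by move=> n; exact: hn_opD.
Qed.

Let T_L2 f : hl.-integrable setT (EFin \o f) -> kint hl K f \in Lfun hl 2%:E.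
Proof.
move=> if_; apply/Lfun2P; split; first exact: mkintK.
by apply: le_lt_trans (contraction if_) _; rewrite ltry.
Qed.

Let T f (i : hl.-integrable setT (EFin \o f)) : H := toL2 (T_L2 i).

Let T_bound f (i : hl.-integrable setT (EFin \o f)) : hn (T i) <= Num.sqrt (pi / 2) * hn f.
Proof.
have p0 : 0 <= pi / 2 :> R by rewrite divr_ge0 ?pi_ge0.
have h : hn (T i) ^+ 2 <= (Num.sqrt (pi / 2) * hn f) ^+ 2.
  rewrite exprMn (sqr_sqrtr p0) -lee_fin; apply: le_trans (contraction i).
  by rewrite hn_EFin.
by rewrite -ler_sqr ?nnegrE ?hn_ge0 ?mulr_ge0 ?sqrtr_ge0 ?hn_ge0.
Qed.

Let T_dist f g (i : hl.-integrable setT (EFin \o f)) (j : hl.-integrable setT (EFin \o g)) :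
  hn (T i - T j) <= Num.sqrt (pi / 2) * hn (f - g).
Proof.
have ij : hl.-integrable setT (EFin \o (f - g)).
  rewrite [X in integrable _ _ X](_ : _ = ((EFin \o f) \- (EFin \o g))%E).
    exact: integrableB.
  by apply/funext => x.
have iK (h : H) x : hl.-integrable setT (EFin \o h) ->
    hl.-integrable setT (EFin \o (fun t => K x t * h t)).
  move=> ih; have := integrable_abse ih; apply: le_integrable_hl.
    by have mh := L2_measurable h; exact: mKr.
  by move=> t _; rewrite normrM ler_piMl// k1.
apply: le_trans (T_bound ij); rewrite le_eqVlt; apply/orP; left; apply/eqP/eq_hn.
apply: aeW => x; transitivity (kint hl K f x - kint hl K g x); first by [].
rewrite /kint -RintegralB//; [|exact: iK|exact: iK].
by apply: eq_Rintegral => t _; rewrite L2subE mulrBr.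
Qed.

Let T_sym f g (i : hl.-integrable setT (EFin \o f)) (j : hl.-integrable setT (EFin \o g)) :
  ip (T i) g = ip f (T j).
Proof.
have lim (u v : H) (a : hl.-integrable setT (EFin \o u)) (b : hl.-integrable setT (EFin \o v)) :
    ip (opD (en0 n) u) v @[n --> \oo] --> ip (T a) v.
  have mu_ := L2_measurable u; have mv := L2_measurable v.
  have [|||||_ c] := @hl_dct R (fun n x => kint hl (D (en n)) u x * v x)
    (fun x => kint hl K u x * v x) (fun x => (\int[hl]_t `|u t|) * `|v x|).
  - by move=> n; apply: measurable_funM => //; exact: mkintD.
  - by apply: measurable_funM => //; exact: mkintK.
  - by move=> x x0; apply: cvgM; [exact: kD_cvg|exact: cvg_cst].
  - move=> n x x0; rewrite normrM ler_wpM2r//; apply: kint_L1_le => //.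
      by rewrite /D; apply: measurable_funM; [apply: measurable_funM; [mea|apply: measurableT_comp => //; mea]|mea].
    move=> t t0; rewrite !normrM !(ger0_norm (expR_ge0 _)).
    by rewrite mulr_ile1 ?mulr_ge0 ?expR_ge0 ?exp1// mulr_ile1 ?expR_ge0 ?exp1.
  - exact: has_int_integrable (has_int_scale _ (conj (integrable_abse b) erefl)).
  exact: c.
have h1 := lim _ _ i j; have h2 := lim _ _ j i.
rewrite [RHS]ipC.
have e : (fun n => ip (opD (en0 n) f) g) = (fun n => ip (opD (en0 n) g) f).
  by apply/funext => n; rewrite op_adjP ipC; exact: opD_adj.
by rewrite e in h1; exact: (cvg_unique _ h1 h2).
Qed.

Let cutn f n := cut n.+1%:R f.
Let cutn_cvg f : hn (f - cutn f n) @[n --> \oo] --> (0 : R).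
Proof.
apply: (cvg_comp (fun n : nat => n.+1%:R : R) (fun N => hn (f - cut N f)) _ (@cut_cvg R f)).
by apply/cvgryPge => A; near=> n; apply: le_trans (_ : n%:R <= _); [near: n; exact: nbhs_infty_ger|rewrite ler_nat].
Unshelve. all: by end_near. Qed.

Let Tn f n : H := T (cut_integrable n.+1%:R f).

Let Tn_cauchy f : forall e, 0 < e -> exists N, forall m n, (N <= m)%N -> (N <= n)%N ->
  hn (Tn f m - Tn f n) <= e.
Proof.
move=> e e0; pose M : R := Num.sqrt (pi / 2).
have M0 : 0 < M by rewrite sqrtr_gt0 divr_gt0 ?pi_gt0.
have e1 : 0 < e / (2 * M) by rewrite divr_gt0 ?mulr_gt0.
move/cvgrPdist_le : (cutn_cvg f) => /(_ _ e1)[N _ hN]; exists N => m n Nm Nn.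
have := hN m Nm; have := hN n Nn; rewrite /= !sub0r !normrN !(ger0_norm (hn_ge0 _)) => h1 h2.
apply: le_trans (T_dist _ _) _; apply: (@le_trans _ _ (M * (e / (2 * M) + e / (2 * M)))).
  rewrite ler_wpM2l ?(ltW M0)//; apply: le_trans (hn_triangle _ f _) _.
  by apply: lerD => //; rewrite hnBC.
by rewrite le_eqVlt; apply/orP; left; apply/eqP; field; rewrite gt_eqF.
Qed.

(** The transform of $f$ is the limit of the transforms of its truncations,
    which form a Cauchy sequence by [T_dist]. It is symmetric because the
    damped kernels are. *)
Lemma fourier_op : {F : op hl |
  (forall f : H, hl.-integrable setT (EFin \o f) ->
     F f = kint hl (fun x t => k (x * t)) f %[ae hl]) /\ opadj F ≡ F}.
Proof.
pose M : R := Num.sqrt (pi / 2).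
have l f : {l : H | hn (Tn f n - l) @[n --> \oo] --> (0 : R)}.
  by apply/cid/L2_complete; exact: Tn_cauchy.
pose F f := sval (l f).
have FP f : hn (Tn f n - F f) @[n --> \oo] --> (0 : R) by rewrite /F; case: (l f).
have bnd f : hn (F f) <= M * hn f.
  have h n : hn (F f) <= hn (Tn f n - F f) + M * (hn f + hn (f - cutn f n)).
    have e : hn (F f) = hn (Tn f n - (Tn f n - F f)) by rewrite opprB addrC subrK.
    rewrite [leLHS]e.
    apply: le_trans (hnB _ _) _; rewrite addrC lerD2l; apply: le_trans (T_bound _) _.
    rewrite ler_wpM2l ?sqrtr_ge0//.
    have e' : hn (cutn f n) = hn (f - (f - cutn f n)) by rewrite opprB addrC subrK.
    by rewrite [leLHS]e'; exact: hnB.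
  have c : hn (Tn f n - F f) + M * (hn f + hn (f - cutn f n)) @[n --> \oo] --> 0 + M * (hn f + 0).
    by apply: cvgD => //; apply: cvgM; [exact: cvg_cst|apply: cvgD; [exact: cvg_cst|exact: cutn_cvg]].
  rewrite add0r addr0 in c.
  apply: (ler_cvg_to (cvg_cst (hn (F f))) c).
  by apply: nearW => n.
have ipc (u v : nat -> H) (a b : H) : hn (u n - a) @[n --> \oo] --> (0 : R) ->
    hn (b - v n) @[n --> \oo] --> (0 : R) -> ip (u n) (v n) @[n --> \oo] --> ip a b.
  move=> ua vb; apply/subr_cvg0.
  apply: (@cvg0_bound _ _ _ _ _ (fun n => hn (u n - a) * (hn b + hn (b - v n)) + hn a * hn (b - v n))).
    apply: nearW => n.
    have -> : ip (u n) (v n) - ip a b = ip (u n - a) (v n) - ip a (b - v n).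
      by rewrite ipBl ipBr; ring.
    apply: le_trans (ler_normB _ _) _; apply: lerD; last exact: ip_le.
    apply: le_trans (ip_le _ _) _; rewrite ler_wpM2l ?hn_ge0//.
    have -> : hn (v n) = hn (b - (b - v n)) by rewrite opprB addrC subrK.
    exact: hnB.
  have c : hn (u n - a) * (hn b + hn (b - v n)) + hn a * hn (b - v n) @[n --> \oo]
      --> 0 * (hn b + 0) + hn a * 0.
    by apply: cvgD; apply: cvgM => //; [apply: cvgD => //; exact: cvg_cst|exact: cvg_cst].
  by rewrite mul0r mulr0 addr0 in c.
have sym f g : ip (F f) g = ip f (F g).
  have h1 := ipc _ _ _ _ (FP f) (cutn_cvg g).
  have h2 := ipc _ _ _ _ (FP g) (cutn_cvg f).
  rewrite [RHS]ipC.
  have e : (fun n => ip (Tn f n) (cutn g n)) = (fun n => ip (Tn g n) (cutn f n)).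
    by apply/funext => n; rewrite (T_sym _ (cut_integrable n.+1%:R g)) ipC.
  by rewrite e in h1; exact: (cvg_unique _ h1 h2).
exists (Op (sqrtr_ge0 (pi / 2)) sym bnd); split; last by [].
move=> f i /=.
have z : hn (T i - F f) = 0.
  apply/eqP; rewrite eq_le hn_ge0 andbT.
  have c : M * hn (f - cutn f n) + hn (Tn f n - F f) @[n --> \oo] --> M * 0 + 0.
    by apply: cvgD => //; apply: cvgM; [exact: cvg_cst|exact: cutn_cvg].
  rewrite mulr0 addr0 in c; apply: (ler_cvg_to (cvg_cst (hn (T i - F f))) c).
  apply: nearW => n; apply: le_trans (hn_triangle _ (Tn f n) _) _.
  by rewrite lerD2r; exact: T_dist.
have := hn_eq0 z; apply: filterS => x h _; have := h I; rewrite L2subE => /eqP.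
by rewrite subr_eq0 eq_sym => /eqP.
Qed.

End FourierKernel.

(** * Cosine and sine transforms against the Laplace transform *)

Section FourierOperators.
Context {R : realType}.
Local Notation H := (L2space (@hl R)).
Implicit Types (f g : H) (e x t s : R).

(** Integrable functions are dense, truncations being integrable. *)
Lemma op_dense (A B : op hl) :
  (forall f, hl.-integrable setT (EFin \o f) -> A f = B f %[ae hl]) -> A ≡ B.
Proof.
move=> AB f g.
have c : (op_bnd A + op_bnd B) * hn (f - cut N f) * hn g @[N --> +oo] --> (op_bnd A + op_bnd B) * 0 * hn g.
  by apply: cvgM; [apply: cvgM; [exact: cvg_cst|exact: cut_cvg]|exact: cvg_cst].
apply/eqP; rewrite -subr_eq0 -normr_eq0 eq_le normr_ge0 andbT.
rewrite mulr0 mul0r in c; apply: (ler_cvg_to (cvg_cst `|ip (A f) g - ip (B f) g|) c).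
apply: nearW => N.
have e : ip (A (cut N f)) g = ip (B (cut N f)) g.
  by apply: eq_ip; [exact: AB (cut_integrable N f)|exact: aeW].
have -> : ip (A f) g - ip (B f) g = ip (A (f - cut N f)) g - ip (B (f - cut N f)) g.
  by rewrite !ip_opB e; ring.
apply: le_trans (ler_normB _ _) _; rewrite mulrDl mulrDl; apply: lerD.
  by apply: le_trans (ip_le _ _) _; rewrite ler_wpM2r ?hn_ge0// op_bndP.
by apply: le_trans (ip_le _ _) _; rewrite ler_wpM2r ?hn_ge0// op_bndP.
Qed.

Lemma cos_damped e s t : 0 < e ->
  has_int (fun v => expR (- (e * v)) * (cos (s * v) * cos (v * t)))
    (poisson e (s - t) + 1 * poisson e (s + t)).
Proof.
move=> e0; apply: has_int_eq (has_int_add (has_int_scale (1 / 2) (int_exp_cos (s - t) e0))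
  (has_int_scale (1 / 2) (int_exp_cos (s + t) e0))) _ _ _; first by mea.
  move=> v v0; rewrite (mulrC v t) mulrBl mulrDl cosB cosD.
  by field.
by rewrite /poisson; field; rewrite !gt_eqF// ltr_pwDl ?sqr_ge0 ?exprn_gt0.
Qed.

Lemma sin_damped e s t : 0 < e ->
  has_int (fun v => expR (- (e * v)) * (sin (s * v) * sin (v * t)))
    (poisson e (s - t) + (-1) * poisson e (s + t)).
Proof.
move=> e0; apply: has_int_eq (has_int_add (has_int_scale (1 / 2) (int_exp_cos (s - t) e0))
  (has_int_scale (-1 / 2) (int_exp_cos (s + t) e0))) _ _ _; first by mea.
  move=> v v0; rewrite (mulrC v t) mulrBl mulrDl cosB cosD.
  by field.
by rewrite /poisson; field; rewrite !gt_eqF// ltr_pwDl ?sqr_ge0 ?exprn_gt0.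
Qed.

Let n1 : `|1| <= 1 :> R. Proof. by rewrite normr1. Qed.
Let nm1 : `|-1| <= 1 :> R. Proof. by rewrite normrN1. Qed.

Definition opFc : op hl :=
  sval (fourier_op (@measurable_cos R) (@cos_max R) n1 cos_damped).
Definition opFs : op hl :=
  sval (fourier_op (@measurable_sin R) (@sin_max R) nm1 sin_damped).

Lemma opFcE f : hl.-integrable setT (EFin \o f) ->
  opFc f = kint hl (fun x t => cos (x * t)) f %[ae hl].
Proof. exact: (svalP (fourier_op (@measurable_cos R) (@cos_max R) n1 cos_damped)).1. Qed.
Lemma opadj_Fc : opadj opFc ≡ opFc.
Proof. exact: (svalP (fourier_op (@measurable_cos R) (@cos_max R) n1 cos_damped)).2. Qed.
Lemma opFsE f : hl.-integrable setT (EFin \o f) ->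
  opFs f = kint hl (fun x t => sin (x * t)) f %[ae hl].
Proof. exact: (svalP (fourier_op (@measurable_sin R) (@sin_max R) nm1 sin_damped)).1. Qed.
Lemma opadj_Fs : opadj opFs ≡ opFs.
Proof. exact: (svalP (fourier_op (@measurable_sin R) (@sin_max R) nm1 sin_damped)).2. Qed.

(** For integrable $f$ the double integral of $e^{-xv}k(vt)f(t)$ converges
    absolutely. *)
Let LF (k : R -> R) (K : R -> R -> R) M (sK : schur hl wt K M) (F : op hl) :
  measurable_fun setT k -> (forall x, `|k x| <= 1) ->
  (forall f, hl.-integrable setT (EFin \o f) -> F f = kint hl (fun x t => k (x * t)) f %[ae hl]) ->
  (forall x t, 0 < x -> 0 < t -> has_int (fun v => expR (- (x * v)) * k (t * v)) (K x t)) ->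
  opL ∘ F ≡ opK sK.
Proof.
move=> mk k1 FE kK; apply: op_dense => f if_.
have mf := L2_measurable f.
have iaf : hl.-integrable setT (EFin \o (fun t => `|f t|)) by exact: integrable_abse if_.
have gt0 : {ae hl, forall x : R, 0 < x} by exact: ae_hlW.
have e1 := kernel_opK (@schur_L R) (F f); have e2 := kernel_opK sK f.
suff h : {ae hl, forall x, kint hl kL (F f) x = kint hl K f x}.
  apply: (@filterS3 _ (almost_everywhere (@hl R)) (ae_filter_ringOfSetsType _) _ _ _ _ _ e1 e2 h).
  move=> x [_ h1] [_ h2] h3 _; exact: etrans h1 (etrans h3 (esym h2)).
apply: ae_hlW => x x0; have mkL : measurable_fun setT (fun v => kL x v : R) by rewrite /kL; mea.
have mkf : measurable_fun setT (kint hl (fun x t => k (x * t)) f).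
  apply: (@measurable_kintf _ (measurableTypeR R)) => //.
  by apply: measurableT_comp => //; mea.
have mkr (v : R) : measurable_fun setT (fun t : R => k (v * t)) by apply: measurableT_comp => //; mea.
have mkc (t : R) : measurable_fun setT (fun v : R => k (v * t)) by apply: measurableT_comp => //; mea.
have ikf (v : R) : hl.-integrable setT (EFin \o (fun t : R => k (v * t) * f t)).
  apply: (@le_integrable_hl _ _ (fun t : R => `|f t|)) => //; first exact: measurable_funM.
  by move=> t t0; rewrite normrM ler_piMl// k1.
transitivity (\int[hl]_v (\int[hl]_t (kL x v * (k (v * t) * f t)))).
  rewrite /kint /Rintegral; congr fine; apply: ae_eq_integral => //.
  - by apply/measurable_EFinP; apply: measurable_funM => //; exact: L2_measurable.
  - apply/measurable_EFinP; apply: (@measurable_kint _ (measurableTypeR R) _ _ (fun v t => kL x v * (k (v * t) * f t))).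
    apply: measurable_funM; first by rewrite /kL; mea.
    apply: measurable_funM; first by apply: measurableT_comp => //; mea.
    by apply: measurableT_comp => //; exact: measurable_snd.
  apply: (@filterS _ (almost_everywhere (@hl R)) (ae_filter_ringOfSetsType _) _ _ _ (FE f if_)).
  move=> v h _; congr EFin; rewrite [F f v]h// /kint.
  by rewrite -RintegralZl.
transitivity (\int[hl]_t (\int[hl]_v (kL x v * (k (v * t) * f t)))).
  apply: (@hl_fubini _ _ (x^-1 * \int[hl]_t `|f t|)).
  - apply: measurable_funM; first by rewrite /kL; mea.
    apply: measurable_funM; first by apply: measurableT_comp => //; mea.
    by apply: measurableT_comp => //; exact: measurable_snd.
  - have hb := has_int_scale (\int[hl]_t `|f t|) (int_exp x0).
    rewrite mulrC -(has_int_ereal hb).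
    apply: ge0_le_integral => //.
    + by move=> v _; exact: integral_ge0.
    + apply: (@measurable_fun_fubini_tonelli_F _ _ (measurableTypeR R) (measurableTypeR R) R hl
        (fun p => (`|kL x p.1 * (k (p.1 * p.2) * f p.2)|)%:E)) => //.
      apply/measurable_EFinP; apply: measurable_normr; apply: measurable_funM; first by rewrite /kL; mea.
      apply: measurable_funM; first by apply: measurableT_comp => //; mea.
      by apply: measurableT_comp => //; exact: measurable_snd.
    + by apply/measurable_EFinP; mea.
    + move=> v _; rewrite mulrC.
      have ha := has_int_scale (expR (- (x * v))) (conj iaf erefl : has_int (fun t => `|f t|) _).
      rewrite -(has_int_ereal ha); apply: ge0_le_integral_hl.
      * by apply: measurable_normr; apply: measurable_funM => //; exact: measurable_funM.
      * by apply: measurable_funM => //; exact: measurable_normr.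
      * move=> t t0; rewrite normr_ge0 /= /kL normrM (ger0_norm (expR_ge0 _)) ler_wpM2l ?expR_ge0//.
        by rewrite normrM ler_piMl.
  - move=> v v0; have := has_int_scale (kL x v) (conj (ikf v) erefl : has_int _ _).
    exact: has_int_integrable.
  - move=> t t0; have := has_int_scale (f t) (kK x t x0 t0).
    move=> /has_int_integrable; apply: eq_integrable => // v _ /=.
    by congr EFin; rewrite /kL (mulrC v t); ring.
apply: eq_Rintegral_hl.
- apply: (@measurable_kint _ (measurableTypeR R) _ _ (fun t v => kL x v * (k (v * t) * f t))).
  apply: measurable_funM; first by rewrite /kL; mea.
  apply: measurable_funM; first by apply: measurableT_comp => //; mea.
  by apply: measurableT_comp => //; exact: measurable_fst.
- by apply: measurable_funM => //; exact: measurable_row x (schur_meas sK).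
move=> t t0; rewrite mulrC -(has_intE (has_int_scale (f t) (kK x t x0 t0))).
by apply: eq_Rintegral => v _; rewrite /kL (mulrC v t); ring.
Qed.

Lemma comp_LFc : opL ∘ opFc ≡ @opC1 R.
Proof.
apply: (LF _ (@measurable_cos R) (@cos_max R) opFcE) => x t x0 t0; exact: int_exp_cos.
Qed.

Lemma comp_LFs : opL ∘ opFs ≡ @opC2 R.
Proof.
apply: (LF _ (@measurable_sin R) (@sin_max R) opFsE) => x t x0 t0; exact: int_exp_sin.
Qed.

Lemma comp_FcL : opFc ∘ opL ≡ @opC2 R.
Proof. by rewrite -opadj_C1 -comp_LFc opadj_comp opadj_Fc opadj_L. Qed.

Lemma comp_FsL : opFs ∘ opL ≡ @opC1 R.
Proof. by rewrite -opadj_C2 -comp_LFs opadj_comp opadj_Fs opadj_L. Qed.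

End FourierOperators.

(** * Injectivity of the Laplace transform *)

Section LaplaceInjective.
Context {R : realType}.
Local Notation H := (L2space (@hl R)).
Implicit Types (f g : H) (a s t x : R).

Lemma exp_L2 x : 0 < x -> (fun t => expR (- (x * t))) \in Lfun (@hl R) 2%:E.
Proof.
move=> x0; apply/Lfun2P; split; first by mea.
have h : has_int (fun t => expR (- (x * t)) ^+ 2) (2 * x)^-1.
  apply: has_int_eq (int_exp (_ : 0 < 2 * x)) _ _ _ => //; first by rewrite mulr_gt0.
    by mea.
  by move=> t _; rewrite expr2 -expRD; congr expR; ring.
by rewrite (has_int_ereal h) ltry.
Qed.

Lemma exp_integrable f x : 0 < x -> hl.-integrable setT (EFin \o (fun t => expR (- (x * t)) * f t)).
Proof. by move=> x0; exact: (L2_mul_integrable (toL2 (exp_L2 x0)) f). Qed.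

Lemma bernoulli_le (x : R) m : 0 <= x <= 1 -> 1 - m%:R * x <= (1 - x) ^+ m.
Proof.
move=> /andP[x0 x1]; elim: m => [|m IH]; first by rewrite mul0r subr0 expr0.
rewrite exprS; have h : 0 <= 1 - x by rewrite subr_ge0.
apply: le_trans (ler_wpM2l h IH); rewrite -natr1.
have : 0 <= m%:R * x * x by rewrite !mulr_ge0. by nra.
Qed.

Lemma pow_exp_le (x : R) m : 0 < x <= 1 -> (0 < m)%N -> (1 - x) ^+ m <= (m%:R * x)^-1.
Proof.
move=> /andP[x0 x1] m0; have h : 0 <= 1 - x by rewrite subr_ge0.
have mx : 0 < m%:R * x by rewrite mulr_gt0// ltr0n.
apply: (@le_trans _ _ (expR (- x) ^+ m)).
  by apply: lerXn2r; rewrite ?nnegrE ?expR_ge0//; exact: expR_ge1Dx.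
rewrite -expRM_natl mulrN expRN lef_pV2 ?posrE ?expR_gt0//.
by apply: le_trans (expR_ge1Dx _); rewrite lerDr.
Qed.

(** The polynomials $(1-u^n)^{2^n}$ separate the points below and above one
    half. With $u=e^{-ct}$ they turn the vanishing of a Laplace transform into
    that of the integrals over half-lines. *)
Lemma step_cvg (r : R) : 0 < r -> r < 1 -> r != 2^-1 ->
  (1 - r ^+ n) ^+ (2 ^ n) @[n --> \oo] --> ((r < 2^-1)%R%:R : R).
Proof.
move=> r0 r1 rn; have rx n : 0 < r ^+ n <= 1 by rewrite exprn_gt0//= exprn_ile1// ltW.
have e n : (2 ^ n)%:R * r ^+ n = (2 * r) ^+ n :> R by rewrite natrX exprMn.
have rr := rx _.
have up n : (1 - r ^+ n) ^+ (2 ^ n) <= 1.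
  have /andP[a b] := rx n; apply: exprn_ile1; first by rewrite subr_ge0.
  by rewrite gerBl ltW.
case: (ltP r 2^-1) => [lt|ge].
- apply: (@squeeze_cvgr _ _ _ _ (fun n => 1 - (2 * r) ^+ n) (fun=> 1)).
  + apply: nearW => n; rewrite up andbT -e; apply: bernoulli_le.
    by have /andP[/ltW -> ->] := rx n.
  + rewrite -[X in _ --> X]subr0; apply: cvgB; first exact: cvg_cst.
    by apply: cvg_expr; rewrite ger0_norm ?mulr_ge0 ?ltW//; lra.
  + exact: cvg_cst.
- have gt : 2^-1 < r by rewrite lt_neqAle eq_sym rn.
  apply: (@squeeze_cvgr _ _ _ _ (fun=> 0) (fun n => (2 * r)^-1 ^+ n)).
  + apply: nearW => n; have /andP[a b] := rx n; apply/andP; split.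
      by apply: exprn_ge0; rewrite subr_ge0.
    by rewrite exprVn -e; apply: pow_exp_le; rewrite ?expn_gt0.
  + exact: cvg_cst.
  + apply: cvg_expr; rewrite ger0_norm ?invr_ge0 ?mulr_ge0 ?ltW//.
    by rewrite invf_lt1 ?mulr_gt0//; lra.
Qed.

Section vanishing.
Variable f : H.
Hypothesis Lf0 : opL f = (cst 0 : R -> R) %[ae hl].

(** The hypothesis gives the vanishing of the integral for almost every $x$
    only; points from the right and dominated convergence give it everywhere. *)
Let lap0 x : 0 < x -> \int[hl]_t (expR (- (x * t)) * f t) = 0.
Proof.
move=> x0; have mf := L2_measurable f.
have z : {ae hl, forall y : R, kint hl kL f y = 0}.
  apply: (@filterS2 _ (almost_everywhere (@hl R)) (ae_filter_ringOfSetsType _) _ _ _ _ Lf0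
    (kernel_opK (@schur_L R) f)).
  by move=> y h [_ h2]; rewrite -[kint _ _ _ _]h2 h.
have ey (n : nat) : {y : R | x < y < x + n.+1%:R^-1 /\ kint hl kL f y = 0}.
  apply/cid; have [N [mN N0 sN]] := z.
  apply: contrapT => /forallNP hn.
  have n0 : 0 < n.+1%:R^-1 :> R by rewrite invr_gt0.
  have sub : `]x, (x + n.+1%:R^-1)%R[ `<=` N.
    move=> y /=; rewrite in_itv/= => xy; apply: sN => /= hy; apply: (hn y); split => //.
  have : (hl (`]x, (x + n.+1%:R^-1)%R[ : set R) <= hl N)%E by apply: le_measure; rewrite ?inE.
  rewrite N0 -[leLHS]/(@lebesgue_measure R (`]x, (x + n.+1%:R^-1)%R[ `&` Rplus)).
  rewrite setIidl; last first.
    by move=> y /=; rewrite in_itv/= => /andP[xy _]; apply/RplusE; exact: lt_trans xy.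
  rewrite lebesgue_measure_itv/= lte_fin ltrDl n0 -EFinD lee_fin addrAC subrr add0r.
  by rewrite leNgt n0.
pose y n := sval (ey n).
have yP n : x < y n < x + n.+1%:R^-1 /\ kint hl kL f (y n) = 0 := svalP (ey n).
have yx : y n @[n --> \oo] --> x.
  apply: (@squeeze_cvgr _ _ _ _ (fun=> x) (fun n => x + n.+1%:R^-1)).
  + by apply: nearW => n; have [/andP[/ltW -> /ltW ->] _] := yP n.
  + exact: cvg_cst.
  + rewrite -[X in _ --> X]addr0; apply: cvgD; [exact: cvg_cst|exact: cvg_harmonic].
have [|||||_ c] := @hl_dct R (fun n t => expR (- (y n * t)) * f t)
  (fun t => expR (- (x * t)) * f t) (fun t => `|expR (- (x * t)) * f t|).
- by move=> n; apply: measurable_funM => //; mea.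
- by apply: measurable_funM => //; mea.
- move=> t t0; apply: cvgM; last exact: cvg_cst.
  have := continuous_cvg _ (@continuous_expR R (- (x * t))) (cvgN (cvgM yx (cvg_cst t))).
  by move=> h; exact: h.
- move=> n t t0; rewrite !normrM !(ger0_norm (expR_ge0 _)) ler_wpM2r// ler_expR lerN2.
  by rewrite ler_wpM2r ?(ltW t0)//; have [/andP[/ltW]] := yP n.
- exact: integrable_abse (exp_integrable f x0).
apply: (cvg_unique _ c) => //.
rewrite (_ : (fun n => _) = fun=> 0); first exact: cvg_cst.
by apply/funext => n; have [_] := yP n.
Qed.

Let pow0 m a s : 0 < a -> 0 < s ->
  has_int (fun t => expR (- (s * t)) * (1 - expR (- (a * t))) ^+ m * f t) 0.
Proof.
move=> a0; have mf := L2_measurable f; elim: m s => [|m IH] s s0.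
  apply: (@has_int_eq _ (fun t => expR (- (s * t)) * f t) _ 0) => //.
  - by split; [exact: exp_integrable|exact: lap0].
  - by apply: measurable_funM => //; mea.
  - by move=> t _; rewrite expr0 mulr1.
have sa : 0 < s + a by rewrite addr_gt0.
apply: has_int_eq (has_int_add (IH s s0) (has_int_scale (-1) (IH _ sa))) _ _ _.
- by apply: measurable_funM => //; mea.
- by move=> t _; rewrite mulrDl opprD expRD exprS; ring.
- by rewrite mulr0 addr0.
Qed.

Let tail0 x : 0 < x -> \int[hl]_t (expR (- (1 * t)) * f t * \1_(`]x, +oo[) t) = 0.
Proof.
move=> x0; have mf := L2_measurable f.
pose c := ln 2 / x; have c0 : 0 < c by rewrite divr_gt0// ln_gt0// ltr1n.
have mi : measurable_fun setT (\1_(`]x, +oo[) : R -> R) by exact: measurable_indic.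
have [|||||_ l] := @hl_dct_ae R (fun n t => expR (- (1 * t)) * (1 - expR (- (n.+1%:R * c * t))) ^+ (2 ^ n.+1) * f t)
  (fun t => expR (- (1 * t)) * f t * \1_(`]x, +oo[) t) (fun t => `|expR (- (1 * t)) * f t|).
- by move=> n; apply: measurable_funM => //; mea.
- by apply: measurable_funM => //; apply: measurable_funM => //; mea.
- apply: (@ae_hl_neq _ x) => t t0 tx.
  pose r := expR (- (c * t)).
  have r1 : r < 1 by rewrite -expR0 ltr_expR oppr_lt0 mulr_gt0.
  have rE : (r < 2^-1) = (x < t).
    rewrite -[2^-1]lnK ?posrE// ltr_expR lnV ?posrE// ltrN2 /c mulrAC ltr_pdivlMr//.
    by rewrite ltr_pM2l// ln_gt0// ltr1n.
  have rn : r != 2^-1.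
    apply: contraNneq tx => rh; have := congr1 (@ln R) rh; rewrite /r expRK lnV ?posrE// => /oppr_inj h.
    apply/eqP; have l0 : ln 2 != 0 :> R by rewrite gt_eqF// ln_gt0// ltr1n.
    apply: (mulfI l0); rewrite -[in RHS]h /c; field; by rewrite gt_eqF.
  have := step_cvg (expR_gt0 _) r1 rn; rewrite -cvg_shiftS /= rE => h.
  rewrite mulrAC; apply: cvgM; last exact: cvg_cst.
  apply: cvgM; first exact: cvg_cst.
  rewrite indicE (_ : (t \in _) = (x < t)); last first.
    by apply/idP/idP; rewrite inE/= in_itv/= andbT.
  rewrite [X in X @ _](_ : _ = (fun n => (1 - r ^+ n.+1) ^+ (2 ^ n.+1))) //.
  by apply/funext => n; rewrite /r -expRM_natl mulrN !mulrA.
- move=> n t t0; rewrite !normrM !(ger0_norm (expR_ge0 _)) ler_wpM2r// ler_piMr ?expR_ge0//.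
  have h : 0 <= 1 - expR (- (n.+1%:R * c * t)).
    rewrite subr_ge0 -[leRHS]expR0 ler_expR oppr_le0.
    by apply: mulr_ge0; [apply: mulr_ge0 => //; exact: ltW|exact: ltW].
  have h1 : 1 - expR (- (n.+1%:R * c * t)) <= 1 by rewrite gerBl expR_ge0.
  by rewrite ger0_norm ?exprn_ge0// exprn_ile1.
- exact: integrable_abse (exp_integrable f ltr01).
apply: (cvg_unique _ l) => //.
rewrite (_ : (fun n => _) = fun=> 0); first exact: cvg_cst.
by apply/funext => n; apply: has_intE; apply: pow0 => //; rewrite mulr_gt0.
Qed.

(** All the integrals of $e^{-t}f(t)$ over half-lines vanish by [tail0], so the
    indefinite integral is constant; Lebesgue's differentiation theorem
    concludes. *)
Lemma laplace_vanishing : f = (cst 0 : R -> R) %[ae hl].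
Proof.
have mf := L2_measurable f.
pose h t := expR (- (1 * t)) * f t.
have mh : measurable_fun setT h by apply: measurable_funM => //; mea.
have ih : (@lebesgue_measure R).-integrable Rplus (EFin \o h).
  apply/integrableP; split; first by apply/measurable_EFinP; exact: measurable_funTS.
  have /integrableP[_] := exp_integrable f ltr01.
  rewrite integral_hl//.
  by apply: measurableT_comp => //; apply/measurable_EFinP.
have ih0 : (@lebesgue_measure R).-integrable setT (EFin \o (h \_ Rplus)).
  by rewrite -restrict_EFin; exact: (@integrable_mkcond _ (measurableTypeR R) R lebesgue_measure Rplus (EFin \o h) (@measurable_Rplus R)).1 ih.
have locf := integrable_locally_restrict measurable_Rplus ih.
have F0 x : 0 < x -> \int[@lebesgue_measure R]_(t in `]-oo, x]) (h \_ Rplus) t = 0.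
  move=> x0; have mi : measurable_fun setT (\1_(`]x, +oo[) : R -> R) by exact: measurable_indic.
  have hi1 : has_int h 0 by split; [exact: exp_integrable|exact: lap0].
  have hi2 : has_int (fun t => h t * \1_(`]x, +oo[) t) 0.
    split; last exact: tail0.
    have := exp_integrable f ltr01 => /integrable_abse; apply: le_integrable_hl.
      exact: measurable_funM.
    move=> t t0; rewrite normrM ler_piMr// indicE.
    by case: (_ \in _); rewrite ?normr0// normr1.
  have := has_intE (has_int_add hi1 (has_int_scale (-1) hi2)).
  rewrite mulr0 addr0 => <-; rewrite Rintegral_mkcond /Rintegral integral_hl; last first.
    by apply/measurable_EFinP; apply: measurable_funD => //; apply: measurable_funM => //; exact: measurable_funM.
  rewrite [in RHS]integral_mkcond; congr fine; apply: eq_integral => t _.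
  rewrite /patch indicE; have [tR|tR] := boolP (t \in Rplus); last first.
    by case: ifP => //=; rewrite (negbTE tR).
  rewrite (_ : (t \in `]x, +oo[) = ~~ (t \in `]-oo, x])); last first.
    by rewrite !mem_setE !in_itv/= andbT ltNge.
  rewrite ?tR; case: ifP => _ /=; congr EFin; first by ring.
  by rewrite mulr1 mulN1r subrr.
have iy (y : R) : (@lebesgue_measure R).-integrable `]-oo, y] (EFin \o (h \_ Rplus)).
  by apply: integrableS ih0 => //; exact: measurable_itv.
have F1 := FTC1Ny iy locf.
apply/ae_hl.
apply: (@filterS _ (almost_everywhere (@lebesgue_measure R)) (ae_filter_ringOfSetsType _) _ _ _ F1).
move=> x [_ e] /RplusE x0 _.
have e0 : h x = 0.
  have -> : h x = (h \_ Rplus) x by rewrite /patch mem_set//; exact/RplusE.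
  rewrite -e derive1E (near_eq_derive (g := fun=> 0)) ?derive_cst//.
  near=> y; apply: F0; near: y; exact: lt_nbhsr.
move/eqP : e0; rewrite /h mulf_eq0 gt_eqF ?expR_gt0//= => /eqP.
by [].
Unshelve. all: by end_near. Qed.

End vanishing.

Lemma opL_inj (f : H) : opL f = (cst 0 : R -> R) %[ae hl] -> f = (cst 0 : R -> R) %[ae hl].
Proof. exact: laplace_vanishing. Qed.

Lemma opL_adj_inj (f : H) : opadj opL f = (cst 0 : R -> R) %[ae hl] -> f = (cst 0 : R -> R) %[ae hl].
Proof.
move=> h; apply: opL_inj; have h2 := (opeqP _ _).1 (@opadj_L R) f.
apply: (@filterS2 _ (almost_everywhere (@hl R)) (ae_filter_ringOfSetsType _) _ _ _ _ h h2).
by move=> x h1 h3 _; rewrite -h3// h1.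
Qed.

End LaplaceInjective.

(** * The algebra of the compositions *)

Section OperatorIdentities.
Context {R : realType}.
Local Notation H := (L2space (@hl R)).
Local Notation S := (@opS R).
Local Notation L := (@opL R).
Local Notation P := (@opP R).
Local Notation Fc := (@opFc R).
Local Notation Fs := (@opFs R).
Local Notation Id := (@opone _ _ R (@hl R)).
Implicit Types (A B C : op (@hl R)) (f g : H).

Lemma ip_add A B f g : ip ((A ⊕ B) f) g = ip (A f) g + ip (B f) g.
Proof. exact: ipDl. Qed.
Lemma ip_scale a A f g : ip ((a ⊙ A) f) g = a * ip (A f) g.
Proof. exact: ipZl. Qed.
Let opadj_add A B : opadj (A ⊕ B) ≡ opadj A ⊕ opadj B. Proof. by []. Qed.
Let opadj_scale a A : opadj (a ⊙ A) ≡ a ⊙ opadj A. Proof. by []. Qed.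
Let opadj_one : opadj Id ≡ Id. Proof. by []. Qed.
Let opcompE A B f : (A ∘ B) f = A (B f). Proof. by []. Qed.
Let oponeE f : Id f = f. Proof. by []. Qed.
Let hn_add A B f : hn ((A ⊕ B) f) <= hn (A f) + hn (B f). Proof. exact: hnD. Qed.

(* Unfolding the operations on operators makes rewriting prohibitively slow. *)
Opaque opcomp opadd opscale opone opS opL opC1 opC2 opP opM opW opFc opFs.

(** Multiplication by the Laplace transform on both sides is injective, and
    replaces oscillating kernels by positive ones. *)
Lemma cancel_L A B : L ∘ A ∘ L ≡ L ∘ B ∘ L -> A ≡ B.
Proof.
move=> h; apply: (opcancel_l (@opL_inj R)); apply: (opcancel_r (@opL_adj_inj R)).
exact: h.
Qed.

Lemma comp_FcFc : Fc ∘ Fc ≡ (pi / 2) ⊙ Id.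
Proof.
apply: cancel_L; rewrite opcompA comp_LFc -opcompA comp_FcL comp_C1C2.
by rewrite opcompZr opcompo1 opcompZl comp_LL.
Qed.

Lemma comp_FsFs : Fs ∘ Fs ≡ (pi / 2) ⊙ Id.
Proof.
apply: cancel_L; rewrite opcompA comp_LFs -opcompA comp_FsL comp_C2C1.
by rewrite opcompZr opcompo1 opcompZl comp_LL.
Qed.

(** After multiplication by $L$ on both sides the claim reads
    $C_1^2+C_2^2=S^2=LSL$. *)
Lemma comp_FcFs : (Fc ∘ Fs) ⊕ (Fs ∘ Fc) ≡ S.
Proof.
apply: cancel_L; rewrite opcompDr !opcompA comp_LFc comp_LFs opcompDl -!opcompA.
rewrite comp_FcL comp_FsL comp_SS -comp_LL.
by rewrite !opcompA.
Qed.

Definition kappa : R := Num.sqrt (2 / pi).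
Lemma kappa_gt0 : 0 < kappa.
Proof. by rewrite sqrtr_gt0 divr_gt0 ?pi_gt0. Qed.
Lemma kappa_sqr : kappa ^+ 2 = 2 / pi.
Proof. by rewrite sqr_sqrtr// divr_ge0 ?pi_ge0. Qed.
Let pi0 : pi != 0 :> R. Proof. by rewrite gt_eqF// pi_gt0. Qed.

Let pi_cancel : 2 / pi * (pi / 2) = 1 :> R.
Proof. by move: pi0; move: (@pi R) => p p0; field. Qed.

Definition Fc1 := kappa ⊙ Fc.
Definition Fs1 := kappa ⊙ Fs.
Definition Hp := Fc1 ⊕ Fs1.
Definition opA := 2 ⊙ Id ⊕ (2 / pi) ⊙ S.
Definition opB := 2^-1 ⊙ Id ⊕ (- 4^-1) ⊙ (P ∘ P).

Lemma opcompZZ a b A B : (a ⊙ A) ∘ (b ⊙ B) ≡ (a * b) ⊙ (A ∘ B).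
Proof. by rewrite opcompZl opcompZr opscaleA. Qed.

Lemma Fc1_sqr : Fc1 ∘ Fc1 ≡ Id.
Proof.
rewrite opcompZZ comp_FcFc opscaleA -expr2 kappa_sqr.
by rewrite pi_cancel opscale1.
Qed.

Lemma Fs1_sqr : Fs1 ∘ Fs1 ≡ Id.
Proof.
rewrite opcompZZ comp_FsFs opscaleA -expr2 kappa_sqr.
by rewrite pi_cancel opscale1.
Qed.

Lemma Hp_sqr : Hp ∘ Hp ≡ opA.
Proof.
move=> f g; have h := comp_FcFs f g; have h1 := Fc1_sqr f g; have h2 := Fs1_sqr f g.
have e : Hp ∘ Hp ≡ (Fc1 ∘ Fc1 ⊕ Fc1 ∘ Fs1) ⊕ (Fs1 ∘ Fc1 ⊕ Fs1 ∘ Fs1).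
  by rewrite {1}/Hp opcompDl /Hp !opcompDr.
have h3 : ip ((Fc1 ∘ Fs1) f) g = kappa * kappa * ip ((Fc ∘ Fs) f) g.
  exact: etrans (opcompZZ kappa kappa Fc Fs f g) (ip_scale _ _ _ _).
have h4 : ip ((Fs1 ∘ Fc1) f) g = kappa * kappa * ip ((Fs ∘ Fc) f) g.
  exact: etrans (opcompZZ kappa kappa Fs Fc f g) (ip_scale _ _ _ _).
have h5 := etrans (esym (ip_add (Fc ∘ Fs) (Fs ∘ Fc) f g)) h.
have h6 := etrans (e f g) (etrans (ip_add _ _ f g) (congr2 +%R (ip_add _ _ f g) (ip_add _ _ f g))).
have h7 := etrans (ip_add (2 ⊙ Id) ((2 / pi) ⊙ S) f g) (congr2 +%R (ip_scale _ _ f g) (ip_scale _ _ f g)).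
have arith (a b c d x y z w : R) : a = w -> d = w -> b = kappa * kappa * x ->
    c = kappa * kappa * y -> x + y = z -> a + b + (c + d) = 2 * w + 2 / pi * z.
  by move=> -> -> -> -> <-; rewrite -expr2 kappa_sqr; ring.
exact: etrans h6 (etrans (arith _ _ _ _ _ _ _ _ h1 h2 h3 h4 h5) (esym h7)).
Qed.

Lemma opA_adj : opadj opA ≡ opA.
Proof. by rewrite /opA opadj_add !opadj_scale opadj_one opadj_S. Qed.

(** Expanding the product, all terms but the identity cancel by
    $P^2+\frac1\pi SP^2=MP=\frac2\pi S$. *)
Lemma comp_AB : opA ∘ opB ≡ Id.
Proof.
move=> f g.
have e : opM ∘ P ≡ P ∘ P ⊕ pi^-1 ⊙ (S ∘ P ∘ P).
  rewrite -comp_SP opcompDl opcompZl => u v; rewrite !ip_add; exact: addrC.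
have h1 := etrans (esym (comp_MP f g)) (etrans (e f g) (ip_add _ _ f g)).
have h2 := ip_scale pi^-1 (S ∘ P ∘ P) f g.
have h3 := ip_scale (2 / pi) S f g.
have e2 : opA ∘ opB ≡ 2 ⊙ (2^-1 ⊙ Id ⊕ (- 4^-1) ⊙ (P ∘ P)) ⊕
    (2 / pi) ⊙ (2^-1 ⊙ S ⊕ (- 4^-1) ⊙ (S ∘ P ∘ P)).
  by rewrite /opA opcompDl !opcompZl opcomp1o /opB opcompDr !opcompZr opcompo1 opcompA.
have lin c a A b B : ip ((c ⊙ (a ⊙ A ⊕ b ⊙ B)) f) g = c * (a * ip (A f) g + b * ip (B f) g).
  by rewrite ip_scale ip_add !ip_scale.
have h4 := etrans (e2 f g) (etrans (ip_add _ _ f g) (congr2 +%R (lin _ _ _ _ _) (lin _ _ _ _ _))).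
have arith (a b c c' d d' : R) : d' = b + c' -> c' = pi^-1 * c -> d' = 2 / pi * d ->
    2 * (2^-1 * a + (- 4^-1) * b) + 2 / pi * (2^-1 * d + (- 4^-1) * c) = a.
  move=> k1 k2 k3.
  transitivity (a + 2^-1 * (2 / pi * d) - 2^-1 * (b + pi^-1 * c)).
    by move: pi0; move: (@pi R) => p p0; field.
  by rewrite -k3 k1 k2; ring.
exact: etrans h4 (arith _ _ _ _ _ _ h1 h2 h3).
Qed.

Lemma opB_adj : opadj opB ≡ opB.
Proof.
by rewrite /opB opadj_add !opadj_scale opadj_one opadj_comp opadj_P.
Qed.

Lemma comp_BA : opB ∘ opA ≡ Id.
Proof. by rewrite -opB_adj -opA_adj -opadj_comp comp_AB. Qed.

Definition opF := Hp ∘ (Hp ∘ Fc1).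
Definition opG := Hp ∘ (Hp ∘ Fs1).

Lemma opF_eq : opF ≡ (2 * kappa) ⊙ (Fc ⊕ pi^-1 ⊙ (L ∘ @opC1 R)).
Proof.
rewrite /opF opcompA Hp_sqr /opA /Fc1 opcompZr opcompDl !opcompZl opcomp1o -comp_LL -opcompA comp_LFc.
by move=> f g; rewrite !(ip_scale, ip_add); ring.
Qed.

Lemma opG_eq : opG ≡ (2 * kappa) ⊙ (Fs ⊕ pi^-1 ⊙ (L ∘ @opC2 R)).
Proof.
rewrite /opG opcompA Hp_sqr /opA /Fs1 opcompZr opcompDl !opcompZl opcomp1o -comp_LL -opcompA comp_LFs.
by move=> f g; rewrite !(ip_scale, ip_add); ring.
Qed.

(** The value $\pi^{-5/2}$ for which the logarithmic part of the kernel
    contributes exactly $-\frac14P^2$ below. *)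
Definition beta : R := (pi ^+ 2 * Num.sqrt pi)^-1.

Definition Tc := (kappa / 2) ⊙ Fc ⊕ L ∘ @opW R (- beta * pi / 2) (- beta).
Definition Ts := (kappa / 2) ⊙ Fs ⊕ L ∘ @opW R (- (beta * pi / 2)) beta.

Lemma beta_kappa : kappa * (beta * pi ^+ 3 * Num.sqrt 2 / 8) = 4^-1.
Proof.
have p0 := @pi_gt0 R; have sp : 0 < Num.sqrt pi :> R by rewrite sqrtr_gt0.
have s2 : Num.sqrt 2 ^+ 2 = 2 :> R by rewrite sqr_sqrtr.
have sp2 : Num.sqrt pi ^+ 2 = pi :> R by rewrite sqr_sqrtr// pi_ge0.
rewrite /kappa /beta sqrtrM// sqrtrV ?pi_ge0//.
transitivity (Num.sqrt 2 ^+ 2 * pi / (8 * Num.sqrt pi ^+ 2) : R).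
  move: sp pi0; move: (Num.sqrt pi) (Num.sqrt 2) => a b; move: (@pi R) => p a0 p'; by field; rewrite p' gt_eqF.
by rewrite s2 sp2; move: pi0; move: (@pi R) => p p'; field.
Qed.

Lemma comp_FcTc : Fc1 ∘ Tc ≡ opB.
Proof.
rewrite /Tc opcompDr /Fc1 opcompZZ comp_FcFc opscaleA !opcompZl opcompA comp_FcL comp_C2W opscaleA.
move=> f g; rewrite !(ip_scale, ip_add); congr (_ * _ + _ * _).
  transitivity (kappa ^+ 2 * (pi / 4)); first by field.
  by rewrite kappa_sqr; move: pi0; move: (@pi R) => p p'; field.
by rewrite !mulNr mulrN beta_kappa.
Qed.

Lemma comp_FsTs : Fs1 ∘ Ts ≡ opB.
Proof.
rewrite /Ts opcompDr /Fs1 opcompZZ comp_FsFs opscaleA !opcompZl opcompA comp_FsL comp_C1W opscaleA.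
move=> f g; rewrite !(ip_scale, ip_add); congr (_ * _ + _ * _).
  transitivity (kappa ^+ 2 * (pi / 4)); first by field.
  by rewrite kappa_sqr; move: pi0; move: (@pi R) => p p'; field.
by rewrite mulrN beta_kappa.
Qed.

Lemma opF_E : opF ≡ opA ∘ Fc1. Proof. by rewrite /opF opcompA Hp_sqr. Qed.
Lemma opG_E : opG ≡ opA ∘ Fs1. Proof. by rewrite /opG opcompA Hp_sqr. Qed.

Lemma Tc_E : Tc ≡ Fc1 ∘ opB.
Proof. by rewrite -comp_FcTc opcompA Fc1_sqr opcomp1o. Qed.
Lemma Ts_E : Ts ≡ Fs1 ∘ opB.
Proof. by rewrite -comp_FsTs opcompA Fs1_sqr opcomp1o. Qed.

Lemma Tc_opF : Tc ∘ opF ≡ Id.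
Proof. by rewrite Tc_E opF_E opcompA -(opcompA Fc1) comp_BA opcompo1 Fc1_sqr. Qed.
Lemma opF_Tc : opF ∘ Tc ≡ Id.
Proof. by rewrite Tc_E opF_E opcompA -(opcompA opA) Fc1_sqr opcompo1 comp_AB. Qed.
Lemma Ts_opG : Ts ∘ opG ≡ Id.
Proof. by rewrite Ts_E opG_E opcompA -(opcompA Fs1) comp_BA opcompo1 Fs1_sqr. Qed.
Lemma opG_Ts : opG ∘ Ts ≡ Id.
Proof. by rewrite Ts_E opG_E opcompA -(opcompA opA) Fs1_sqr opcompo1 comp_AB. Qed.

Let hn_inv A f : opadj A ≡ A -> A ∘ A ≡ Id -> hn (A f) = hn f.
Proof.
move=> adj sq; congr (Num.sqrt _); rewrite op_adjP ipC.
by rewrite [LHS](adj (A f) f) -opcompE (sq f f) oponeE.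
Qed.

Let adj_scale a A : opadj A ≡ A -> opadj (a ⊙ A) ≡ a ⊙ A.
Proof. by move=> h; rewrite opadj_scale h. Qed.

Lemma hn_Fc1 f : hn (Fc1 f) = hn f.
Proof. by apply: hn_inv; [exact/adj_scale/opadj_Fc|exact: Fc1_sqr]. Qed.
Lemma hn_Fs1 f : hn (Fs1 f) = hn f.
Proof. by apply: hn_inv; [exact/adj_scale/opadj_Fs|exact: Fs1_sqr]. Qed.

Let hn_Hp f : hn (Hp f) <= 2 * hn f.
Proof.
apply: le_trans (hn_add _ _ _) _; rewrite hn_Fc1 hn_Fs1.
by rewrite mulr_natl mulr2n.
Qed.

(** $\langle Sf,f\rangle=\|Lf\|^2\ge0$, so $\langle Af,f\rangle\ge2\|f\|^2$. *)
Let hn_A_ge f : hn f <= hn (opA f).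
Proof.
have h : 2 * hn f ^+ 2 <= ip (opA f) f.
  rewrite /opA ip_add !ip_scale oponeE hn_sqr lerDl mulr_ge0 ?divr_ge0 ?pi_ge0//.
  have := @comp_LL R f f => <-; rewrite opcompE op_adjP ipC.
  by rewrite [X in 0 <= X](@opadj_L R f (L f)) ip_ge0.
have [f0|f0] := eqVneq (hn f) 0; first by rewrite f0 hn_ge0.
have fp : 0 < hn f by rewrite lt_neqAle eq_sym f0 hn_ge0.
rewrite -(ler_pM2r fp) -expr2; apply: le_trans (le_trans h _).
  by rewrite ler_peMl ?sqr_ge0// ler1n.
by apply: le_trans (ler_norm _) _; exact: ip_le.
Qed.

Lemma hn_opF f : hn f <= hn (opF f) <= 8 * hn f.
Proof.
apply/andP; split.
  rewrite (eq_hn ((opeqP _ _).1 opF_E f)); rewrite opcompE; apply: le_trans (hn_A_ge _); by rewrite hn_Fc1.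
rewrite !opcompE; apply: le_trans (hn_Hp _) _; apply: le_trans (ler_wpM2l _ (hn_Hp _)) _ => //.
by rewrite hn_Fc1; have := hn_ge0 f; lra.
Qed.

Lemma hn_opG f : hn f <= hn (opG f) <= 8 * hn f.
Proof.
apply/andP; split.
  rewrite (eq_hn ((opeqP _ _).1 opG_E f)); rewrite opcompE; apply: le_trans (hn_A_ge _); by rewrite hn_Fs1.
rewrite !opcompE; apply: le_trans (hn_Hp _) _; apply: le_trans (ler_wpM2l _ (hn_Hp _)) _ => //.
by rewrite hn_Fs1; have := hn_ge0 f; lra.
Qed.

Transparent opcomp opadd opscale opone opS opL opC1 opC2 opP opM opW opFc opFs.

End OperatorIdentities.

(** * Differentiation of Laplace transforms *)

Section LaplaceTransform.
Context {R : realType}.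
Implicit Types (phi psi : R -> R) (x z u : R).

Lemma der_cst0 (h : R -> R) : (forall x, 0 < x -> is_derive x 1 h 0) ->
  forall a b, 0 < a -> 0 < b -> h a = h b.
Proof.
move=> dh; suff le a b : 0 < a -> a < b -> h a = h b.
  move=> a b a0 b0; case: (ltgtP a b) => [ab|ba|->//]; first exact: le.
  by apply/esym/le.
move=> a0 ab; have [||c _] := @MVT R h (fun=> 0) a b ab.
- by move=> x; rewrite in_itv/= => /andP[ax _]; apply: dh; exact: lt_trans ax.
- apply: derivable_within_continuous => x; rewrite in_itv/= => /andP[ax _].
  by have [] := dh x (lt_le_trans a0 ax).
by rewrite mul0r => /eqP; rewrite subr_eq0 eq_sym => /eqP.
Qed.

Lemma der_ge0 (h dh : R -> R) : (forall x, 0 < x -> is_derive x 1 h (dh x)) ->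
  (forall x, 0 < x -> 0 <= dh x) -> h x @[x --> 0^'+] --> (0 : R) ->
  forall x, 0 < x -> 0 <= h x.
Proof.
move=> hd d0 h0 x x0.
apply: (ler_cvg_to h0 (cvg_cst (h x))); near=> e.
have e0 : 0 < e by near: e; exact: nbhs_right_gt.
have ex : e < x by near: e; exact: nbhs_right_lt.
have [||c cI] := @MVT R h dh e x ex.
- by move=> y; rewrite in_itv/= => /andP[ey _]; apply: hd; exact: lt_trans ey.
- apply: derivable_within_continuous => y; rewrite in_itv/= => /andP[ey _].
  by have [] := hd y (lt_le_trans e0 ey).
move: cI; rewrite in_itv/= => /andP[ec _] e1; rewrite -subr_ge0 e1.
by apply: mulr_ge0; [apply: d0; exact: lt_trans ec|rewrite subr_ge0 ltW].
Unshelve. all: by end_near. Qed.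

(** Functions with a Laplace transform on the whole half-line; the class is
    stable under multiplication by the variable ([lapl_mul]), which is what
    repeated differentiation needs. *)
Definition lapl phi := measurable_fun setT phi /\
  forall z, 0 < z -> hl.-integrable setT (EFin \o (fun u => expR (- (z * u)) * phi u)).

Lemma lapl_bounded phi C : measurable_fun setT phi ->
  (forall u, 0 < u -> `|phi u| <= C) -> lapl phi.
Proof.
move=> mp pC; split=> // z z0.
apply: (@le_integrable_hl _ _ (fun u => C * expR (- (z * u)))).
- by apply: measurable_funM => //; mea.
- move=> u u0; rewrite normrM (ger0_norm (expR_ge0 _)) mulrC.
  by apply: ler_wpM2r; rewrite ?expR_ge0// pC.
- exact: has_int_integrable (has_int_scale C (int_exp z0)).
Qed.

Lemma mul_exp_le z u : 0 < z -> 0 <= u -> u * expR (- (z * u)) <= 2 / z * expR (- (z / 2 * u)).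
Proof.
move=> z0 u0; rewrite (_ : - (z * u) = - (z / 2 * u) - (z / 2 * u)); last by field.
rewrite expRD mulrA; apply: ler_wpM2r; first exact: expR_ge0.
rewrite expRN ler_pdivrMr ?expR_gt0//.
have := expR_ge1Dx (z / 2 * u) => h.
apply: le_trans (ler_wpM2l _ h); last by rewrite divr_ge0// ltW.
rewrite mulrDr mulr1 -[leLHS]add0r lerD//; first by rewrite divr_ge0// ltW.
by rewrite le_eqVlt; apply/orP; left; apply/eqP; field; rewrite gt_eqF.
Qed.

Lemma lapl_mul phi : lapl phi -> lapl (fun u => u * phi u).
Proof.
move=> [mp ip]; split; first by apply: measurable_funM => //; mea.
move=> z z0; have z2 : 0 < z / 2 by rewrite divr_gt0.
apply: (@le_integrable_hl _ _ (fun u => 2 / z * `|expR (- (z / 2 * u)) * phi u|)).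
- by apply: measurable_funM; [mea|apply: measurable_funM => //; mea].
- move=> u u0; rewrite mulrA (mulrC _ u) !normrM (ger0_norm (ltW u0)) !(ger0_norm (expR_ge0 _)) mulrA.
  by apply: ler_wpM2r => //; apply: mul_exp_le => //; exact: ltW.
- exact: has_int_integrable (has_int_scale (2 / z) (conj (integrable_abse (ip _ z2)) erefl : has_int (fun u => `|expR (- (z / 2 * u)) * phi u|) _)).
Qed.

Lemma lapl_has_int phi z : lapl phi -> 0 < z ->
  has_int (fun u => expR (- (z * u)) * phi u) (LT phi z).
Proof. by move=> [_ ip] z0; split => //; exact: ip. Qed.

Lemma LT_eq phi psi I z : lapl phi -> 0 < z -> measurable_fun setT psi ->
  (forall u, 0 < u -> psi u = phi u) -> LT phi z = I -> LT psi z = I.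
Proof.
move=> lp z0 mpsi e <-; apply: has_intE; apply: has_int_eq (lapl_has_int lp z0) _ _ _ => //.
  by apply: measurable_funM => //; mea.
by move=> u u0; rewrite e.
Qed.

Lemma LT_le phi psi z : lapl phi -> lapl psi -> 0 < z ->
  (forall u, 0 < u -> 0 <= phi u <= psi u) -> 0 <= LT phi z <= LT psi z.
Proof.
move=> lp lq z0 h; have hp := lapl_has_int lp z0; have hq := lapl_has_int lq z0.
apply/andP; split.
  rewrite -lee_fin -(has_int_ereal hp).
  rewrite (_ : 0%:E = \int[hl]_u ((fun=> 0) u)%:E :> \bar R)%E; last by rewrite integral0.
  apply: ge0_le_integral_hl => //; first exact: has_int_measurable hp.
  by move=> u u0; rewrite lexx mulr_ge0 ?expR_ge0//; have /andP[] := h u u0.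
rewrite -lee_fin -(has_int_ereal hp) -(has_int_ereal hq).
apply: ge0_le_integral_hl; [exact: has_int_measurable hp|exact: has_int_measurable hq|].
move=> u u0; have /andP[a b] := h u u0; rewrite mulr_ge0 ?expR_ge0//=.
by rewrite ler_wpM2l ?expR_ge0.
Qed.

(** Differentiation under the integral sign. The exponential is taken at $|u|$
    so that the domination holds at every real $u$. *)
Lemma der_LT phi z : lapl phi -> 0 < z -> has_der (LT phi) z (- LT (fun u => u * phi u) z).
Proof.
move=> lp z0; have [mp ip] := lp; have z2 : 0 < z / 2 by rewrite divr_gt0.
pose F x u := expR (- (x * `|u|)) * phi u.
have FE x : 0 < x -> \int[hl]_u F x u = LT phi x.
  move=> x0; apply: eq_Rintegral_hl; [by apply: measurable_funM => //; mea|by apply: measurable_funM => //; mea|].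
  by move=> u u0; rewrite /F ger0_norm// ltW.
have dF x u : is_derive x 1 (F ^~ u) (- `|u| * expR (- (x * `|u|)) * phi u).
  by rewrite /F; apply: has_derP; [der|rewrite /=; ring].
have d1 x u : partial1of2 F x u = - `|u| * expR (- (x * `|u|)) * phi u.
  by rewrite partial1of2E; have [_ <-] := dF x u.
pose G u := `| `|u| * expR (- (z / 2 * `|u|)) * phi u|.
have [mup iup] := lapl_mul lp.
have Iz : (`](z / 2), (z + 1)[ : set R) z by rewrite /= in_itv/=; apply/andP; split; lra.
have h1 x : (`](z / 2), (z + 1)[ : set R) x -> 0 < x by rewrite /= in_itv/= => /andP[+ _]; lra.
have intF x : (`](z / 2), (z + 1)[ : set R) x -> (@hl R).-integrable setT (EFin \o F x).
  move=> /h1 x0; have [? _] : has_int (F x) (LT phi x); last by [].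
  apply: has_int_eq (lapl_has_int lp x0) _ _ _ => //; first by apply: measurable_funM => //; mea.
  by move=> u u0; rewrite /F ger0_norm// ltW.
have intG : (@hl R).-integrable setT (EFin \o G).
  have [? _] : has_int G (\int[hl]_u `|expR (- (z / 2 * u)) * (u * phi u)|); last by [].
  apply: has_int_eq (conj (integrable_abse (iup _ z2)) erefl : has_int (fun u => `|expR (- (z / 2 * u)) * (u * phi u)|) _) _ _ _ => //.
    by apply: measurable_normr; apply: measurable_funM => //; mea.
  by move=> u u0; rewrite /G (ger0_norm (ltW u0)); congr `|_|; ring.
have G0 u : 0 <= G u by exact: normr_ge0.
have derF x u : (`](z / 2), (z + 1)[ : set R) x -> setT u -> derivable (F ^~ u) x 1.
  by move=> _ _; have [] := dF x u.
have Gub x u : (`](z / 2), (z + 1)[ : set R) x -> setT u -> `|partial1of2 F x u| <= G u.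
  move=> /= + _; rewrite in_itv/= => /andP[zx _]; rewrite d1 /G !normrM normrN !normr_id.
  rewrite ler_wpM2r// ler_wpM2l// !(ger0_norm (expR_ge0 _)) ler_expR lerN2 ler_wpM2r//.
  exact: ltW.
have D := @derivable_under_integral R _ (measurableTypeR R) (@hl R) F setT measurableT z (z / 2) (z + 1) Iz intF derF G G0 intG Gub.
have E := @differentiation_under_integral R _ (measurableTypeR R) (@hl R) F setT measurableT z (z / 2) (z + 1) Iz intF derF G G0 intG Gub.
have near_z : \forall x \near z, \int[hl]_u F x u = LT phi x.
  by near=> x; apply: FE; near: x; exact: lt_nbhsr.
apply: (near_eq_is_derive near_z).
have -> : - LT (fun u => u * phi u) z = \int[hl]_y (partial1of2 F ^~ y) z.
  rewrite /LT -mulN1r -(has_intE (has_int_scale (-1) (conj (iup _ z0) erefl))).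
  apply: eq_Rintegral_hl; first by apply: measurable_funM; [mea|apply: measurable_funM => //; mea].
    rewrite [X in measurable_fun _ X](_ : _ = (fun u => - `|u| * expR (- (z * `|u|)) * phi u)).
      by apply: measurable_funM => //; mea.
    by apply/funext => u; exact: d1.
  by move=> u u0; rewrite d1 (ger0_norm (ltW u0)); ring.
by rewrite -E derive1E; split.
Unshelve. all: by end_near. Qed.

Lemma lapl1 : lapl (fun=> 1).
Proof. by apply: (@lapl_bounded _ 1) => // u _; rewrite normr1. Qed.

Lemma LT1 z : 0 < z -> LT (fun=> 1) z = z^-1.
Proof.
move=> z0; apply: has_intE; apply: has_int_eq (int_exp z0) _ _ _ => //; first by mea.
by move=> u _; rewrite mulr1.
Qed.

Let LT_next phi (F : R -> R) (dF : R -> R) : lapl phi ->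
  (forall z, 0 < z -> LT phi z = F z) -> (forall z, 0 < z -> has_der F z (- dF z)) ->
  forall z, 0 < z -> LT (fun u => u * phi u) z = dF z.
Proof.
move=> lp h dh z z0; have d1 := der_LT lp z0.
have n1 : \forall x \near z, LT phi x = F x by near=> x; apply: h; near: x; exact: lt_nbhsr.
have d2 : is_derive z 1 F (- LT (fun u => u * phi u) z) by exact: near_eq_is_derive d1.
have [_ e1] := d2; have [_ e2] := dh z z0.
by apply: oppr_inj; rewrite -e1 -e2.
Unshelve. all: by end_near. Qed.

Lemma LTu z : 0 < z -> LT (fun u => u * 1) z = (z ^+ 2)^-1.
Proof.
move: z; apply: (@LT_next _ (fun z => z^-1) _ lapl1 LT1) => z z0; apply: has_derP; first by der; rewrite gt_eqF.
by rewrite mulr1.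
Qed.

Lemma LTu2 z : 0 < z -> LT (fun u => u * (u * 1)) z = 2 / z ^+ 3.
Proof.
move: z; apply: (@LT_next _ (fun z => (z ^+ 2)^-1) _ (lapl_mul lapl1) LTu) => z z0.
apply: has_derP; first by der; rewrite expf_neq0// gt_eqF.
by rewrite /=; field; rewrite gt_eqF.
Qed.

(** The auxiliary functions $f$ and $g$ of the sine and cosine integrals. *)
Definition auxf := LT (fun u => (1 + u ^+ 2)^-1).
Definition auxg := LT (fun u => u * (1 + u ^+ 2)^-1).

Lemma lapl_f : lapl (fun u => (1 + u ^+ 2)^-1).
Proof.
apply: (@lapl_bounded _ 1); first by mea.
move=> u _; rewrite ger0_norm ?invr_ge0 ?addr_ge0 ?sqr_ge0//.
by rewrite invf_le1 ?ltr_pwDl ?sqr_ge0// lerDl sqr_ge0.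
Qed.
Lemma lapl_g : lapl (fun u => u * (1 + u ^+ 2)^-1).
Proof. exact: lapl_mul lapl_f. Qed.

Lemma der_auxf z : 0 < z -> has_der auxf z (- auxg z).
Proof. exact: der_LT lapl_f. Qed.

(** $u^2/(1+u^2)=1-1/(1+u^2)$: this closes the differential system of $f$ and
    $g$. *)
Let LTg' z : 0 < z -> LT (fun u => u * (u * (1 + u ^+ 2)^-1)) z = z^-1 - auxf z.
Proof.
move=> z0.
have h := has_int_add (lapl_has_int lapl1 z0) (has_int_scale (-1) (lapl_has_int lapl_f z0)).
apply: has_intE; apply: has_int_eq h _ _ _ => //.
- by mea.
- by move=> u u0; field; rewrite gt_eqF// ltr_pwDl ?sqr_ge0.
- by rewrite LT1// mulN1r.
Qed.

Lemma der_auxg z : 0 < z -> has_der auxg z (auxf z - z^-1).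
Proof. by move=> z0; have := der_LT lapl_g z0; rewrite LTg'// opprB. Qed.

(** The difference is the transform of $u^2/(1+u^2)\le u$. *)
Lemma auxf_bound z : 0 < z -> 0 <= z^-1 - auxf z <= (z ^+ 2)^-1.
Proof.
move=> z0; rewrite -LTg'// -LTu//; apply: LT_le => //.
- exact: lapl_mul lapl_g.
- exact: lapl_mul lapl1.
move=> u u0; have d : 0 < 1 + u ^+ 2 by rewrite ltr_pwDl ?sqr_ge0.
rewrite !mulr_ge0 ?invr_ge0 ?(ltW u0) ?(ltW d)//= ler_wpM2l ?(ltW u0)//.
by rewrite ler_pdivrMr// mul1r; have := sqr_ge0 (u - 1); nra.
Qed.

(** The difference is the transform of $u^3/(1+u^2)\le u^2$. *)
Lemma auxg_bound z : 0 < z -> 0 <= (z ^+ 2)^-1 - auxg z <= 2 / z ^+ 3.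
Proof.
move=> z0; have h := has_int_add (lapl_has_int (lapl_mul lapl1) z0) (has_int_scale (-1) (lapl_has_int lapl_g z0)).
have e : LT (fun u => u * (u * (u * (1 + u ^+ 2)^-1))) z = (z ^+ 2)^-1 - auxg z.
  apply: has_intE; apply: has_int_eq h _ _ _ => //.
  - by mea.
  - by move=> u u0; field; rewrite gt_eqF// ltr_pwDl ?sqr_ge0.
  - by rewrite LTu// mulN1r.
rewrite -e -LTu2//; apply: LT_le => //.
- exact: lapl_mul (lapl_mul lapl_g).
- exact: lapl_mul (lapl_mul lapl1).
move=> u u0; have d : 0 < 1 + u ^+ 2 by rewrite ltr_pwDl ?sqr_ge0.
rewrite !mulr_ge0 ?invr_ge0 ?(ltW u0) ?(ltW d)//= !ler_wpM2l ?(ltW u0)//.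
by rewrite ler_pdivrMr// mul1r; have := sqr_ge0 (u - 1); nra.
Qed.

End LaplaceTransform.

(** * Lommel functions *)

Section LommelFunctions.
Context {R : realType}.
Implicit Types (y w : R -> R) (z m nu : R).

Let near_gt0 z (P : R -> Prop) : 0 < z -> (forall x, 0 < x -> P x) -> \forall x \near z, P x.
Proof. by move=> z0 h; near=> x; apply: h; near: x; exact: lt_nbhsr.
Unshelve. all: by end_near. Qed.

Lemma has_der_near (f g : R -> R) z a : 0 < z -> (forall x, 0 < x -> f x = g x) ->
  has_der f z a -> has_der g z a.
Proof. by move=> z0 fg; apply: near_eq_is_derive; exact: near_gt0. Qed.

Lemma has_der_derive1 (f : R -> R) z : derivable f z 1 -> has_der f z (derive1 f z).
Proof. by move=> h; rewrite derive1E; exact: derivableP. Qed.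

(** For $\nu^2=1/4$ the substitution $w=y/\sqrt z$ turns the Lommel operator
    into $z^{3/2}(y''+y)$. *)
Lemma is_lommelS_intro (y y1 y2 : R -> R) m nu : nu ^+ 2 = 1 / 4 ->
  (forall z, 0 < z -> has_der y z (y1 z)) -> (forall z, 0 < z -> has_der y1 z (y2 z)) ->
  (forall z, 0 < z -> z * Num.sqrt z * (y2 z + y z) = z `^ (m + 1)) ->
  y z / Num.sqrt z / z `^ (m - 1) @[z --> +oo] --> (1 : R) ->
  is_lommelS m nu (fun z => y z / Num.sqrt z).
Proof.
move=> nu2 d1 d2 e l; split => // z z0.
pose w x := y x / Num.sqrt x.
pose w1 x := y1 x / Num.sqrt x - y x / (2 * Num.sqrt x ^+ 3).
pose w2 x := y2 x / Num.sqrt x - y1 x / Num.sqrt x ^+ 3 + 3 / 4 * (y x / Num.sqrt x ^+ 5).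
have dw x : 0 < x -> has_der w x (w1 x).
  move=> x0; have s0 : 0 < Num.sqrt x by rewrite sqrtr_gt0.
  apply: has_derP; first by apply: der_mul; [exact: d1|der; rewrite ?gt_eqF].
  by rewrite /w1; field; rewrite gt_eqF.
have dw1 x : 0 < x -> has_der w1 x (w2 x).
  move=> x0; have s0 : 0 < Num.sqrt x by rewrite sqrtr_gt0.
  apply: has_derP.
    apply: der_add; first by apply: der_mul; [exact: d2|der; rewrite ?gt_eqF].
    apply: der_opp; apply: der_mul; first exact: d1.
    by der; rewrite ?mulf_neq0 ?expf_neq0 ?gt_eqF.
  by rewrite /w2 /=; field; rewrite gt_eqF.
have E1 x : 0 < x -> w1 x = derive1 w x.
  by move=> x0; rewrite derive1E; have [_ ->] := dw x x0.
have remainder x : 0 < x -> has_der (derive1 w) x (w2 x).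
  by move=> x0; apply: has_der_near (dw1 x x0).
split; first by have [] := dw z z0.
  by have [] := remainder z z0.
have -> : derive1n 2 w z = w2 z by rewrite /= derive1E; have [_ ->] := remainder z z0.
rewrite -E1// nu2 -e// /w /w1 /w2.
have s0 : 0 < Num.sqrt z by rewrite sqrtr_gt0.
move: (sqr_sqrtr (ltW z0)) s0.
move: (Num.sqrt z) (y z) (y1 z) (y2 z) => s a b c <- s0.
by field; rewrite gt_eqF.
Qed.

(** The difference of two solutions, times $\sqrt z$, is a combination of sine
    and cosine; it tends to 0 at infinity and its absolute value has period
    $\pi$, so it vanishes. *)
Lemma lommelS_unique m nu w v : nu ^+ 2 = 1 / 4 ->
  Num.sqrt z * z `^ (m - 1) @[z --> +oo] --> (0 : R) ->
  is_lommelS m nu w -> is_lommelS m nu v -> forall z, 0 < z -> w z = v z.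
Proof.
move=> nu2 lim [ew lw] [ev lv].
pose D x := w x - v x.
pose D1 x := derive1 w x - derive1 v x.
pose D2 x := derive1n 2 w x - derive1n 2 v x.
have dD x : 0 < x -> has_der D x (D1 x).
  move=> x0; have [a1 _ _] := ew x x0; have [b1 _ _] := ev x x0.
  exact: der_add (has_der_derive1 a1) (der_opp (has_der_derive1 b1)).
have dD1 x : 0 < x -> has_der D1 x (D2 x).
  move=> x0; have [_ a1 _] := ew x x0; have [_ b1 _] := ev x x0.
  exact: der_add (has_der_derive1 a1) (der_opp (has_der_derive1 b1)).
have eD x : 0 < x -> x ^+ 2 * D2 x + x * D1 x + (x ^+ 2 - 1 / 4) * D x = 0.
  move=> x0; have [_ _ a1] := ew x x0; have [_ _ b1] := ev x x0.
  rewrite nu2 in a1; rewrite nu2 in b1.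
  have h (c d e p2 p1 p0 q2 q1 q0 r : R) : c * p2 + d * p1 + e * p0 = r ->
      c * q2 + d * q1 + e * q0 = r -> c * (p2 - q2) + d * (p1 - q1) + e * (p0 - q0) = 0.
    by move=> e1 e2; rewrite -(subrr r) -{1}e1 -e2; ring.
  exact: h a1 b1.
pose y x := Num.sqrt x * D x.
pose y1 x := Num.sqrt x * D1 x + D x / (2 * Num.sqrt x).
have ds x : 0 < x -> has_der (@Num.sqrt R) x (2 * Num.sqrt x)^-1.
  by move=> x0; apply: (@has_derP _ (fun x => Num.sqrt x)); [der|rewrite mulr1].
have dcos x : has_der (@cos R) x (- sin x) by exact: is_derive_cos.
have dsin x : has_der (@sin R) x (cos x) by exact: is_derive_sin.
have dy x : 0 < x -> has_der y x (y1 x).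
  move=> x0; have s0 : 0 < Num.sqrt x by rewrite sqrtr_gt0.
  apply: has_derP; first by apply: der_mul; [exact: ds|exact: dD].
  by rewrite /y1; field; rewrite gt_eqF.
have dy1 x : 0 < x -> has_der y1 x (- y x).
  move=> x0; have s0 : 0 < Num.sqrt x by rewrite sqrtr_gt0.
  apply: has_derP.
    apply: der_add; first by apply: der_mul; [exact: ds|exact: dD1].
    by apply: der_mul; [exact: dD|der; rewrite ?mulf_neq0 ?gt_eqF].
  have := eD x x0; rewrite /y /=; move: (sqr_sqrtr (ltW x0)) s0.
  move: (Num.sqrt x) (D x) (D1 x) (D2 x) => s a b c <- s0 e.
  apply/eqP; rewrite -subr_eq0; apply/eqP.
  transitivity ((s ^+ 3)^-1 * ((s ^+ 2) ^+ 2 * c + s ^+ 2 * b + ((s ^+ 2) ^+ 2 - 1 / 4) * a)).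
    by field; rewrite gt_eqF.
  by rewrite e mulr0.
pose A x := y x * cos x - y1 x * sin x.
pose B x := y x * sin x + y1 x * cos x.
have cA x : 0 < x -> A x = A 1.
  move=> x0; apply: (@der_cst0 _ A) => // t t0; apply: has_derP.
    by apply: der_add; [apply: der_mul; [exact: dy|exact: dcos]|apply: der_opp; apply: der_mul; [exact: dy1|exact: dsin]].
  by rewrite /=; ring.
have cB x : 0 < x -> B x = B 1.
  move=> x0; apply: (@der_cst0 _ B) => // t t0; apply: has_derP.
    by apply: der_add; [apply: der_mul; [exact: dy|exact: dsin]|apply: der_mul; [exact: dy1|exact: dcos]].
  by rewrite /=; ring.
have yE x : 0 < x -> y x = A 1 * cos x + B 1 * sin x.
  move=> x0; rewrite -(cA x x0) -(cB x x0) /A /B.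
  transitivity (y x * (cos x ^+ 2 + sin x ^+ 2)); last by ring.
  by rewrite cos2Dsin2 mulr1.
have yp x : 0 < x -> `|y (x + pi)| = `|y x|.
  move=> x0; have xp : 0 < x + pi by rewrite addr_gt0 ?pi_gt0.
  have c : cos (x + pi) = - cos x := cosDpi x; have s : sin (x + pi) = - sin x := sinDpi x.
  by rewrite (yE _ xp) (yE _ x0) c s -normrN; congr `|_|; ring.
have ypn x n : 0 < x -> `|y (x + n%:R * pi)| = `|y x|.
  move=> x0; elim: n => [|n IH]; first by rewrite mul0r addr0.
  rewrite -natr1 mulrDl mul1r addrA yp ?IH//.
  by rewrite ltr_wpDr// mulr_ge0 ?pi_ge0.
have y0 : y x @[x --> +oo] --> (0 : R).
  have h : Num.sqrt x * x `^ (m - 1) * (w x / x `^ (m - 1) - v x / x `^ (m - 1)) @[x --> +oo]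
      --> 0 * (1 - 1 : R) by apply: cvgM => //; exact: cvgB.
  rewrite mul0r in h; apply: cvg_trans h; apply: near_eq_cvg.
  near=> x; have x0 : 0 < x by near: x; exact: nbhs_pinfty_gt.
  have zn : x `^ (m - 1) != 0 by rewrite gt_eqF// powR_gt0.
  by rewrite /y /D; field.
move=> z z0; apply/eqP; rewrite -subr_eq0 -/(D z).
have : y z = 0.
  have h : y (z + n%:R * pi) @[n --> \oo] --> (0 : R).
    move/cvg_pinftyP : y0; apply; apply/cvgryPge => M.
    near=> n; apply: (@le_trans _ _ (n%:R)); first by near: n; exact: nbhs_infty_ger.
    have pi1 : 1 <= pi :> R by have := @pi_ge2 R; lra.
    by rewrite -[leLHS]mulr1 ler_wpDl ?(ltW z0)// ler_wpM2l.
  have h2 : `|y (z + n%:R * pi)| @[n --> \oo] --> `|0 : R| by exact: cvg_norm.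
  apply/eqP; rewrite -normr_eq0; apply/eqP; transitivity (`|0 : R|); last exact: normr0.
  have e : (fun n : nat => `|y (z + n%:R * pi)|) = (fun=> `|y z|).
    by apply/funext => n; exact: ypn.
  by rewrite e in h2; exact: (cvg_unique _ (cvg_cst _) h2).
by move/eqP; rewrite mulf_eq0 gt_eqF ?sqrtr_gt0.
Unshelve. all: by end_near. Qed.

Let half z : 0 < z -> z `^ (1 / 2) = Num.sqrt z.
Proof. by move=> z0; rewrite mul1r powR12_sqrt// ltW. Qed.

Let pow_p12 z : 0 < z -> z `^ (- (1 / 2) + 1) = Num.sqrt z.
Proof. by move=> z0; rewrite -half//; congr powR; field. Qed.
Let pow_m12 z : 0 < z -> z `^ (- (3 / 2) + 1) = (Num.sqrt z)^-1.
Proof. by move=> z0; rewrite -half// -powRN; congr powR; field. Qed.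
Let pow_m32 z : 0 < z -> z `^ (- (1 / 2) - 1) = (z * Num.sqrt z)^-1.
Proof.
move=> z0; rewrite -half// -[X in (X * _)^-1]powRr1 ?(ltW z0)// -powRD ?gt_eqF ?implybT// -powRN.
by congr powR; field.
Qed.
Let pow_m52 z : 0 < z -> z `^ (- (3 / 2) - 1) = (z ^+ 2 * Num.sqrt z)^-1.
Proof.
move=> z0; rewrite -half// -powR_mulrn ?(ltW z0)// -powRD ?gt_eqF ?implybT// -powRN.
by congr powR; field.
Qed.

Let inv_y : (fun x : R => x^-1) @ +oo --> (0 : R).
Proof.
apply/gtr0_cvgV0; first by near=> x; near: x; exact: nbhs_pinfty_gt.
exact: cvg_id.
Unshelve. all: by end_near. Qed.

Let cvg_eq_y (f g : R -> R) (l : R) : (forall x, 0 < x -> f x = g x) ->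
  f x @[x --> +oo] --> l -> g x @[x --> +oo] --> l.
Proof.
move=> fg h; apply: cvg_trans h; apply: near_eq_cvg; near=> x; apply: fg.
by near: x; exact: nbhs_pinfty_gt.
Unshelve. all: by end_near. Qed.

Let squeeze1 (f : R -> R) : (forall x, 0 < x -> 0 <= 1 - f x <= 2 * x^-1) -> f x @[x --> +oo] --> (1 : R).
Proof.
move=> h; apply/subr_cvg0; apply: (@cvg0_bound _ _ _ _ _ (fun x => 2 * x^-1)).
  near=> x; have x0 : 0 < x by near: x; exact: nbhs_pinfty_gt.
  have /andP[a b] := h x x0.
  by rewrite distrC ger0_norm.
by rewrite -(mulr0 (2 : R)); apply: cvgM; [exact: cvg_cst|exact: inv_y].
Unshelve. all: by end_near. Qed.

Lemma lommelS_f z : 0 < z -> Num.sqrt z * lommelS (- (1 / 2)) (1 / 2) z = auxf z.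
Proof.
have n2 : (1 / 2) ^+ 2 = 1 / 4 :> R by field.
have sol : is_lommelS (- (1 / 2)) (1 / 2) (fun z => auxf z / Num.sqrt z).
  apply: (@is_lommelS_intro _ (fun z => - auxg z) (fun z => - (auxf z - z^-1))) => //.
  - by move=> x x0; exact: der_auxf.
  - by move=> x x0; apply: der_opp; exact: der_auxg.
  - by move=> x x0; rewrite pow_p12//; field; rewrite gt_eqF.
  - apply: (@cvg_eq_y (fun x => x * auxf x)).
      move=> x x0; rewrite pow_m32//; field; by rewrite !gt_eqF ?sqrtr_gt0.
    apply: squeeze1 => x x0; have /andP[a b] := auxf_bound x0.
    have -> : 1 - x * auxf x = x * (x^-1 - auxf x) by field; rewrite gt_eqF.
    rewrite mulr_ge0 ?(ltW x0)//=; apply: le_trans (ler_wpM2l (ltW x0) b) _.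
    have xi : 0 < x^-1 by rewrite invr_gt0.
    rewrite (_ : x * (x ^+ 2)^-1 = x^-1); first by lra.
    by field; rewrite gt_eqF.
have lim : Num.sqrt z * z `^ (- (1 / 2) - 1) @[z --> +oo] --> (0 : R).
  apply: (@cvg_eq_y (fun x => x^-1)); last exact: inv_y.
  by move=> x x0; rewrite pow_m32//; field; rewrite !gt_eqF ?sqrtr_gt0.
move=> z0; have L : is_lommelS (- (1 / 2)) (1 / 2) (lommelS (- (1 / 2)) (1 / 2) : R -> R).
  by rewrite /lommelS; apply: xgetPex; eexists; exact: sol.
rewrite (lommelS_unique n2 lim L sol z0) mulrC divfK// gt_eqF// sqrtr_gt0//.
Qed.

Lemma lommelS_g z : 0 < z -> Num.sqrt z * lommelS (- (3 / 2)) (- (1 / 2)) z = auxg z.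
Proof.
have n2 : (- (1 / 2)) ^+ 2 = 1 / 4 :> R by field.
have sol : is_lommelS (- (3 / 2)) (- (1 / 2)) (fun z => auxg z / Num.sqrt z).
  apply: (@is_lommelS_intro _ (fun z => auxf z - z^-1) (fun z => - auxg z - (- (z ^+ 2)^-1))) => //.
  - by move=> x x0; exact: der_auxg.
  - move=> x x0; apply: has_derP.
      by apply: der_add; [exact: der_auxf|der; rewrite gt_eqF].
    by rewrite mulr1.
  - move=> x x0; rewrite pow_m12//.
    have s0 : 0 < Num.sqrt x by rewrite sqrtr_gt0.
    rewrite [RHS](_ : _ = Num.sqrt x / Num.sqrt x ^+ 2); last by field; rewrite gt_eqF.
    by rewrite (sqr_sqrtr (ltW x0)); field; rewrite gt_eqF.
  - apply: (@cvg_eq_y (fun x => x ^+ 2 * auxg x)).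
      move=> x x0; rewrite pow_m52//; field; by rewrite !gt_eqF ?sqrtr_gt0.
    apply: squeeze1 => x x0; have /andP[a b] := auxg_bound x0.
    have -> : 1 - x ^+ 2 * auxg x = x ^+ 2 * ((x ^+ 2)^-1 - auxg x) by field; rewrite gt_eqF.
    rewrite mulr_ge0 ?sqr_ge0//=; apply: le_trans (ler_wpM2l (sqr_ge0 x) b) _.
    rewrite (_ : x ^+ 2 * (2 / x ^+ 3) = 2 * x^-1)//.
    by field; rewrite gt_eqF.
have lim : Num.sqrt z * z `^ (- (3 / 2) - 1) @[z --> +oo] --> (0 : R).
  apply: (@cvg_eq_y (fun x => x^-1 * x^-1)).
    by move=> x x0; rewrite pow_m52//; field; rewrite !gt_eqF ?sqrtr_gt0.
  by rewrite -(mulr0 (0 : R)); apply: cvgM; exact: inv_y.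
move=> z0; have L : is_lommelS (- (3 / 2)) (- (1 / 2)) (lommelS (- (3 / 2)) (- (1 / 2)) : R -> R).
  by rewrite /lommelS; apply: xgetPex; eexists; exact: sol.
rewrite (lommelS_unique n2 lim L sol z0) mulrC divfK// gt_eqF// sqrtr_gt0//.
Qed.

End LommelFunctions.

(** * The psi function at negative half-integers *)

Section GammaHalf.
Context {R : realType}.
Implicit Types (x t z u v : R).

Definition gamma_half : R := \int[hl]_v (expR (- v) * (Num.sqrt v)^-1).
Definition dgamma_half : R := \int[hl]_v (expR (- v) * ((Num.sqrt v)^-1 * ln v)).

Let phi0 p q (u : R) := (Num.sqrt u)^-1 * (p + q * ln u) / (1 + u ^+ 2).

Lemma int_phi0 p q : has_int (phi0 p q)
  (p * (pi / Num.sqrt 2) - q * (pi ^+ 2 * Num.sqrt 2 / 4)).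
Proof.
apply: has_int_eq (has_int_add (has_int_scale p (int_sqrtV2 ltr01))
  (has_int_scale q (int_lnV ltr01))) _ _ _.
- by rewrite /phi0; mea.
- by move=> u u0; rewrite /phi0 expr1n; ring.
- by rewrite ln1 sqrtr1 !mulr1 mul0r sub0r divr1 mulrN.
Qed.

Lemma lapl_integrable (phi : R -> R) : hl.-integrable setT (EFin \o phi) -> lapl phi.
Proof.
move=> i; have mphi : measurable_fun setT phi by have /integrableP[/measurable_EFinP] := i.
split=> // z z0; apply: (@le_integrable_hl _ _ (fun u => `|phi u|)).
- by apply: measurable_funM => //; mea.
- move=> u u0; rewrite normrM (ger0_norm (expR_ge0 _)) ler_piMl//.
  by rewrite -expR0 ler_expR oppr_le0 mulr_ge0// ltW.
- exact: integrable_abse i.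
Qed.

Lemma lapl_eq (phi psi : R -> R) : lapl phi -> measurable_fun setT psi ->
  (forall u, 0 < u -> psi u = phi u) -> lapl psi.
Proof.
move=> lp mpsi e; split=> // z z0.
have [? _] : has_int (fun u => expR (- (z * u)) * psi u) (LT phi z); last by [].
apply: has_int_eq (lapl_has_int lp z0) _ _ _ => //; first by apply: measurable_funM => //; mea.
by move=> u u0; rewrite e.
Qed.

Lemma lapl_add (phi psi : R -> R) : lapl phi -> lapl psi -> lapl (fun u => phi u + psi u).
Proof.
move=> lp lq; have [mp _] := lp; have [mq _] := lq.
split; first exact: measurable_funD.
move=> z z0; have [? _] : has_int (fun u => expR (- (z * u)) * (phi u + psi u)) (LT phi z + LT psi z); last by [].
apply: has_int_eq (has_int_add (lapl_has_int lp z0) (lapl_has_int lq z0)) _ _ _ => //.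
  by apply: measurable_funM; [mea|exact: measurable_funD].
by move=> u _; rewrite mulrDr.
Qed.

Let psi0 p q (u : R) := (Num.sqrt u)^-1 * (p + q * ln u).

(** The function is $\varphi(u)+u^2\varphi(u)$ with $\varphi$ integrable. *)
Lemma lapl_psi0 p q : lapl (psi0 p q).
Proof.
have l0 := lapl_integrable (has_int_integrable (int_phi0 p q)).
apply: lapl_eq (lapl_add l0 (lapl_mul (lapl_mul l0))) _ _; first by rewrite /psi0; mea.
move=> u u0; rewrite /psi0 /phi0; field; rewrite !gt_eqF ?sqrtr_gt0//.
by rewrite ltr_pwDl ?sqr_ge0.
Qed.

Let has_gamma : has_int (fun v => expR (- v) * (Num.sqrt v)^-1) gamma_half.
Proof.
split=> //; have [_ /(_ 1 ltr01)] := lapl_psi0 1 0; apply: eq_integrable => // u _ /=.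
by rewrite /psi0 mul1r mul0r addr0 mulr1.
Qed.

Let has_dgamma : has_int (fun v => expR (- v) * ((Num.sqrt v)^-1 * ln v)) dgamma_half.
Proof.
split=> //; have [_ /(_ 1 ltr01)] := lapl_psi0 0 1; apply: eq_integrable => // u _ /=.
by rewrite /psi0 mul1r mul1r add0r.
Qed.

Lemma LT_psi0 p q z : 0 < z ->
  LT (psi0 p q) z = (Num.sqrt z)^-1 * ((p - q * ln z) * gamma_half + q * dgamma_half).
Proof.
move=> z0; have zi : 0 < z^-1 by rewrite invr_gt0.
have s0 : 0 < Num.sqrt z by rewrite sqrtr_gt0.
have [mp _] := lapl_psi0 p q.
rewrite /LT (Rintegral_scale zi); last by apply: measurable_funM => //; mea.
have h := has_int_add (has_int_scale (Num.sqrt z * (p - q * ln z)) has_gamma)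
  (has_int_scale (Num.sqrt z * q) has_dgamma).
have e : \int[hl]_x (expR (- (z * (z^-1 * x))) * psi0 p q (z^-1 * x)) =
   Num.sqrt z * (p - q * ln z) * gamma_half + Num.sqrt z * q * dgamma_half.
  apply: has_intE; apply: has_int_eq h _ _ _ => //; first by rewrite /psi0; mea.
  move=> u u0; have -> : z * (z^-1 * u) = u by rewrite mulrA mulfV ?mul1r// gt_eqF.
  rewrite /psi0.
  rewrite sqrtrM ?(ltW zi)// sqrtrV ?(ltW z0)// lnM ?posrE// lnV ?posrE//.
  by field; rewrite !gt_eqF ?sqrtr_gt0.
rewrite e; move: (sqr_sqrtr (ltW z0)) s0; move: (Num.sqrt z) (ln z) => s l <- s0.
by field; rewrite gt_eqF.
Qed.

(** The square is $\int\int e^{-(1+s)v}s^{-1/2}\,ds\,dv$; integrating in $v$ first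
    leaves $\int s^{-1/2}/(1+s)\,ds=\pi$. *)
Lemma gamma_half_sqr : gamma_half ^+ 2 = pi.
Proof.
pose F v s := expR (- ((1 + s) * v)) * (Num.sqrt s)^-1.
have h1 v : 0 < v -> has_int (F v) (expR (- v) * ((Num.sqrt v)^-1 * gamma_half)).
  move=> v0; have vi : 0 < v^-1 by rewrite invr_gt0.
  have := has_int_scale (expR (- v)) (lapl_has_int (lapl_psi0 1 0) v0).
  rewrite LT_psi0// mul0r subr0 mul1r mul0r addr0 => h.
  apply: has_int_eq h _ _ _ => //; first by rewrite /F; mea.
  move=> s s0; have -> : F v s = expR (- v) * expR (- (v * s)) * (Num.sqrt s)^-1.
    by rewrite /F -expRD; congr (expR _ * _); ring.
  by rewrite /psi0; ring.
have h2 s : 0 < s -> has_int (F^~ s) ((Num.sqrt s)^-1 / (1 + s)).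
  move=> s0; have s1 : 0 < 1 + s by rewrite ltr_wpDl.
  apply: has_int_eq (has_int_scale (Num.sqrt s)^-1 (int_exp s1)) _ _ _ => //; first by rewrite /F; mea.
  by move=> v v0; rewrite /F; ring.
have h3 : has_int (fun v => expR (- v) * ((Num.sqrt v)^-1 * gamma_half)) (gamma_half ^+ 2).
  apply: has_int_eq (has_int_scale gamma_half has_gamma) _ _ _; first by mea.
    by move=> v _; ring.
  by rewrite expr2.
have F0 v s : 0 <= F v s by rewrite mulr_ge0 ?expR_ge0// invr_ge0 sqrtr_ge0.
have i1 v : 0 < v -> hl.-integrable setT (EFin \o F v) by move=> /h1/has_int_integrable.
have i2 s : 0 < s -> hl.-integrable setT (EFin \o F^~ s) by move=> /h2/has_int_integrable.
have FB := @hl_fubini R F (gamma_half ^+ 2) _ _ i1 i2; move: FB.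
have -> : \int[hl]_v \int[hl]_t F v t = gamma_half ^+ 2.
  rewrite -(has_intE h3); apply: eq_Rintegral_hl.
  - apply: (@measurable_kint _ (measurableTypeR R)); rewrite /F; mea.
  - by mea.
  - by move=> v v0; exact: has_intE (h1 _ v0).
have -> : \int[hl]_t \int[hl]_v F v t = pi.
  rewrite -(has_intE int_sqrtV1); apply: eq_Rintegral_hl.
  - apply: (@measurable_kint _ (measurableTypeR R) R hl (fun t v => F v t)); rewrite /F; mea.
  - by mea.
  - by move=> s s0; exact: has_intE (h2 _ s0).
apply; first by rewrite /F; mea.
rewrite -(has_int_ereal h3) le_eqVlt; apply/orP; left; apply/eqP.
apply: ae_eq_integral => //.
- apply: (@measurable_fun_fubini_tonelli_F _ _ (measurableTypeR R) (measurableTypeR R) R hl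
    (fun p => `|F p.1 p.2|%:E)) => //.
  by apply/measurable_EFinP; rewrite /F; mea.
- by apply/measurable_EFinP; mea.
apply: ae_hlW => v v0 _; rewrite -(has_int_ereal (h1 _ v0)).
by apply: eq_integral => s _; rewrite ger0_norm.
Qed.

Lemma gamma_halfE : gamma_half = Num.sqrt pi.
Proof.
rewrite -gamma_half_sqr sqrtr_sqr ger0_norm//.
by apply: Rintegral_ge0 => v _; rewrite mulr_ge0 ?expR_ge0// invr_ge0 sqrtr_ge0.
Qed.

(* The integrand of the Gamma integral, written with an exponential so that it
   makes sense, and is differentiable in the parameter, at every point. *)
Let F x t := expR ((x - 1) * ln t) * expR (- t).

Let eulerE x : euler_integral x = \int[hl]_t F x t.
Proof.
rewrite /euler_integral /Rintegral integral_hl; last first.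
  by apply/measurable_EFinP; rewrite /F; mea.
congr fine; apply: eq_integral => t; rewrite inE => /RplusE t0.
by rewrite /F /powR gt_eqF.
Qed.

Let root8 (t : R) := Num.sqrt (root4 t).

(** With $q=t^{1/8}$, the power is at most $q^{-5}+q^{-3}$ and the logarithm at
    most $8(q+q^{-1})$; the exponential absorbs the growth at infinity. *)
Let F_bound x t : 3 / 8 < x -> x < 5 / 8 -> 0 < t ->
  F x t <= 8 * majorant t /\ `|ln t| * F x t <= 64 * majorant t.
Proof.
move=> x1 x2 t0; have r0 := root4_gt0 t0.
pose q := root8 t; have q0 : 0 < q by rewrite sqrtr_gt0.
have q2 : q ^+ 2 = root4 t by rewrite sqr_sqrtr// ltW.
have q8 : q ^+ 8 = t by rewrite -(root4_4 t0) -q2 -exprM.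
have lnt : ln t = 8 * ln q by rewrite -[in LHS]q8 lnXn// mulr_natl.
have B : expR ((x - 1) * ln t) <= q ^- 5 + q ^- 3.
  have e n : q ^- n = expR (- (n%:R * ln q)).
    by rewrite expRN expRM_natl lnK// posrE.
  rewrite !e lnt; case: (leP 0 (ln q)) => l.
    apply: (@le_trans _ _ (expR (- (3%:R * ln q)))); last by rewrite lerDr expR_ge0.
    by rewrite ler_expR; nra.
  apply: (@le_trans _ _ (expR (- (5%:R * ln q)))); last by rewrite lerDl expR_ge0.
  by rewrite ler_expR; nra.
have L : `|ln t| <= 8 * (q + q^-1).
  have h1 := ln_sublinear q0; have qi : 0 < q^-1 by rewrite invr_gt0.
  have h2 := ln_sublinear qi; rewrite lnV ?posrE// in h2.
  by rewrite lnt ler_norml; apply/andP; split; lra.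
have X : expR (- t) * ((q ^- 5 + q ^- 3) * (q + q^-1)) <= 8 * majorant t.
  rewrite /majorant -q2.
  have -> : (q ^- 5 + q ^- 3) * (q + q^-1) = (1 + q ^+ 2) ^+ 2 / (q ^+ 2) ^+ 3 by field; rewrite gt_eqF.
  have p1 : 0 < 1 + q ^+ 2 by rewrite addr_gt0 ?exprn_gt0.
  have -> : 8 * ((q ^+ 2) ^+ 3 * (1 + q ^+ 2) ^+ 2)^-1 = 8 / (1 + q ^+ 2) ^+ 2 / (q ^+ 2) ^+ 3.
    by field; rewrite !gt_eqF.
  rewrite mulrA ler_wpM2r ?invr_ge0 ?exprn_ge0 ?(ltW q0)//.
  rewrite ler_pdivlMr ?exprn_gt0// expRN mulrAC -mulrA mulrC ler_pdivrMr ?expR_gt0//.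
  have := expR_ge1Dx t; rewrite -{1}q8 => h.
  have h4 : (1 + q ^+ 2) ^+ 2 * (1 + q ^+ 2) ^+ 2 <= 8 * (1 + q ^+ 8).
    move: (q ^+ 2) (exprn_ge0 2 (ltW q0)) (exprM q 2 4) => r r_ge0 ->.
    have a1 : (1 + r) ^+ 2 <= 2 * (1 + r ^+ 2) by have := sqr_ge0 (1 - r); nra.
    have a2 : (1 + r ^+ 2) ^+ 2 <= 2 * (1 + r ^+ 4) by have := sqr_ge0 (1 - r ^+ 2); nra.
    have a3 : (1 + r) ^+ 2 * (1 + r) ^+ 2 <= (2 * (1 + r ^+ 2)) * (2 * (1 + r ^+ 2)).
      by apply: ler_pM => //; exact: sqr_ge0.
    by apply: le_trans a3 _; nra.
  by apply: le_trans h4 _; rewrite ler_wpM2l.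
have B0 : 0 <= q ^- 5 + q ^- 3 by rewrite addr_ge0// invr_ge0 exprn_ge0// ltW.
have q1 : 1 <= q + q^-1.
  have -> : q + q^-1 = (q ^+ 2 + 1) / q by field; rewrite gt_eqF.
  by rewrite ler_pdivlMr//; have := sqr_ge0 (q - 1); nra.
split.
  apply: (@le_trans _ _ (expR (- t) * ((q ^- 5 + q ^- 3) * (q + q^-1)))) => //.
  rewrite /F mulrC ler_wpM2l ?expR_ge0//; apply: le_trans B _.
  by rewrite ler_peMr.
apply: (@le_trans _ _ (8 * (expR (- t) * ((q ^- 5 + q ^- 3) * (q + q^-1))))); last first.
  by rewrite (_ : 64 * majorant t = 8 * (8 * majorant t)) ?ler_wpM2l//; ring.
rewrite [leRHS](_ : _ = 8 * (q + q^-1) * ((q ^- 5 + q ^- 3) * expR (- t))); last by ring.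
apply: ler_pM => //; first by rewrite mulr_ge0 ?expR_ge0.
by rewrite ler_wpM2r ?expR_ge0.
Qed.

Let mF x : measurable_fun setT (F x).
Proof. by rewrite /F; mea. Qed.

Let F_int x : 3 / 8 < x -> x < 5 / 8 -> hl.-integrable setT (EFin \o F x).
Proof.
move=> x1 x2; apply: (@le_integrable_hl _ _ (fun t => 8 * majorant t)) => //.
  by move=> t t0; rewrite ger0_norm ?mulr_ge0 ?expR_ge0//; have [] := F_bound x1 x2 t0.
have := integrableZl measurableT 8 (@integrable_majorant R).
by apply: eq_integrable => // x' _ /=; rewrite EFinM.
Qed.

Lemma der_euler : has_der (@euler_integral R) (1 / 2) dgamma_half.
Proof.
have -> : @euler_integral R = (fun x => \int[hl]_t F x t) by apply/funext => x; exact: eulerE.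
pose I : set R := `](3 / 8), (5 / 8)[.
have Ih : I (1 / 2) by rewrite /I /= in_itv/=; apply/andP; split; lra.
have dF x t : is_derive x 1 (F ^~ t) (ln t * F x t).
  by rewrite /F; apply: has_derP; [der|rewrite /=; ring].
have d1 x t : partial1of2 F x t = ln t * F x t.
  by rewrite partial1of2E; have [_ <-] := dF x t.
pose G t : R := 64 * majorant t.
have r40 (t : R) : 0 <= root4 t by exact: sqrtr_ge0.
have G0 t : 0 <= G t by rewrite mulr_ge0// invr_ge0 mulr_ge0 ?exprn_ge0// addr_ge0.
have intF x : I x -> (@hl R).-integrable setT (EFin \o F x).
  by rewrite /I /= in_itv/= => /andP[]; exact: F_int.
have intG : (@hl R).-integrable setT (EFin \o G).
  have := integrableZl measurableT 64 (@integrable_majorant R).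
  by apply: eq_integrable => // x' _ /=; rewrite EFinM.
have derF x t : I x -> setT t -> derivable (F ^~ t) x 1 by move=> _ _; have [] := dF x t.
have Gub x t : I x -> setT t -> `|partial1of2 F x t| <= G t.
  rewrite /I /= in_itv/= => /andP[x1 x2] _; rewrite d1.
  case: (leP t 0) => t0; first by rewrite ln0// mul0r normr0.
  rewrite normrM (ger0_norm (x := F x t)) ?mulr_ge0 ?expR_ge0//.
  by have [] := F_bound x1 x2 t0.
have D := @derivable_under_integral R _ (measurableTypeR R) (@hl R) F setT measurableT _ _ _ Ih intF derF G G0 intG Gub.
have E := @differentiation_under_integral R _ (measurableTypeR R) (@hl R) F setT measurableT _ _ _ Ih intF derF G G0 intG Gub.
have -> : dgamma_half = \int[hl]_y (partial1of2 F ^~ y) (1 / 2).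
  apply: eq_Rintegral_hl; first by mea.
    rewrite [X in measurable_fun _ X](_ : _ = (fun t => ln t * F (1 / 2) t)).
      by apply: measurable_funM => //; mea.
    by apply/funext => t; exact: d1.
  move=> t t0; rewrite d1 /F.
  have -> : expR ((1 / 2 - 1) * ln t) = (Num.sqrt t)^-1.
    rewrite -powR12_sqrt ?(ltW t0)// /powR gt_eqF// -expRN; congr expR; by field.
  by ring.
by rewrite -E derive1E; split.
Qed.

Lemma euler_half : euler_integral (1 / 2) = gamma_half.
Proof.
rewrite eulerE; apply: eq_Rintegral_hl; [exact: mF|by mea|].
move=> t t0; rewrite /F.
have -> : expR ((1 / 2 - 1) * ln t) = (Num.sqrt t)^-1.
  rewrite -powR12_sqrt ?(ltW t0)// /powR gt_eqF// -expRN; congr expR; by field.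
by rewrite mulrC.
Qed.

Lemma der_pochhammer n x : (forall i, (i < n)%N -> x + i%:R != 0) ->
  has_der (fun x => pochhammer x n) x (pochhammer x n * \sum_(i < n) (x + i%:R)^-1).
Proof.
elim: n => [|n IH] h.
  rewrite big_ord0 mulr0 (_ : (fun x => pochhammer x 0) = (fun=> 1)); first exact: der_cst.
  by apply/funext => y; rewrite /pochhammer big_ord0.
rewrite (_ : (fun x => pochhammer x n.+1) = (fun x => pochhammer x n * (x + n%:R))); last first.
  by apply/funext => y; rewrite /pochhammer big_ord_recr.
apply: has_derP; first by apply: der_mul; [apply: IH => i /ltnW; exact: h|der].
have hn := h n (ltnSn n).
by rewrite big_ord_recr /= {3}/pochhammer big_ord_recr /= -/(pochhammer x n); field.
Qed.

Lemma pochhammer_neq0 n x : (forall i, (i < n)%N -> x + i%:R != 0) -> pochhammer x n != 0.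
Proof. by move=> h; apply/prodf_neq0 => i _; exact: h. Qed.

(** Near the point, the function Gamma is by definition the quotient of the
    Euler integral at a point near $1/2$ by a Pochhammer symbol. *)
Lemma digamma_half (k : nat) : digamma (- (1 / 2) - k%:R : R) =
  dgamma_half / Num.sqrt pi + \sum_(j < k.+1) (j%:R + 1 / 2)^-1.
Proof.
pose x : R := - (1 / 2) - k%:R; rewrite -/x.
have xi i : (i < k.+1)%N -> x + i%:R != 0.
  rewrite ltnS => ik; have : i%:R <= k%:R :> R by rewrite ler_nat.
  by move=> h; rewrite lt_eqF// /x; lra.
have k0 : 0 <= k%:R :> R by [].
have near_x : \forall y \near x, euler_integral (y + k.+1%:R) / pochhammer y k.+1 = Gamma y.
  near=> y; have y1 : - (k.+1%:R) < y by near: y; apply: lt_nbhsr; rewrite /x -natr1; lra.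
  have y2 : y < - k%:R by near: y; apply: lt_nbhsl; rewrite /x; lra.
  rewrite /Gamma ifF; last by apply/negbTE; rewrite -leNgt; lra.
  rewrite (@truncn_def _ _ k)//; apply/andP; split; lra.
have xk : x + k.+1%:R = 1 / 2 by rewrite /x -natr1; field.
have p0 := pochhammer_neq0 xi; have g0 : 0 < Num.sqrt pi :> R by rewrite sqrtr_gt0 pi_gt0.
have d : has_der (fun y => euler_integral (y + k.+1%:R) / pochhammer y k.+1) x
    ((dgamma_half - Num.sqrt pi * \sum_(i < k.+1) (x + i%:R)^-1) / pochhammer x k.+1).
  apply: has_derP.
    apply: der_mul.
      apply: (@der_comp _ (@euler_integral R) (fun y => y + k.+1%:R)); last by der.
      by rewrite xk; exact: der_euler.
    by apply: der_inv; [exact: der_pochhammer|].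
  by rewrite /= xk euler_half gamma_halfE; field.
have [_ e] := near_eq_is_derive near_x d.
have e2 : Gamma x = Num.sqrt pi / pochhammer x k.+1.
  by rewrite -(nbhs_singleton near_x) xk euler_half gamma_halfE.
rewrite /digamma derive1E e e2.
have -> : \sum_(i < k.+1) (x + i%:R)^-1 = - \sum_(j < k.+1) (j%:R + 1 / 2)^-1.
  rewrite (reindex_inj rev_ord_inj) /= -sumrN; apply: eq_bigr => i _.
  rewrite -invrN; congr (_^-1); rewrite subSS natrB; last by rewrite -ltnS.
  by rewrite /x; ring.
by move: g0; move: (Num.sqrt pi) => s s0; field; rewrite p0 gt_eqF.
Unshelve. all: by end_near. Qed.

End GammaHalf.

(** * The power series of the inverse kernels *)

Section InverseKernelSeries.
Context {R : realType}.
Implicit Types (z x : R).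

Lemma cvg_LT0 (phi : R -> R) I : has_int phi I -> LT phi z @[z --> 0^'+] --> I.
Proof.
move=> hp; apply/cvg_at_rightP => u [u0 uc].
have mp := has_int_measurable hp; have [ip <-] := hp.
have [|||||_ c] := @hl_dct R (fun n v => expR (- (u n * v)) * phi v) phi (fun v => `|phi v|).
- by move=> n; apply: measurable_funM => //; mea.
- exact: mp.
- move=> v v0; rewrite -[X in _ --> X]mul1r; apply: cvgM; last exact: cvg_cst.
  have := continuous_cvg _ (@continuous_expR R (- (0 * v))) (cvgN (cvgM uc (cvg_cst v))).
  by rewrite mul0r oppr0 expR0 => h; exact: h.
- move=> n v v0; rewrite normrM (ger0_norm (expR_ge0 _)) ler_piMl//.
  by rewrite -[leRHS]expR0 ler_expR oppr_le0 mulr_ge0// ltW// u0.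
- exact: integrable_abse ip.
exact: c.
Qed.

(** Integrating a bound on the derivative of a function that vanishes at the
    origin. *)
Lemma growth (h dh : R -> R) (C : R) m :
  (forall z, 0 < z -> has_der h z (dh z)) -> h z @[z --> 0^'+] --> (0 : R) ->
  (forall z, 0 < z -> `|dh z| <= C * (z ^+ m / m`!%:R)) ->
  forall z, 0 < z -> `|h z| <= C * (z ^+ m.+1 / (m.+1)`!%:R).
Proof.
move=> hd h0 hb z z0; pose p x := C * (x ^+ m.+1 / (m.+1)`!%:R).
have fm : m`!%:R != 0 :> R by rewrite pnatr_eq0 -lt0n fact_gt0.
have m1 : m.+1%:R != 0 :> R by [].
have dp x : has_der p x (C * (x ^+ m / m`!%:R)).
  apply: has_derP; first by rewrite /p; der.
  rewrite /= factS natrM; move: (m.+1%:R : R) m1 (m`!%:R : R) fm => u u0 q q0.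
  by field; rewrite u0 q0.
have p0 : p x @[x --> 0^'+] --> (0 : R).
  by apply: con_at_right; [rewrite /p; con|rewrite /p expr0n/= mul0r mulr0].
rewrite ler_norml; apply/andP; split.
  rewrite -subr_ge0 opprK; apply: (@der_ge0 R (fun x => h x + p x) (fun x => dh x + C * (x ^+ m / m`!%:R))) => //.
  - by move=> x x0; apply: der_add => //; exact: hd.
  - by move=> x x0; have := hb x x0; rewrite ler_norml => /andP[+ _]; rewrite -subr_ge0 opprK.
  - by have := cvgD h0 p0; rewrite addr0 => hh; exact: hh.
rewrite -subr_ge0; apply: (@der_ge0 R (fun x => p x - h x) (fun x => C * (x ^+ m / m`!%:R) - dh x)) => //.
- by move=> x x0; apply: der_add => //; apply: der_opp; exact: hd.
- by move=> x x0; have := hb x x0; rewrite ler_norml => /andP[_]; rewrite -subr_ge0.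
- by have := cvgB p0 h0; rewrite subr0 => hh; exact: hh.
Qed.

Lemma cvg_sqrt_ln (C D : R) : Num.sqrt z * (C - D * ln z) @[z --> 0^'+] --> (0 : R).
Proof.
apply: (@cvg0_bound _ _ _ _ _ (fun z => `|C| * root4 z ^+ 2 + 4 * `|D| * (root4 z ^+ 3 + root4 z))).
  near=> z; have z0 : 0 < z by near: z; exact: nbhs_right_gt.
  have r0 := root4_gt0 z0; have L := ln_root4 z0.
  rewrite -root4_sqr// normrM (ger0_norm (sqr_ge0 _)).
  apply: (@le_trans _ _ (root4 z ^+ 2 * (`|C| + `|D| * (4 * (root4 z + (root4 z)^-1))))).
    apply: ler_wpM2l; first exact: sqr_ge0.
    by apply: le_trans (ler_normB _ _) _; rewrite lerD2l normrM ler_wpM2l.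
  by rewrite le_eqVlt; apply/orP; left; apply/eqP; field; rewrite gt_eqF.
apply: con_at_right; first by rewrite /root4; con.
by rewrite /root4 !sqrtr0 !expr0n /= !mulr0 addr0 mulr0 addr0.
Unshelve. all: by end_near. Qed.

Let der_expn n z : 0 < z -> has_der (fun z => z ^+ n) z (n%:R * (z ^+ n / z)).
Proof.
move=> z0; apply: has_derP; first by der.
by case: n => [|n]; rewrite ?mul0r//= mulr1 exprSr mulfK// gt_eqF.
Qed.

Let der_rt z : 0 < z -> has_der (@Num.sqrt R) z (2 * Num.sqrt z)^-1.
Proof. by move=> z0; apply: (@has_derP _ (fun x => Num.sqrt x)); [der|rewrite mulr1]. Qed.

Let der_ln1 z : 0 < z -> has_der (@ln R) z z^-1.
Proof. by move=> z0; apply: (@has_derP _ (fun x => ln x)); [der|rewrite mulr1]. Qed.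

(* For the cosine sg = 1 and c1 is minus the sine; for the sine sg = -1 and
   c1 is the cosine. *)
Variables (sg : R) (c c1 : R -> R).
Hypothesis dc : forall x, has_der c x (c1 x).
Hypothesis dc1 : forall x, has_der c1 x (- c x).
Hypothesis cb : forall x, `|c x| <= 1.
Hypothesis c0 : c 0 = (1 + sg) / 2.
Hypothesis c10 : c1 0 = (1 - sg) / 2.

Let a : R := - (@beta R * pi / 2).
Let b : R := - sg * @beta R.
Let k2 : R := @kappa R / 2.
Let om := omega a b.
Let ph (u : R) : R := (Num.sqrt u)^-1 * (a + b * ln u) / (1 + u ^+ 2).

Definition inverse_kernel z := k2 * c z + LT om z.
Let E z := LT ph z.
Let e0 z := k2 * c1 z + E z.

Let pi0 : 0 < @pi R. Proof. exact: pi_gt0. Qed.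
Let sp0 : 0 < Num.sqrt (@pi R). Proof. by rewrite sqrtr_gt0. Qed.
Let sp2 : Num.sqrt (@pi R) ^+ 2 = pi. Proof. by rewrite sqr_sqrtr// ltW. Qed.

Let r2 : 0 < Num.sqrt (2 : R). Proof. by rewrite sqrtr_gt0. Qed.
Let r22 : Num.sqrt (2 : R) ^+ 2 = 2. Proof. by rewrite sqr_sqrtr. Qed.

Let intP : has_int ph (a * (pi / Num.sqrt 2) - b * (pi ^+ 2 * Num.sqrt 2 / 4)).
Proof. exact: int_phi0. Qed.

Let intW : has_int om (a * (pi / Num.sqrt 2) + b * (pi ^+ 2 * Num.sqrt 2 / 4)).
Proof.
apply: has_int_eq (has_int_add (has_int_scale a (int_sqrt (@ltr01 R)))
  (has_int_scale b (int_lns (@ltr01 R)))) _ _ _.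
- exact: measurable_omega.
- by move=> u u0; rewrite /om /omega expr1n; ring.
- by rewrite ln1 sqrtr1 !mulr1 mul0r add0r divr1.
Qed.

Let lP : lapl ph. Proof. exact: lapl_integrable (has_int_integrable intP). Qed.
Let lW : lapl om. Proof. exact: lapl_integrable (has_int_integrable intW). Qed.

Let rpi : @kappa R = Num.sqrt 2 / Num.sqrt pi.
Proof. by rewrite /kappa sqrtrM// sqrtrV// ltW. Qed.

Let bpi : @beta R * pi ^+ 2 = (Num.sqrt pi)^-1.
Proof.
rewrite /beta; have p0 : pi != 0 :> R by rewrite gt_eqF.
move: sp0 p0; move: (Num.sqrt (@pi R)) => s s0; move: (@pi R) => p p0.
by field; rewrite p0 gt_eqF.
Qed.

Let piV : pi / Num.sqrt 2 = pi * Num.sqrt 2 / 2 :> R.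
Proof. by rewrite -[X in _ = _ / X]r22; field; rewrite gt_eqF. Qed.

(** The constant [beta] is also the one for which the trigonometric and the
    Laplace part cancel at the origin. *)
Let Y0 : inverse_kernel z @[z --> 0^'+] --> (0 : R).
Proof.
have cc : c z @[z --> 0^'+] --> c 0 by apply: con_at_right => //; exact: der_continuous (dc 0).
have h := cvgD (cvgM (cvg_cst k2) cc) (cvg_LT0 intW).
have e : k2 * c 0 + (a * (pi / Num.sqrt 2) + b * (pi ^+ 2 * Num.sqrt 2 / 4)) = 0.
  rewrite piV c0 /k2 rpi /a /b.
  transitivity ((1 + sg) * Num.sqrt 2 / 4 * ((Num.sqrt pi)^-1 - @beta R * pi ^+ 2)).
    move: sp0; move: (@beta R) (Num.sqrt (2 : R)) (Num.sqrt (@pi R)) => B r w; move: (@pi R) => p w0.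
    by field; rewrite gt_eqF.
  by rewrite bpi subrr mulr0.
by move: h; rewrite e => hh; exact: hh.
Qed.

Let e00 : e0 z @[z --> 0^'+] --> (0 : R).
Proof.
have cc : c1 z @[z --> 0^'+] --> c1 0 by apply: con_at_right => //; exact: der_continuous (dc1 0).
have h := cvgD (cvgM (cvg_cst k2) cc) (cvg_LT0 intP).
have e : k2 * c1 0 + (a * (pi / Num.sqrt 2) - b * (pi ^+ 2 * Num.sqrt 2 / 4)) = 0.
  rewrite piV c10 /k2 rpi /a /b.
  transitivity ((1 - sg) * Num.sqrt 2 / 4 * ((Num.sqrt pi)^-1 - @beta R * pi ^+ 2)).
    move: sp0; move: (@beta R) (Num.sqrt (2 : R)) (Num.sqrt (@pi R)) => B r w; move: (@pi R) => p w0.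
    by field; rewrite gt_eqF.
  by rewrite bpi subrr mulr0.
by move: h; rewrite e => hh; exact: hh.
Qed.

Let psi (k : nat) : R := digamma (- (1 / 2) - (2 * k)%:R).
Let D : R := sg * (2 / pi).
Let Cc k := 1 + D * psi k.
Let A k : R := (pi * pochhammer (3 / 2) (2 * k))^-1.
Let s_ k : R := (2 * k)%:R + 1 / 2.
Let zeta k z := A k * (z ^+ (2 * k) * (Num.sqrt z * (Cc k - D * ln z))).
Let zeta1 k z := A k * (z ^+ (2 * k) / Num.sqrt z * (s_ k * (Cc k - D * ln z) - D)).

Let der_zeta k z : 0 < z -> has_der (zeta k) z (zeta1 k z).
Proof.
move=> z0; apply: has_derP.
  apply: der_mul; first exact: der_cst.
  apply: der_mul; first exact: der_expn.
  apply: der_mul; first exact: der_rt.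
  apply: der_add; first exact: der_cst.
  by apply: der_opp; apply: der_mul; [exact: der_cst|exact: der_ln1].
have sz : 0 < Num.sqrt z by rewrite sqrtr_gt0.
rewrite /zeta1 /s_ /=; move: (sqr_sqrtr (ltW z0)) sz.
move: (z ^+ (2 * k)) (ln z) (A k) (Cc k) ((2 * k)%:R : R) D => q l a' c' n d'.
move: (Num.sqrt z) => r <- r_gt0.
by field; rewrite gt_eqF.
Qed.

Let pochS k : pochhammer (3 / 2 : R) (2 * k.+1) =
  pochhammer (3 / 2) (2 * k) * ((s_ k.+1 - 1) * s_ k.+1).
Proof.
rewrite mulnS addSn addSn add0n /pochhammer !big_ord_recr /= -mulrA; congr (_ * _).
by rewrite /s_ mulnS addSn addSn add0n -!natr1; congr (_ * _); field.
Qed.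

(** The recursion of the psi function, applied twice. *)
Let psiS k : psi k.+1 = psi k + (s_ k.+1 - 1)^-1 + (s_ k.+1)^-1.
Proof.
rewrite /psi !digamma_half mulnS addSn addSn add0n !big_ord_recr /= !addrA.
by congr (_ + _^-1 + _^-1); rewrite /s_ mulnS addSn addSn add0n -!natr1; field.
Qed.

Let poch_neq0 k : pochhammer (3 / 2 : R) k != 0.
Proof. by apply: pochhammer_neq0 => i _; rewrite gt_eqF// ltr_wpDr. Qed.

(** Two differentiations of a term lower its index by one: the power of $z$
    contributes $s(s-1)$, which is the ratio of two Pochhammer symbols, and the
    logarithm shifts the psi value by $1/s+1/(s-1)$. *)
Let der_zeta1 k z : 0 < z -> has_der (zeta1 k.+1) z (zeta k z).
Proof.
move=> z0; have sz : 0 < Num.sqrt z by rewrite sqrtr_gt0.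
apply: has_derP.
  apply: der_mul; first exact: der_cst.
  apply: der_mul.
    apply: der_mul; first exact: der_expn.
    by apply: der_inv; [exact: der_rt|rewrite gt_eqF].
  apply: der_add; last exact: der_cst.
  apply: der_mul; first exact: der_cst.
  apply: der_add; first exact: der_cst.
  by apply: der_opp; apply: der_mul; [exact: der_cst|exact: der_ln1].
have s1 : 0 < s_ k.+1 - 1.
  have e : (2 * k.+1)%:R = (2 * k)%:R + 2 :> R by rewrite mulnS natrD addrC.
  by have : 0 <= (2 * k)%:R :> R by []; rewrite /s_ e; lra.
have s2 : 0 < s_ k.+1 by move: s1; lra.
have nE : (2 * k.+1)%:R = s_ k.+1 - 1 / 2 :> R by rewrite /s_ addrK.
rewrite /zeta /A pochS /Cc psiS nE /=.
have -> : z ^+ (2 * k.+1) = z ^+ (2 * k) * z ^+ 2 by rewrite -exprD mulnS addnC.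
have p0 := poch_neq0 (2 * k); have pn : pi != 0 :> R by rewrite gt_eqF.
move: (sqr_sqrtr (ltW z0)) sz s1 s2 p0 pn.
move: (z ^+ (2 * k)) (ln z) (s_ k.+1) (psi k) D (pochhammer (3 / 2 : R) (2 * k)) => q l s p' d' P.
move: (Num.sqrt z) (@pi R) => r w <- r_gt0 s1 s2 p0 w0.
by field; rewrite w0 p0 !gt_eqF.
Qed.

Let der_e0 z : 0 < z -> has_der e0 z (- inverse_kernel z).
Proof.
move=> z0; have h : LT (fun u => u * ph u) z = LT om z.
  apply: (LT_eq lW z0) => //; first by rewrite /ph; mea.
  move=> u u0; rewrite /ph /om /omega; have su : 0 < Num.sqrt u by rewrite sqrtr_gt0.
  move: (sqr_sqrtr (ltW u0)) su; move: (Num.sqrt u) (ln u) => r l <- r0.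
  by field; rewrite !gt_eqF// ltr_pwDl ?sqr_ge0.
apply: has_derP.
  apply: der_add; last exact: der_LT.
  by apply: der_mul; [exact: der_cst|exact: dc1].
by rewrite h /inverse_kernel; ring.
Qed.

(** The derivative of the closed form splits into a part bounded near the
    origin and the transform of $u^{-1/2}(a+b\log u)$, which the scaling
    $u\mapsto u/z$ evaluates; the latter is the derivative of the first term of
    the series. *)
Let der_Y z : 0 < z -> has_der inverse_kernel z (e0 z + zeta1 0 z).
Proof.
move=> z0.
have h : LT (fun u => u * om u) z + E z =
    (Num.sqrt z)^-1 * ((a - b * ln z) * @gamma_half R + b * @dgamma_half R).
  rewrite -LT_psi0//; apply/esym/has_intE.
  apply: has_int_eq (has_int_add (lapl_has_int (lapl_mul lW) z0) (lapl_has_int lP z0)) _ _ _ => //.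
    by mea.
  move=> u u0; rewrite /ph /om /omega; have su : 0 < Num.sqrt u by rewrite sqrtr_gt0.
  move: (sqr_sqrtr (ltW u0)) su; move: (Num.sqrt u) (ln u) => r l <- r0.
  by field; rewrite !gt_eqF// ltr_pwDl ?sqr_ge0.
apply: has_derP.
  apply: der_add; last exact: der_LT.
  by apply: der_mul; [exact: der_cst|exact: dc].
rewrite /e0 /= mulr0 addr0 -addrA; congr (_ + _).
rewrite (_ : - LT (fun u => u * om u) z = E z - (LT (fun u => u * om u) z + E z)); last by ring.
rewrite h; congr (_ + _).
rewrite /zeta1 /A /Cc /psi /s_ muln0 digamma_half big_ord_recr big_ord0 /= gamma_halfE.
rewrite /a /b /D /beta expr0 /pochhammer big_ord0.
have sz : 0 < Num.sqrt z by rewrite sqrtr_gt0.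
have pn : pi != 0 :> R by rewrite gt_eqF.
move: sz sp0 pn sp2; move: (Num.sqrt z) (ln z) (@dgamma_half R) (Num.sqrt (@pi R)) => r l dg w.
move: (@pi R) => p r_gt0 w_gt0 p0 e.
rewrite -e in p0 *; by field; rewrite !gt_eqF.
Qed.

Fixpoint remainder n z := if n is m.+1 then remainder m z - (-1) ^+ n * zeta n z else inverse_kernel z - zeta 0 z.
Fixpoint remainder_der n z := if n is m.+1 then remainder_der m z - (-1) ^+ n * zeta1 n z else e0 z.
(* Minus the second derivative of [remainder n]. *)
Let ff n z := if n is m.+1 then remainder m z else inverse_kernel z.

Let der_dd n z : 0 < z -> has_der (remainder n) z (remainder_der n z).
Proof.
move=> z0; elim: n => [|n IH].
  apply: has_derP; first by apply: der_add; [exact: der_Y|apply: der_opp; exact: der_zeta].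
  by rewrite /= addrK.
apply: has_derP.
  by apply: der_add; [exact: IH|apply: der_opp; apply: der_mul; [exact: der_cst|exact: der_zeta]].
by rewrite /=; ring.
Qed.

Let der_ee n z : 0 < z -> has_der (remainder_der n) z (- ff n z).
Proof.
move=> z0; elim: n => [|n IH]; first exact: der_e0.
apply: has_derP.
  by apply: der_add; [exact: IH|apply: der_opp; apply: der_mul; [exact: der_cst|exact: der_zeta1]].
have -> : ff n.+1 z = ff n z - (-1) ^+ n * zeta n z.
  by case: n {IH} => [|n] //=; rewrite expr0 mul1r.
by rewrite /= exprS; ring.
Qed.

Let zeta_cvg k : zeta k z @[z --> 0^'+] --> (0 : R).
Proof.
have h : (fun z : R => z ^+ (2 * k)) @ 0^'+ --> (0 ^+ (2 * k) : R) by apply: con_at_right => //; con.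
have := cvgM (cvg_cst (A k)) (cvgM h (cvg_sqrt_ln (Cc k) D)).
by rewrite !mulr0 => hh; exact: hh.
Qed.

Let zeta1_cvg k : zeta1 k.+1 z @[z --> 0^'+] --> (0 : R).
Proof.
have h : (fun z : R => z ^+ (2 * k).+1) @ 0^'+ --> (0 ^+ (2 * k).+1 : R) by apply: con_at_right => //; con.
have hh : A k.+1 * (z ^+ (2 * k).+1 * (Num.sqrt z * (s_ k.+1 * Cc k.+1 - D - s_ k.+1 * D * ln z)))
    @[z --> 0^'+] --> (A k.+1 * (0 ^+ (2 * k).+1 * 0) : R).
  by apply: cvgM; [exact: cvg_cst|apply: cvgM; [exact: h|exact: cvg_sqrt_ln]].
rewrite !mulr0 in hh; apply: cvg_trans hh; apply: near_eq_cvg; near=> z.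
have z0 : 0 < z by near: z; exact: nbhs_right_gt.
have sz : 0 < Num.sqrt z by rewrite sqrtr_gt0.
rewrite /zeta1 mulnS addSn addSn add0n [z ^+ (2 * k).+2]exprSr.
move: (sqr_sqrtr (ltW z0)) sz; move: (z ^+ (2 * k).+1) (ln z) (Num.sqrt z) => q l r <- r_gt0.
by field; rewrite gt_eqF.
Unshelve. all: by end_near. Qed.

Let dd0 n : remainder n z @[z --> 0^'+] --> (0 : R).
Proof.
elim: n => [|n IH]; first by have := cvgB Y0 (zeta_cvg 0); rewrite subr0 => hh; exact: hh.
have := cvgB IH (cvgM (cvg_cst ((-1) ^+ n.+1 : R)) (zeta_cvg n.+1)).
by rewrite mulr0 subr0 => hh; exact: hh.
Qed.

Let ee0 n : remainder_der n z @[z --> 0^'+] --> (0 : R).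
Proof.
elim: n => [|n IH]; first exact: e00.
have := cvgB IH (cvgM (cvg_cst ((-1) ^+ n.+1 : R)) (zeta1_cvg n)).
by rewrite mulr0 subr0 => hh; exact: hh.
Qed.

Let C := k2 + \int[hl]_u `|om u|.

Let Y_bound z : 0 < z -> `|inverse_kernel z| <= C.
Proof.
move=> z0; apply: le_trans (ler_normD _ _) _; apply: lerD.
  have k0 : 0 <= k2 by rewrite divr_ge0// ltW// kappa_gt0.
  by rewrite normrM (ger0_norm k0) ler_piMr.
have [mo io] := lW; have h := lapl_has_int lW z0; have i1 := has_int_integrable h.
apply: le_trans (le_normr_Rintegral _ i1) _ => //.
have hw : has_int (fun u => `|om u|) (\int[hl]_u `|om u|).
  by split => //; exact: integrable_abse (has_int_integrable intW).
rewrite -lee_fin -(has_int_ereal (conj (integrable_abse i1) erefl : has_int (fun t => `|expR (- (z * t)) * om t|) _)).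
rewrite -(has_int_ereal hw); apply: ge0_le_integral_hl.
- by apply: measurable_normr; exact: has_int_measurable h.
- exact: measurable_normr.
move=> u u0; rewrite normr_ge0 normrM (ger0_norm (expR_ge0 _)) ler_piMl//.
by rewrite -[leRHS]expR0 ler_expR oppr_le0 mulr_ge0// ltW.
Qed.

Let ff_bound n z : 0 < z -> `|ff n z| <= C * (z ^+ (2 * n) / (2 * n)`!%:R).
Proof.
elim: n z => [|n IH] z z0; first by rewrite muln0 expr0 fact0 divr1 mulr1; exact: Y_bound.
have be := @growth (remainder_der n) _ C (2 * n) (@der_ee n) (ee0 n).
have bd := @growth (remainder n) _ C (2 * n).+1 (@der_dd n) (dd0 n).
rewrite mulnS addSn addSn add0n; apply: bd => // x x0; apply: be => // t t0.
by rewrite normrN; exact: IH.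
Qed.

Lemma inverse_kernel_series (u : nat -> R) z : 0 < z ->
  (forall k, Num.sqrt z / pi * u k = (-1) ^+ k * (z ^+ (2 * k) / pochhammer (3 / 2) (2 * k) *
     (Num.sqrt z / pi * (1 + sg * (2 / pi * digamma (- (1 / 2) - (2 * k)%:R) - 2 / pi * ln z))))) ->
  Num.sqrt z / pi * limn (series u) = inverse_kernel z.
Proof.
move=> z0 uE; have w0 : Num.sqrt z / pi != 0 by rewrite mulf_neq0 ?invr_eq0 ?gt_eqF ?sqrtr_gt0.
have pn : pi != 0 :> R by rewrite gt_eqF.
have uz k : Num.sqrt z / pi * u k = (-1) ^+ k * zeta k z.
  rewrite uE /zeta /A /Cc /D -/(psi k); congr (_ * _).
  have p0 := poch_neq0 (2 * k); move: pn p0; move: (@pi R) (pochhammer (3 / 2 : R) (2 * k)) => p P pn p0.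
  by field; rewrite p0 pn.
have part n : Num.sqrt z / pi * series u n = inverse_kernel z - ff n z.
  rewrite /series /= mulr_sumr; elim: n => [|n IH].
    by rewrite big_geq// subrr.
  rewrite big_nat_recr//= IH uz.
  have -> : remainder n z = ff n z - (-1) ^+ n * zeta n z.
    by case: n {IH} => [|n] //=; rewrite expr0 mul1r.
  by ring.
have f0 : ff n z @[n --> \oo] --> (0 : R).
  apply: (@cvg0_bound _ _ _ _ _ (fun n => C * (z ^+ (2 * n) / (2 * n)`!%:R))).
    by apply: nearW => n; exact: ff_bound.
  rewrite -(mulr0 C); apply: cvgM; first exact: cvg_cst.
  have h := @cvg_exp_coeff R z; apply: (cvg_comp (fun n => (2 * n)%N) _ _ h).
  exact: (@cvg_mulnl 2).
have l : series u n @[n --> \oo] --> (Num.sqrt z / pi)^-1 * (inverse_kernel z - 0).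
  rewrite (_ : series u = (fun n => (Num.sqrt z / pi)^-1 * (inverse_kernel z - ff n z))).
    by apply: cvgM; [exact: cvg_cst|apply: cvgB => //; exact: cvg_cst].
  by apply/funext => n; rewrite -part mulrA mulVf// mul1r.
by rewrite (cvg_lim _ l)// subr0 mulrA mulfV// mul1r.
Qed.

End InverseKernelSeries.

(** * Mean square integrals of complex functions *)

Local Notation Re := complex.Re.
Local Notation Im := complex.Im.

Section MeanSquareKernels.
Context {R : realType}.
Local Notation H := (L2space (@hl R)).
Implicit Types (k l : R -> R) (A B : op (@hl R)).

Let ae_filter : Filter (almost_everywhere (@hl R)). Proof. exact: ae_filter_ringOfSetsType. Qed.

(** The operator $A$ is given by the kernel $k(xt)$ on truncations. As these
    converge in norm and $A$ is bounded, $A$ is then the mean square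
    transform ([ms_op]); unlike the latter notion, this one is immediate for
    sums, multiples and products. *)
Definition msop k A := measurable_fun setT k /\ forall (f : H) (N : R), {ae hl, forall x,
  hl.-integrable setT (EFin \o (fun t => k (x * t) * cut N f t)) /\
  A (cut N f) x = kint hl (fun x t => k (x * t)) (cut N f) x}.

Let trig_int k (f : H) N x : measurable_fun setT k -> (forall x, `|k x| <= 1) ->
  hl.-integrable setT (EFin \o (fun t : R => k (x * t) * cut N f t)).
Proof.
move=> mk k1; have ic := cut_integrable N f; have mc := L2_measurable (cut N f).
apply: (@le_integrable_hl _ _ (fun t => `|cut N f t|)).
- by apply: measurable_funM => //; apply: measurableT_comp => //; mea.
- by move=> t _; rewrite normrM ler_piMl.
- exact: integrable_abse ic.
Qed.

Lemma msop_Fc : msop (@cos R) (@opFc R).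
Proof.
split; first exact: measurable_cos; move=> f N; have h := opFcE (cut_integrable N f).
apply: (@filterS _ _ ae_filter _ _ _ h) => x hx; split; last exact: hx.
exact: trig_int (@measurable_cos R) (@cos_max R).
Qed.

Lemma msop_Fs : msop (@sin R) (@opFs R).
Proof.
split; first exact: measurable_sin; move=> f N; have h := opFsE (cut_integrable N f).
apply: (@filterS _ _ ae_filter _ _ _ h) => x hx; split; last exact: hx.
exact: trig_int (@measurable_sin R) (@sin_max R).
Qed.

Lemma msop_kernel k A : measurable_fun setT k -> kernel_of A (fun x t => k (x * t)) -> msop k A.
Proof. by move=> mk h; split => // f N; exact: h. Qed.

Lemma msop_add k l A B : msop k A -> msop l B -> msop (fun z => k z + l z) (A ⊕ B).
Proof.
move=> [mk hk] [ml hl_]; split; first exact: measurable_funD.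
move=> f N; apply: (@filterS2 _ _ ae_filter _ _ _ _ (hk f N) (hl_ f N)) => x [i1 e1] [i2 e2].
have h := has_int_add (conj i1 erefl) (conj i2 erefl).
have e t : k (x * t) * cut N f t + l (x * t) * cut N f t = (k (x * t) + l (x * t)) * cut N f t.
  by rewrite mulrDl.
split.
  by have := has_int_integrable h; apply: eq_integrable => // t _ /=; rewrite e.
transitivity (A (cut N f) x + B (cut N f) x); first by [].
rewrite e1 e2 /kint -(has_intE h); apply: eq_Rintegral => t _; exact: e.
Qed.

Lemma msop_scale c k A : msop k A -> msop (fun z => c * k z) (c ⊙ A).
Proof.
move=> [mk hk]; split; first by apply: measurable_funM => //; mea.
move=> f N; apply: (@filterS _ _ ae_filter _ _ _ (hk f N)) => x [i1 e1].
have h := has_int_scale c (conj i1 erefl).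
split.
  by have := has_int_integrable h; apply: eq_integrable => // t _ /=; rewrite mulrA.
transitivity (c * A (cut N f) x); first by [].
rewrite e1 /kint -(has_intE h); apply: eq_Rintegral => t _; exact: mulrA.
Qed.

End MeanSquareKernels.

Section ComplexValued.
Context {R : realType}.
Local Notation H := (L2space (@hl R)).
Local Notation C := R[i].
Local Notation Id := (@opone _ _ R (@hl R)).
Local Notation mu := (@lebesgue_measure R).
Implicit Types (f g : R -> C) (u v p q : H) (k : R -> R) (A B : op (@hl R)) (T S : (R -> C) -> R -> C).

Let ae_filter : Filter (almost_everywhere (@hl R)). Proof. exact: ae_filter_ringOfSetsType. Qed.

Lemma ReM (z w : C) : Re (z * w) = Re z * Re w - Im z * Im w.
Proof. by case: z => a b; case: w => c d. Qed.
Lemma ImM (z w : C) : Im (z * w) = Re z * Im w + Im z * Re w.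
Proof. by case: z => a b; case: w => c d. Qed.
Lemma ReD (z w : C) : Re (z + w) = Re z + Re w.
Proof. by case: z => a b; case: w => c d. Qed.
Lemma ImD (z w : C) : Im (z + w) = Im z + Im w.
Proof. by case: z => a b; case: w => c d. Qed.
Lemma ReB (z w : C) : Re (z - w) = Re z - Re w.
Proof. by case: z => a b; case: w => c d. Qed.
Lemma ImB (z w : C) : Im (z - w) = Im z - Im w.
Proof. by case: z => a b; case: w => c d. Qed.

(** Exact equality on the half-line, rather than almost everywhere, makes the
    existence of $u$ and $v$ equivalent to [L2] ([L2P]). *)
Definition rep f u v := forall x : R, 0 < x -> Re (f x) = u x /\ Im (f x) = v x.

Let int_restrict (h : R -> R) : measurable_fun setT (h \_ Rplus) ->
  (\int[hl]_x (((h \_ Rplus) x) ^+ 2)%:E = \int[mu]_x (((h \_ Rplus) x) ^+ 2)%:E)%E.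
Proof.
move=> mh; rewrite integral_hl; last by apply/measurable_EFinP; exact: measurable_funX.
rewrite integral_mkcond; apply: eq_integral => x _; rewrite /patch; case xR : (x \in Rplus) => //.
by rewrite expr2 (_ : point = 0 :> R)// mul0r.
Qed.

Let L2_hl (h : R -> R) : (h \_ Rplus) \in Lfun mu 2%:E <-> (h \_ Rplus) \in Lfun (@hl R) 2%:E.
Proof.
split=> /Lfun2P[mh i]; apply/Lfun2P; split => //; first by rewrite int_restrict.
by rewrite -int_restrict.
Qed.

Let restr (h : R -> R) u : (forall x, 0 < x -> h x = u x) -> (h \_ Rplus) \in Lfun mu 2%:E.
Proof.
move=> hu; have -> : h \_ Rplus = (u : R -> R) \_ Rplus.
  by apply/funext => x; rewrite /patch; case: ifPn => // /set_mem/RplusE; exact: hu.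
apply/L2_hl/Lfun2P; have mu_ := L2_measurable u.
have mr : measurable_fun setT ((u : R -> R) \_ Rplus).
  by apply/(measurable_restrictT _ (@measurable_Rplus R)); exact: measurable_funTS.
split => //; apply: le_lt_trans (L2_lty u); apply: ge0_le_integral => //.
- by move=> x _; rewrite lee_fin sqr_ge0.
- by apply/measurable_EFinP; exact: measurable_funX.
- by apply/measurable_EFinP; exact: measurable_funX.
by move=> x _; rewrite lee_fin /patch; case: ifP => // _; have -> : point = 0 :> R by []; rewrite expr0n sqr_ge0.
Qed.

Lemma L2P f : L2 f <-> exists u v, rep f u v.
Proof.
split=> [[h1 h2]|[u [v h]]]; last by split; [apply: (@restr _ u)|apply: (@restr _ v)] => x /h[].
exists (toL2 ((L2_hl _).1 h1)), (toL2 ((L2_hl _).1 h2)) => x x0.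
have xR : x \in @Rplus R by rewrite inE; exact/RplusE.
have e (h : R -> R) : h x = (h \_ Rplus) x by rewrite /patch xR.
by split; [exact: (e (fun x => Re (f x)))|exact: (e (fun x => Im (f x)))].
Qed.

Lemma normL2E f u v : rep f u v -> normL2 f = Num.sqrt (hn u ^+ 2 + hn v ^+ 2).
Proof.
move=> h; pose g := (fun x => ComplexField.Normc.normc (f x)) \_ Rplus.
have mu1 := L2_measurable u; have mv1 := L2_measurable v.
have gE x : 0 < x -> g x = Num.sqrt (u x ^+ 2 + v x ^+ 2).
  move=> x0; have [<- <-] := h x x0; rewrite /g /patch mem_set; last exact/RplusE.
  by case: (f x).
have mw : measurable_fun setT (fun x => Num.sqrt (u x ^+ 2 + v x ^+ 2)).
  apply: (measurableT_comp (@measurable_sqrtr R)); apply: measurable_funD; exact: measurable_funX.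
have I : (\int[mu]_x (`|(EFin \o g) x| `^ 2) = (hn u ^+ 2 + hn v ^+ 2)%:E)%E.
  rewrite [RHS]EFinD !hn_EFin -ge0_integralD//; first last.
  - by apply/measurable_EFinP; exact: measurable_funX.
  - by move=> x _; rewrite lee_fin sqr_ge0.
  - by apply/measurable_EFinP; exact: measurable_funX.
  - by move=> x _; rewrite lee_fin sqr_ge0.
  rewrite integral_hl; last first.
    by apply: emeasurable_funD; apply/measurable_EFinP; exact: measurable_funX.
  rewrite [RHS]integral_mkcond; apply: eq_integral => x _.
  rewrite /patch; case: ifPn => xR.
    have x0 : 0 < x by move/set_mem : xR => /RplusE.
    rewrite /= gE// powR_mulrn// real_normK ?num_real// sqr_sqrtr//.
    by rewrite addr_ge0 ?sqr_ge0.
  by rewrite /g /= /patch (negbTE xR) normr0 powR0.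
rewrite /normL2 unlock -/g I poweR_EFin /=.
by rewrite powR12_sqrt// addr_ge0 ?sqr_ge0.
Qed.

Lemma eqL2E f g u v p q : rep f u v -> rep g p q ->
  eqL2 f g <-> u = p %[ae hl] /\ v = q %[ae hl].
Proof.
move=> hf hg; have e : {ae hl, forall x, f x = g x} <-> eqL2 f g by apply: ae_hl.
have gt0 : {ae hl, forall x : R, 0 < x} by exact: ae_hlW.
split=> [/e h|[h1 h2]].
  split; apply: (@filterS2 _ _ ae_filter _ _ _ _ gt0 h) => x x0 ex _;
    have [a1 a2] := hf x x0; have [b1 b2] := hg x x0.
    by rewrite -a1 -b1 ex.
  by rewrite -a2 -b2 ex.
apply/e; apply: (@filterS3 _ _ ae_filter _ _ _ _ _ gt0 h1 h2) => x x0 e1 e2.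
have [a1 a2] := hf x x0; have [b1 b2] := hg x x0.
by apply/eqP; rewrite eq_complex a1 a2 b1 b2 e1// e2// !eqxx.
Qed.

(** The map $T$ on complex functions applies $A$ to the real and the imaginary
    part. *)
Definition acts T A := forall f u v, rep f u v ->
  exists p q, [/\ rep (T f) p q, p = A u %[ae hl] & q = A v %[ae hl]].

Let ae_trans u v p : u = v %[ae hl] -> v = p %[ae hl] -> u = p %[ae hl].
Proof.
move=> h1 h2; apply: (@filterS2 _ _ ae_filter _ _ _ _ h1 h2) => x e1 e2 _.
by rewrite e1// e2.
Qed.

Let ae_sym u v : u = v %[ae hl] -> v = u %[ae hl].
Proof. by move=> h; apply: (@filterS _ _ ae_filter _ _ _ h) => x e _; rewrite e. Qed.

Lemma acts_comp T S A B : acts T A -> acts S B -> acts (fun f => T (S f)) (A ∘ B).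
Proof.
move=> hT hS f u v h; have [p [q [r1 e1 e2]]] := hS f u v h.
have [p' [q' [r2 e3 e4]]] := hT _ _ _ r1; exists p', q'; split => //.
  exact: ae_trans e3 (op_ae A e1).
exact: ae_trans e4 (op_ae A e2).
Qed.

Lemma acts_eq T A B : A ≡ B -> acts T A -> acts T B.
Proof.
move=> /opeqP AB hT f u v h; have [p [q [r1 e1 e2]]] := hT f u v h.
by exists p, q; split => //; [exact: ae_trans e1 (AB u)|exact: ae_trans e2 (AB v)].
Qed.

Lemma acts_norm_le T A (c : R) : 0 <= c -> acts T A -> (forall u, hn (A u) <= c * hn u) ->
  forall f, L2 f -> normL2 (T f) <= c * normL2 f.
Proof.
move=> c0 hT hA f /L2P[u [v r]]; have [p [q [r1 e1 e2]]] := hT f u v r.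
rewrite (normL2E r) (normL2E r1) (eq_hn e1) (eq_hn e2) -[c]ger0_norm// -sqrtr_sqr.
rewrite -sqrtrM ?sqr_ge0// ler_sqrt; last by rewrite mulr_ge0 ?addr_ge0 ?sqr_ge0.
by rewrite mulrDr -!exprMn; apply: lerD; apply: lerXn2r; rewrite ?nnegrE ?hn_ge0 ?mulr_ge0 ?hn_ge0.
Qed.

Lemma acts_norm_ge T A : acts T A -> (forall u, hn u <= hn (A u)) ->
  forall f, L2 f -> normL2 f <= normL2 (T f).
Proof.
move=> hT hA f /L2P[u [v r]]; have [p [q [r1 e1 e2]]] := hT f u v r.
rewrite (normL2E r) (normL2E r1) (eq_hn e1) (eq_hn e2) ler_sqrt ?addr_ge0 ?sqr_ge0//.
by apply: lerD; apply: lerXn2r; rewrite ?nnegrE ?hn_ge0.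
Qed.

Lemma acts_eqL2 T S A : acts T A -> acts S A -> forall f, L2 f -> eqL2 (T f) (S f).
Proof.
move=> hT hS f /L2P[u [v r]]; have [p [q [r1 e1 e2]]] := hT f u v r.
have [p' [q' [r2 e3 e4]]] := hS f u v r; apply/(eqL2E r1 r2); split.
  exact: ae_trans e1 (ae_sym e3).
exact: ae_trans e2 (ae_sym e4).
Qed.

Lemma acts_bounded T A : acts T A -> bounded_operator T.
Proof.
move=> hT; split.
- move=> f /L2P[u [v r]]; have [p [q [r1 _ _]]] := hT f u v r.
  by apply/L2P; exists p, q.
- move=> f g /L2P[u [v r]] /L2P[u' [v' r']] /(eqL2E r r')[eu ev].
  have [p [q [r1 e1 e2]]] := hT f u v r; have [p' [q' [r2 e3 e4]]] := hT g u' v' r'.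
  apply/(eqL2E r1 r2); split.
    exact: ae_trans e1 (ae_trans (op_ae A eu) (ae_sym e3)).
  exact: ae_trans e2 (ae_trans (op_ae A ev) (ae_sym e4)).
- move=> z f g /L2P[u [v r]] /L2P[u' [v' r']].
  have [p [q [r1 e1 e2]]] := hT f u v r; have [p' [q' [r2 e3 e4]]] := hT g u' v' r'.
  pose a := Re z; pose b := Im z.
  have r3 : rep (fun x => z * f x + g x) (a *: u + (- b *: v + u')) (a *: v + (b *: u + v')).
    move=> x x0; have [h1 h2] := r x x0; have [h3 h4] := r' x x0.
    rewrite ReD ImD ReM ImM h1 h2 h3 h4 !L2addE !L2scaleE /a /b; split; ring.
  have [p3 [q3 [r4 e5 e6]]] := hT _ _ _ r3.
  have r5 : rep (fun x => z * T f x + T g x) (a *: p + (- b *: q + p')) (a *: q + (b *: p + q')).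
    move=> x x0; have [h1 h2] := r1 x x0; have [h3 h4] := r2 x x0.
    rewrite ReD ImD ReM ImM h1 h2 h3 h4 !L2addE !L2scaleE /a /b; split; ring.
  have lin s t (m n o m' n' o' : H) : m' = A m %[ae hl] -> n' = A n %[ae hl] -> o' = A o %[ae hl] ->
      A (s *: m + (t *: n + o)) = s *: m' + (t *: n' + o') %[ae hl].
    move=> hm hn_ ho; have l1 := op_lin A s m (t *: n + o); have l2 := op_lin A t n o.
    have hh := @filterI _ _ ae_filter _ _ hm (@filterI _ _ ae_filter _ _ hn_ ho).
    apply: (@filterS3 _ _ ae_filter _ _ _ _ _ l1 l2 hh) => x k1 k2 [k3 [k4 k5]] _.
    by rewrite k1// L2addE L2scaleE k2// !L2addE !L2scaleE k3// k4// k5.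
  apply/(eqL2E r4 r5); split.
    exact: ae_trans e5 (lin _ _ _ _ _ _ _ _ e1 e2 e3).
  exact: ae_trans e6 (lin _ _ _ _ _ _ _ _ e2 e1 e4).
- exists (op_bnd A) => f; apply: acts_norm_le hT _ _; [exact: op_bnd_ge0|exact: op_bndP].
Qed.

Lemma acts_inverse T S A B : acts T A -> acts S B -> B ∘ A ≡ Id -> A ∘ B ≡ Id ->
  inverse_operators T S.
Proof.
have one T' : acts T' Id -> forall f, L2 f -> eqL2 (T' f) f.
  move=> h f /L2P[u [v r]]; have [p [q [r1 e1 e2]]] := h f u v r.
  by apply/(eqL2E r1 r); split; [exact: e1|exact: e2].
move=> hT hS BA AB; split.
  exact: one (acts_eq BA (acts_comp hS hT)).
exact: one (acts_eq AB (acts_comp hT hS)).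
Qed.

Let kint_L2m k A u N : msop k A ->
  kint hl (fun x t => k (x * t)) (cut N u) \in Lfun (@hl R) 2%:E.
Proof.
move=> [mk h]; apply/Lfun2P; split.
  apply: (@measurable_kintf _ (measurableTypeR R)); last exact: L2_measurable.
  by apply: measurableT_comp => //; mea.
apply: le_lt_trans (L2_lty (A (cut N u))); rewrite le_eqVlt; apply/orP; left; apply/eqP.
apply: ae_eq_integral => //.
- apply/measurable_EFinP; apply: measurable_funX; apply: (@measurable_kintf _ (measurableTypeR R)); last exact: L2_measurable.
  by apply: measurableT_comp => //; mea.
- by apply/measurable_EFinP; apply: measurable_funX; exact: L2_measurable.
by apply: (@filterS _ _ ae_filter _ _ _ (h u N)) => x [_ ->].
Qed.

Let trunc_part k k' (h : R -> R) u N x : measurable_fun setT k' -> (forall z, 0 < z -> k z = k' z) ->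
  (forall t, 0 < t -> h t = u t) -> 0 < N -> 0 < x ->
  \int[mu]_(t in `[N^-1, N]) (k (x * t) * h t) = kint hl (fun x t => k' (x * t)) (cut N u) x.
Proof.
move=> mk' kk' hu N0 x0; have mu1 := L2_measurable u.
have pos t : (t \in (`[N^-1, N]%classic : set R)) -> 0 < t.
  rewrite inE /= in_itv/= => /andP[a _]; apply: lt_le_trans a; by rewrite invr_gt0.
have mi : measurable_fun setT (\1_(win N) : R -> R) by exact: measurable_indic (measurable_win N).
rewrite /kint /Rintegral integral_hl; last first.
  apply/measurable_EFinP; apply: measurable_funM; last exact: L2_measurable (cut N u).
  by apply: measurableT_comp => //; mea.
congr fine; rewrite integral_mkcond [RHS]integral_mkcond; apply: eq_integral => t _.
rewrite /patch cutE indicE /win; case tN : (t \in (`[N^-1, N]%classic : set R)).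
  have t0 := pos t tN; rewrite mem_set; last exact/RplusE.
  by rewrite mul1r kk' ?mulr_gt0// hu.
by case: ifP => // _; rewrite mul0r mulr0.
Qed.

Let w_ k A (m : msop k A) N u : H := toL2 (kint_L2m u N m).

Let trunc_rep k k' A (m : msop k' A) f u v N : (forall z, 0 < z -> k z = k' z) ->
  rep f u v -> 0 < N -> rep (trunc_integral k N f) (w_ m N u) (w_ m N v).
Proof.
move=> kk' r N0 x x0; rewrite /trunc_integral /cintegral /=; split.
  rewrite [LHS](_ : _ = \int[mu]_(t in `[N^-1, N]) (k (x * t) * Re (f t))); last first.
    by apply: eq_Rintegral => t _; rewrite ReM /= mul0r subr0.
  by apply: (trunc_part m.1) => // t /r[].
rewrite [LHS](_ : _ = \int[mu]_(t in `[N^-1, N]) (k (x * t) * Im (f t))); last first.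
  by apply: eq_Rintegral => t _; rewrite ImM /= mul0r addr0.
by apply: (trunc_part m.1) => // t /r[].
Qed.

Let w_dist k A (m : msop k A) N u : hn (w_ m N u - A u) <= op_bnd A * hn (u - cut N u).
Proof.
have e : hn (w_ m N u - A u) = hn (A (cut N u) - A u).
  apply: eq_hn; apply: (@filterS _ _ ae_filter _ _ _ (m.2 u N)) => x [_ e] _.
  by rewrite !L2subE e.
by rewrite e hnBC; exact: hn_opB.
Qed.

Let ms_value k k' A f u v : msop k' A -> (forall z, 0 < z -> k z = k' z) -> rep f u v ->
  is_ms_integral k f (fun x => Complex (A u x) (A v x)).
Proof.
move=> m kk' r; set g := fun x => _; have rg : rep g (A u) (A v) by [].
split; first by apply/L2P; exists (A u), (A v).
  near=> N; have N0 : 0 < N by near: N; exact: nbhs_pinfty_gt.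
  by apply/L2P; exists (w_ m N u), (w_ m N v); exact: trunc_rep.
apply: (@cvg0_bound _ _ _ _ _ (fun N => op_bnd A * hn (u - cut N u) + op_bnd A * hn (v - cut N v))).
  near=> N; have N0 : 0 < N by near: N; exact: nbhs_pinfty_gt.
  have rd : rep (fun x => trunc_integral k N f x - g x) (w_ m N u - A u) (w_ m N v - A v).
    move=> x x0; have [a1 a2] := trunc_rep m kk' r N0 x0; have [b1 b2] := rg x x0.
    by rewrite ReB ImB a1 a2 b1 b2.
  rewrite (normL2E rd) ger0_norm ?sqrtr_ge0//.
  apply: (@le_trans _ _ (hn (w_ m N u - A u) + hn (w_ m N v - A v))); last first.
    by apply: lerD; exact: w_dist.
  have p0 := hn_ge0 (w_ m N u - A u); have q0 := hn_ge0 (w_ m N v - A v).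
  rewrite -[leRHS]ger0_norm ?addr_ge0// -sqrtr_sqr ler_sqrt ?sqr_ge0//.
  by rewrite sqrrD lerD2r lerDl mulrn_wge0// mulr_ge0.
have h := @cut_cvg R.
have : op_bnd A * hn (u - cut N u) + op_bnd A * hn (v - cut N v) @[N --> +oo]
  --> op_bnd A * 0 + op_bnd A * 0.
  by apply: cvgD; apply: cvgM; (exact: cvg_cst || exact: h).
by rewrite mulr0 addr0.
Unshelve. all: by end_near. Qed.

Let hn_le_norm f u v : rep f u v -> hn u <= normL2 f /\ hn v <= normL2 f.
Proof.
move=> r; rewrite (normL2E r); split.
  rewrite -[leLHS]ger0_norm ?hn_ge0// -sqrtr_sqr ler_sqrt ?addr_ge0 ?sqr_ge0//.
  by rewrite lerDl sqr_ge0.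
rewrite -[leLHS]ger0_norm ?hn_ge0// -sqrtr_sqr ler_sqrt ?addr_ge0 ?sqr_ge0//.
by rewrite lerDr sqr_ge0.
Qed.

(** The kernels of the theorem agree with measurable ones on the positive
    half-line, the only place where they are evaluated. *)
Lemma ms_op k k' A : msop k' A -> (forall z, 0 < z -> k z = k' z) ->
  (forall f, L2 f -> ms_convergent k f) /\ acts (ms_integral k) A.
Proof.
move=> m kk'; split=> [f /L2P[u [v r]]|f u v r]; first by eexists; exact: ms_value m kk' r.
have h0 := ms_value m kk' r; set g0 := (fun x => _) in h0.
have [LG _ cG] : is_ms_integral k f (ms_integral k f).
  by apply: (@xgetPex _ _ [set g | is_ms_integral k f g]); exists g0.
have [_ _ c0] := h0; have /L2P[p [q rG]] := LG; exists p, q.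
have c : normL2 (fun x => trunc_integral k N f x - ms_integral k f x) +
    normL2 (fun x => trunc_integral k N f x - g0 x) @[N --> +oo] --> (0 + 0 : R) by exact: cvgD.
rewrite addr0 in c; have rg : rep g0 (A u) (A v) by [].
have bnd : \forall N \near +oo, hn (p - A u) <= normL2 (fun x => trunc_integral k N f x - ms_integral k f x) +
    normL2 (fun x => trunc_integral k N f x - g0 x) /\
    hn (q - A v) <= normL2 (fun x => trunc_integral k N f x - ms_integral k f x) +
    normL2 (fun x => trunc_integral k N f x - g0 x).
  near=> N; have N0 : 0 < N by near: N; exact: nbhs_pinfty_gt.
  have tr := trunc_rep m kk' r N0.
  have r1 : rep (fun x => trunc_integral k N f x - ms_integral k f x) (w_ m N u - p) (w_ m N v - q).
    by move=> x x0; have [a1 a2] := tr x x0; have [b1 b2] := rG x x0; rewrite ReB ImB a1 a2 b1 b2.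
  have r2 : rep (fun x => trunc_integral k N f x - g0 x) (w_ m N u - A u) (w_ m N v - A v).
    by move=> x x0; have [a1 a2] := tr x x0; have [b1 b2] := rg x x0; rewrite ReB ImB a1 a2 b1 b2.
  have [h1 h2] := hn_le_norm r1; have [h3 h4] := hn_le_norm r2.
  split; apply: le_trans (hn_triangle _ _ _) (lerD _ _); [rewrite hnBC; exact: h1|exact: h3|rewrite hnBC; exact: h2|exact: h4].
have zero (s t : H) : hn (s - t) <= 0 -> s = t %[ae hl].
  move=> h; have e : hn (s - t) = 0 by apply/eqP; rewrite eq_le h hn_ge0.
  apply: (@filterS _ _ ae_filter _ _ _ (hn_eq0 e)) => x hx _; have := hx I.
  by rewrite L2subE => /eqP; rewrite subr_eq0 => /eqP.
split => //; apply: zero; apply: (ler_cvg_to (cvg_cst _) c); apply: filterS bnd => N; by case.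
Unshelve. all: by end_near. Qed.

Lemma acts_scaled c k A : acts (ms_integral k) A -> acts (scaled_ms_integral c k) (c ⊙ A).
Proof.
move=> h f u v r; have [p [q [r1 e1 e2]]] := h f u v r; exists (c *: p), (c *: q); split.
- move=> x x0; have [a1 a2] := r1 x x0.
  by rewrite /scaled_ms_integral ReM ImM /= !mul0r subr0 addr0 a1 a2.
- apply: (@filterS _ _ ae_filter _ _ _ e1) => x e _.
  by rewrite -[LHS]/(c * p x) e.
- apply: (@filterS _ _ ae_filter _ _ _ e2) => x e _.
  by rewrite -[LHS]/(c * q x) e.
Qed.

End ComplexValued.

(** * The two compositions *)

Section Kernels.
Context {R : realType}.
Implicit Types (z : R).

Lemma acts_cos : acts (@fourier_cos R) (@Fc1 R).
Proof. exact: acts_scaled (ms_op (@msop_Fc R) (fun z _ => erefl)).2. Qed.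

Lemma acts_sin : acts (@fourier_sin R) (@Fs1 R).
Proof. exact: acts_scaled (ms_op (@msop_Fs R) (fun z _ => erefl)).2. Qed.

Lemma acts_hartley : acts (@half_hartley R) (@Hp R).
Proof.
have h := acts_scaled (@kappa R) (ms_op (msop_add (@msop_Fc R) (@msop_Fs R)) (fun z _ => erefl)).2.
by apply: acts_eq h; exact: opscaleDr.
Qed.

Lemma msop_auxg : msop (@auxg R) (@opL R ∘ @opC1 R).
Proof.
have [mg ig] := @lapl_g R; apply: msop_kernel; first exact: measurable_LT mg.
apply: (kernel_LT (@schur_C1 R) mg ig) => v t v0 t0.
by rewrite /kC1; field; rewrite !gt_eqF ?addr_gt0 ?exprn_gt0.
Qed.

Lemma msop_auxf : msop (@auxf R) (@opL R ∘ @opC2 R).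
Proof.
have [mg ig] := @lapl_f R; apply: msop_kernel; first exact: measurable_LT mg.
apply: (kernel_LT (@schur_C2 R) mg ig) => v t v0 t0.
by rewrite /kC2; field; rewrite !gt_eqF ?addr_gt0 ?exprn_gt0.
Qed.

Lemma lapl_omega (a b : R) : lapl (omega a b).
Proof.
apply: (@lapl_bounded _ _ ((`|a| + 2 * `|b|) * 2)); first exact: measurable_omega.
move=> u u0; apply: le_trans (omega_bound a b u0) _.
have d0 : 0 < 1 + u ^+ 2 by rewrite ltr_pwDl ?sqr_ge0.
rewrite -mulrA ler_wpM2l ?addr_ge0 ?mulr_ge0// ler_pdivrMr//.
by have := sqr_ge0 (u - 1); nra.
Qed.

Lemma msop_omega (a b : R) : msop (LT (omega a b)) (@opL R ∘ @opW R a b).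
Proof.
have [mg ig] := lapl_omega a b; apply: msop_kernel; first exact: measurable_LT mg.
exact: (kernel_LT (schur_W a b) mg ig).
Qed.

Lemma kernelF_E z : 0 < z -> kernelF z = cos z + pi^-1 * auxg z.
Proof. by move=> z0; rewrite /kernelF -mulrA lommelS_g. Qed.

Lemma kernelG_E z : 0 < z -> kernelG z = sin z + pi^-1 * auxf z.
Proof. by move=> z0; rewrite /kernelG -mulrA lommelS_f. Qed.

Lemma kernel_c_E z : 0 < z -> kernel_c z = inverse_kernel 1 (@cos R) z.
Proof.
move=> z0; apply: (@inverse_kernel_series _ _ _ (fun x => - sin x)) => //.
- by move=> x; exact: is_derive_cos.
- by move=> x; apply: der_opp; exact: is_derive_sin.
- exact: cos_max.
- by rewrite cos0; field.
- by rewrite sin0 subrr mul0r oppr0.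
by move=> k; ring.
Qed.

Lemma kernel_s_E z : 0 < z -> kernel_s z = inverse_kernel (-1) (@sin R) z.
Proof.
move=> z0; apply: (@inverse_kernel_series _ _ _ (@cos R)) => //.
- by move=> x; exact: is_derive_sin.
- by move=> x; exact: is_derive_cos.
- exact: sin_max.
- by rewrite sin0 subrr mul0r.
- by rewrite cos0; field.
by move=> k; ring.
Qed.

Lemma msop_c : msop (inverse_kernel 1 (@cos R)) (@Tc R).
Proof.
have h := msop_add (msop_scale (@kappa R / 2) (@msop_Fc R))
  (msop_omega (- @beta R * pi / 2) (- @beta R)).
rewrite /Tc [inverse_kernel _ _](_ : _ = (fun z => @kappa R / 2 * cos z + LT (omega (- @beta R * pi / 2) (- @beta R)) z))//.
by apply/funext => z; rewrite /inverse_kernel mulN1r !mulNr.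
Qed.

Lemma msop_s : msop (inverse_kernel (-1) (@sin R)) (@Ts R).
Proof.
have h := msop_add (msop_scale (@kappa R / 2) (@msop_Fs R))
  (msop_omega (- (@beta R * pi / 2)) (@beta R)).
rewrite /Ts [inverse_kernel _ _](_ : _ = (fun z => @kappa R / 2 * sin z + LT (omega (- (@beta R * pi / 2)) (@beta R)) z))//.
by apply/funext => z; rewrite /inverse_kernel opprK mul1r.
Qed.

(** What the operator identities and the expressions of the two kernels give
    for either composition. *)
Lemma composition_thm (X : (R -> R[i]) -> R -> R[i]) (k l k' l' : R -> R) (A K T : op (@hl R)) :
  acts X A -> A ≡ (2 * @kappa R) ⊙ K ->
  msop k' K -> (forall z, 0 < z -> k z = k' z) ->
  msop l' T -> (forall z, 0 < z -> l z = l' z) ->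
  T ∘ A ≡ @opone _ _ R (@hl R) -> A ∘ T ≡ @opone _ _ R (@hl R) ->
  (forall f, hn f <= hn (A f) <= 8 * hn f) ->
  [/\ [/\ bounded_operator X, bounded_operator (ms_integral l) &
          inverse_operators X (ms_integral l)],
      forall f, L2 f -> ms_convergent k f /\
        eqL2 (X f) (scaled_ms_integral (2 * Num.sqrt (2 / pi)) k f),
      forall F : R -> R[i], L2 F -> ms_convergent l F &
      forall f, L2 f -> normL2 f <= normL2 (X f) <= 8 * normL2 f].
Proof.
move=> XA AK mk kk ml ll TA AT nA.
have [ck ak] := ms_op mk kk; have [cl al] := ms_op ml ll; split.
- split; [exact: acts_bounded XA|exact: acts_bounded al|exact: acts_inverse XA al TA AT].
- move=> f hf; split; first exact: ck.
  exact: acts_eqL2 (acts_eq AK XA) (acts_scaled _ ak) f hf.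
- exact: cl.
move=> f hf; apply/andP; split.
  by apply: (acts_norm_ge XA) => // u; have /andP[] := nA u.
by apply: (acts_norm_le _ XA) => // u; have /andP[] := nA u.
Qed.

End Kernels.

Theorem theorem6 (R : realType) :
  (let opF (f : R -> R[i]) := half_hartley (half_hartley (fourier_cos f)) in
   [/\ [/\ bounded_operator opF,
           bounded_operator (ms_integral (@kernel_c R)) &
           inverse_operators opF (ms_integral (@kernel_c R))],
       forall f, L2 f ->
         ms_convergent (@kernelF R) f /\
         eqL2 (opF f) (scaled_ms_integral (2 * Num.sqrt (2 / pi)) (@kernelF R) f),
       forall F : R -> R[i], L2 F -> ms_convergent (@kernel_c R) F &
       forall f, L2 f -> normL2 f <= normL2 (opF f) <= 8 * normL2 f]) /\
  (let opG (f : R -> R[i]) := half_hartley (half_hartley (fourier_sin f)) in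
   [/\ [/\ bounded_operator opG,
           bounded_operator (ms_integral (@kernel_s R)) &
           inverse_operators opG (ms_integral (@kernel_s R))],
       forall f, L2 f ->
         ms_convergent (@kernelG R) f /\
         eqL2 (opG f) (scaled_ms_integral (2 * Num.sqrt (2 / pi)) (@kernelG R) f),
       forall G : R -> R[i], L2 G -> ms_convergent (@kernel_s R) G &
       forall f, L2 f -> normL2 f <= normL2 (opG f) <= 8 * normL2 f]).
Proof.
split; [apply: (composition_thm _ (@opF_eq R) _ (@kernelF_E R) (@msop_c R) (@kernel_c_E R)
    (@Tc_opF R) (@opF_Tc R) (@hn_opF R))
  |apply: (composition_thm _ (@opG_eq R) _ (@kernelG_E R) (@msop_s R) (@kernel_s_E R)
    (@Ts_opG R) (@opG_Ts R) (@hn_opG R))].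
- exact: acts_comp (@acts_hartley R) (acts_comp (@acts_hartley R) (@acts_cos R)).
- exact: msop_add (@msop_Fc R) (msop_scale _ (@msop_auxg R)).
- exact: acts_comp (@acts_hartley R) (acts_comp (@acts_hartley R) (@acts_sin R)).
- exact: msop_add (@msop_Fs R) (msop_scale _ (@msop_auxf R)).
Qed.
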